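(* For any integers $k\ge\theta\ge 3$, there exists an $\alpha>1$ such that, unless $NP\subseteq DTIME(n^{\mathrm{polylog}(n)})$, the optimal value $OPT$ of $MIN$-$SCTM$, restricted to instances with $r_{ji}=c_i=1$ for all $i=1,\dots,n$, $j=1,\dots,m$, and with $|e_j|=k$ and $\theta_j=\theta$ for all $j$, cannot be approximated in polynomial time within the ratio of $O\left(\alpha^{\log^{1-\xi}n}\right)$ for any fixed constant $\xi>0$. Here $n$ is the number of nodes of the hypergraph.
   Context: Let $G$ be a connected hypergraph with node set $N_F=\{1,\dots,n\}$ and hyperedges $e_1,\dots,e_m\subseteq N_F$. Each pair of a node $i$ and a hyperedge $e_j$ with $i\in e_j$ has a benefit $r_{ji}\ge 0$, each node $i$ has an adoption cost $c_i>0$ and a seeding cost $w_i$, and each hyperedge $e_j$ has an adoption threshold $\theta_j$. It is assumed that $\sum_{j:\,i\in e_j}r_{ji}\ge c_i$ for all $i$. SCTM activation process: for a seed set $S_0\subseteq N_F$, define for $t=0,1,2,\dots$ $$\mathcal B_i(S_t)=\{j: i\in e_j,\ |S_t\cap e_j|\ge \theta_j-1\},\quad b_i(S_t)=\sum_{j\in\mathcal B_i(S_t)}r_{ji},\quad S_{t+1}=S_t\cup\{i\in N_F\setminus S_t: b_i(S_t)\ge c_i\}.$$ The sequence stabilizes after finitely many steps; its limit is $S_\infty$. $MIN$-$SCTM$ is the problem $OPT=\min\{\sum_{i\in S_0}w_i : S_0\subseteq N_F,\ S_\infty=N_F\}$. *)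

(* Defs.v *)
From mathcomp Require Import all_boot all_order all_algebra.

Set Implicit Arguments.
Unset Strict Implicit.
Unset Printing Implicit Defensive.

Import Order.TTheory GRing.Theory Num.Theory.

Local Open Scope ring_scope.

(* The nodes 1, ..., n and the hyperedges e_1, ..., e_m are numbered from 0.
   Hyperedges form an indexed family. The data are rational, so that an
   instance can be the input of an algorithm. [benefit j i] is meaningful only
   when [i \in edge j]: nothing below depends on its other values. *)
Record instance := Instance {
  nodes : nat;
  edges : nat;
  edge : 'I_edges -> {set 'I_nodes};
  benefit : 'I_edges -> 'I_nodes -> rat;
  acost : 'I_nodes -> rat;
  scost : 'I_nodes -> rat;
  threshold : 'I_edges -> nat }.

Definition adjacent (I : instance) : rel 'I_(nodes I) :=
  fun i i' => [exists j, (i \in edge j) && (i' \in @edge I j)].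

Definition connected_hypergraph (I : instance) : Prop :=
  (0 < nodes I)%N /\ forall i i' : 'I_(nodes I), connect (@adjacent I) i i'.

(* Seeding costs are nonnegative: an approximation ratio is meaningless for an
   optimal value of arbitrary sign. *)
Definition well_formed (I : instance) : Prop :=
  [/\ connected_hypergraph I,
      forall j i, i \in @edge I j -> 0 <= benefit j i,
      forall i, 0 < @acost I i,
      forall i, 0 <= @scost I i
    & forall i, @acost I i <= \sum_(j | i \in edge j) benefit j i].

Section Activation.
Variable I : instance.
Implicit Types (S : {set 'I_(nodes I)}) (i : 'I_(nodes I)).

(* The subtraction is truncated, which does not matter here: for a threshold 0
   the condition holds with either reading. *)
Definition active_edges S i : {set 'I_(edges I)} :=
  [set j | (i \in edge j) && (threshold j - 1 <= #|S :&: edge j|)%N].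

Definition influence S i : rat := \sum_(j in active_edges S i) benefit j i.

Definition spread_step S : {set 'I_(nodes I)} :=
  S :|: [set i | (i \notin S) && (acost i <= influence S i)].

Definition spread S (t : nat) : {set 'I_(nodes I)} := iter t spread_step S.

(* The limit S_oo; see [spread_stable]. *)
Definition spread_limit S : {set 'I_(nodes I)} := spread S (nodes I).

Lemma spread_stable S t : (nodes I <= t)%N -> spread S t = spread_limit S.
Proof.
have step_sub (A : {set 'I_(nodes I)}) : A \subset spread_step A by exact: subsetUl.
have grow u : spread_step (spread S u) = spread S u \/ (u <= #|spread S u|)%N.
  elim: u => [|u [fix_u|le_u]]; first by right.
    by left; rewrite /spread /= -/(spread S u) fix_u.
  have [fix_u|neq_u] := eqVneq (spread_step (spread S u)) (spread S u).
    by left; rewrite /spread /= -/(spread S u) fix_u.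
  right; apply: (leq_ltn_trans le_u); apply: proper_card.
  by rewrite properEneq eq_sym neq_u step_sub.
have fix_n : spread_step (spread_limit S) = spread_limit S.
  case: (grow (nodes I)) => // le_n; apply/eqP.
  by rewrite eq_sym eqEcard step_sub (leq_trans (max_card _)) // card_ord.
move=> /subnK <-; elim: (t - nodes I)%N => [//|u IHu].
by rewrite addSn /spread /= -/(spread S _) IHu fix_n.
Qed.

Definition seed_cost S : rat := \sum_(i in S) scost i.

(* [setT] is always feasible, so its cost can serve as the default value. *)
Definition OPT : rat :=
  \big[Order.min/seed_cost setT]_(S | spread_limit S == setT) seed_cost S.

Lemma OPT_min S : spread_limit S = setT -> OPT <= seed_cost S.
Proof. by move=> limS; apply: bigmin_le_cond; apply/eqP. Qed.

Lemma OPT_attained : exists2 S, spread_limit S = setT & OPT = seed_cost S.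
Proof.
have subT t : setT \subset spread setT t.
  elim: t => [//|t IHt]; exact: (subset_trans IHt (subsetUl _ _)).
have limT : spread_limit setT == setT by rewrite -subTset subT.
rewrite /OPT; elim/big_ind: _ => [|x y [A lA ->] [B lB ->]|S /eqP lS].
- by exists setT => //; apply/eqP.
- by case: (leP (seed_cost A) (seed_cost B)) => _; [exists A | exists B].
- by exists S.
Qed.

End Activation.

Definition unit_uniform (k theta : nat) (I : instance) : Prop :=
  [/\ well_formed I,
      forall j i, i \in @edge I j -> benefit j i = 1,
      forall i, @acost I i = 1,
      forall j, #|@edge I j| = k
    & forall j, @threshold I j = theta].

(* A self-delimiting code: [block x ++ y] determines [x] and [y]. *)
Definition block (x : seq bool) : seq bool :=
  flatten [seq [:: true; b] | b <- x] ++ [:: false].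

(* Binary expansion, least significant bit first. *)
Definition nat_bits (k : nat) : seq bool :=
  [seq odd (k %/ 2 ^ i) | i <- iota 0 (trunc_log 2 k).+1].

Definition code_nat (k : nat) : seq bool := block (nat_bits k).

Definition code_int (z : int) : seq bool := (z < 0) :: code_nat `|z|%N.

Definition code_rat (q : rat) : seq bool :=
  code_int (numq q) ++ code_int (denq q).

Definition code_instance (I : instance) : seq bool :=
  code_nat (nodes I) ++ code_nat (edges I)
  ++ flatten [seq code_nat (threshold j) ++ code_nat #|edge j|
                  ++ flatten [seq code_nat (val i) ++ code_rat (benefit j i)
                             | i <- enum (edge j)]
             | j : 'I_(edges I) <- enum 'I_(edges I)]
  ++ flatten [seq code_rat (acost i) ++ code_rat (scost i)
             | i : 'I_(nodes I) <- enum 'I_(nodes I)].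

Inductive move := Left | Stay | Right.

(* One tape, infinite in both directions. A tape symbol is [None] (blank),
   [Some (inl b)] (a bit) or [Some (inr a)] (an auxiliary symbol). The machine
   halts when its transition function is undefined. *)
Record machine := Machine {
  state : finType;
  aux : finType;
  start : state;
  delta : state -> option (bool + aux) ->
          option (state * option (bool + aux) * move) }.

Section Run.
Variable M : machine.

Definition symbol := option (bool + aux M).

(* [before] lists the symbols to the left of the head, nearest first; cells
   beyond either list are blank. *)
Record config := Config {
  cstate : state M;
  before : seq symbol;
  scanned : symbol;
  after : seq symbol }.

Definition init (x : seq bool) : config :=
  let w : seq symbol := [seq Some (inl b) | b <- x] in
  Config (start M) [::] (head None w) (behead w).

Definition step (c : config) : option config :=
  if delta (cstate c) (scanned c) is Some (s, a, d) then
    Some (match d with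
          | Left => Config s (behead (before c)) (head None (before c))
                             (a :: after c)
          | Stay => Config s (before c) a (after c)
          | Right => Config s (a :: before c) (head None (after c))
                              (behead (after c))
          end)
  else None.

Definition run (x : seq bool) (t : nat) : config :=
  iter t (fun c => odflt c (step c)) (init x).

Definition halted (c : config) : bool := ~~ isSome (step c).

(* All the bits left on the tape, from left to right. *)
Definition output (c : config) : seq bool :=
  pmap (fun a : symbol => if a is Some (inl b) then Some b else None)
       (rev (before c) ++ scanned c :: after c).

Definition computes (T : nat -> nat) (f : seq bool -> seq bool) : Prop :=
  forall x, halted (run x (T (size x))) /\ output (run x (T (size x))) = f x.

(* A word is accepted when the machine halts with output [true]. *)
Definition decides (T : nat -> nat) (L : seq bool -> Prop) : Prop :=
  forall x, halted (run x (T (size x)))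
            /\ (L x <-> output (run x (T (size x))) = [:: true]).

End Run.

(* Loaded only here: [classical_sets] shadows the names of [finset]. *)
From mathcomp Require Import boolp classical_sets reals topology normedtype.
From mathcomp Require Import sequences landau exp.
Import numFieldNormedType.Exports.
Local Open Scope classical_set_scope.
Local Open Scope ring_scope.

Definition language := seq bool -> Prop.

Definition polytime (f : seq bool -> seq bool) : Prop :=
  exists (M : machine) (d : nat), computes M (fun s => s ^ d + d)%N f.

Definition class_P (L : language) : Prop :=
  exists (M : machine) (d : nat), decides M (fun s => s ^ d + d)%N L.

Definition class_NP (L : language) : Prop :=
  exists2 V : language, class_P V &
  exists d : nat, forall x,
    L x <-> exists2 y, (size y <= size x ^ d + d)%N & V (block x ++ y).

Definition DTIME (R : realType) (f : nat -> R) (L : language) : Prop :=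
  exists (M : machine) (T : nat -> nat),
    (fun s => (T s)%:R : R) =O_\oo f /\ decides M T L.

Definition log2 (R : realType) (x : R) : R := ln x / ln 2.

(* DTIME(n^polylog(n)) is the union over c of the classes DTIME(n^(log n)^c). *)
Definition DTIME_quasipoly (R : realType) (L : language) : Prop :=
  exists c : nat, DTIME (fun s => s%:R `^ (log2 (s%:R : R) ^+ c)) L.

Definition NP_sub_quasipoly (R : realType) : Prop :=
  forall L, class_NP L -> DTIME_quasipoly R L.

(* Only a value has to be computed, not a seed set of that cost. *)
Definition OPT_approximable (R : realType) (P : instance -> Prop)
    (rho : nat -> R) : Prop :=
  exists2 A : seq bool -> seq bool, polytime A &
  forall I, P I -> exists q : rat,
    [/\ A (code_instance I) = code_rat q,
        OPT I <= q
      & ratr q <= rho (nodes I) * ratr (OPT I)].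

(* Main.v *)
(** Let L be in NP, with verifier V. From x one writes down an instance of
    quasi-polynomial size n whose optimal value grows by a factor above
    2^((log n)^(1 - xi)) when x is not in L. No PCP theorem is needed: local
    decoding is left to the activation process.

    Three hyperedges simulate a Horn rule a /\ b -> c, so an instance is a Horn
    system some of whose nodes may be bought at unit cost. Data of 2^m bits are
    encoded by the m-fold tensor power of the code sending (a, b) to the F = 2^m
    points of a line; an honest purchase is one value per position, F^m in all.
    Horn rules decode the data and derive the tableau of V on them. Two points
    determine a line, so decoding is unambiguous unless F^m + (F - 1)^m, which is
    at least (3/2) F^m, inputs are derived. Substituting the system for its own
    inputs t times amplifies the gap to (3/2)^t, while log n is O(m^2 t); with t
    about m^c and c large this beats the exponent 1 - xi. *)

Require Import Defs.
From mathcomp Require Import all_boot all_order all_algebra.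
From mathcomp Require Import zify lra boolp.

Set Implicit Arguments.
Unset Strict Implicit.
Unset Printing Implicit Defensive.

(** * Stack programs on a Turing machine *)

(** The conclusion concerns one-tape machines, so the reduction itself must become such a machine,
    composed with the given approximation machine; hence the compiler. Unary registers suffice for
    it, since the time allowed is polynomial in the size of the instance. Only the approximate value
    may be too large for unary: it is judged by the lengths of its numerator and denominator alone.
    The obstacle on the combinatorial side is that activation is monotone and cannot enforce
    consistency: a buyer may pay for several values at one position and derive a mixture of runs.
    This is not prevented but charged for. A copy with two values at one data bit already has the
    full amplified number of derived inputs, and from there on it is granted every conclusion; below
    that number the decoded word is unique and the tableau is a real run. The output of a copy is an
    input of its parent, so the charge is multiplied from level to level. The factor 3/2 comes from
    Bernoulli's inequality: 2 m is at most F = 2^m, so (F - 1)^m is at least half of F^m. *)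

Definition upd (T : Type) (s : nat -> T) r l : nat -> T :=
  fun r' => if r' == r then l else s r'.

Lemma upd_same (T : Type) (s : nat -> T) r : upd s r (s r) = s.
Proof. by apply: funext => i; rewrite /upd; case: eqP => [->|]. Qed.

Section Programs.
Variable G : finType.

(** [Case] pops register [r] and branches on the popped entry, if any; [Loop] pops until the
    register is empty. Branches are indexed by the finite alphabet, so a popped entry can be
    remembered in the finite control. [exec] is a relation because loops need not terminate. *)
Inductive prog :=
| Skip
| Push (r : nat) (g : G)
| Seq (p q : prog)
| Case (r : nat) (k : option G -> prog)
| Loop (r : nat) (k : G -> prog).

Implicit Types (s : nat -> seq G) (r t : nat) (g : G).

Inductive exec : prog -> (nat -> seq G) -> (nat -> seq G) -> nat -> Prop :=
| ESkip s : exec Skip s s 0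
| EPush r g s : exec (Push r g) s (upd s r (g :: s r)) 1
| ESeq p q s s1 s2 t1 t2 :
    exec p s s1 t1 -> exec q s1 s2 t2 -> exec (Seq p q) s s2 (t1 + t2)
| ECase r k s s' t :
    exec (k (ohead (s r))) (upd s r (behead (s r))) s' t ->
    exec (Case r k) s s' t.+1
| ELoop0 r k s : s r = [::] -> exec (Loop r k) s s 1
| ELoop r k g l s s1 s2 t1 t2 :
    s r = g :: l -> exec (k g) (upd s r l) s1 t1 ->
    exec (Loop r k) s1 s2 t2 -> exec (Loop r k) s s2 (t1 + t2).+1.

(** One unit of time pushes at most one entry. *)
Lemma exec_size p s s' t r : exec p s s' t -> size (s' r) <= size (s r) + t.
Proof.
elim=> {p s s' t} [s|r' g s|p q s s1 s2 t1 t2 _ h1 _ h2|r' k s s' t _ h||].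
- by rewrite addn0.
- by rewrite /upd; case: eqP => [->|_] /=; lia.
- lia.
- apply: (leq_trans h); rewrite /upd; case: eqP => [->|_]; last lia.
  by rewrite size_behead; lia.
- by move=> r0 k s _; rewrite leq_addr.
- move=> r' k g l s s1 s2 t1 t2 e _ h1 _ h2.
  move: h1 h2; rewrite /upd; case: eqP => [er|_]; last lia.
  by rewrite er e /=; lia.
Qed.

Fixpoint registers (p : prog) : nat :=
  match p with
  | Skip => 0
  | Push r _ => r.+1
  | Seq p q => maxn (registers p) (registers q)
  | Case r k => maxn r.+1 (\max_(o : option G) registers (k o))
  | Loop r k => maxn r.+1 (\max_(g : G) registers (k g))
  end.

Variables (R : nat) (bit : bool -> G).

Definition cell := {ffun 'I_R -> option G}.
(* [Some (inr None)] is the left end marker; cell i + 1 holds entry i, counted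
   from the bottom, of every register. *)
Definition tsym := option (bool + option cell).

Definition cell_get (c : cell) r : option G :=
  if insub r is Some j then c j else None.
Definition cell_set (c : cell) r v : cell :=
  [ffun j => if val j == r then v else c j].

Lemma cell_get_set c r r' v : r < R ->
  cell_get (cell_set c r v) r' = if r' == r then v else cell_get c r'.
Proof.
move=> lt_r; rewrite /cell_get; case: insubP => [j lt_j <-|].
  by rewrite ffunE.
by case: eqP => // ->; rewrite lt_r.
Qed.

(* A bit of the original input counts as an entry of register 0. *)
Definition view (x : tsym) : option cell :=
  match x with
  | None => Some [ffun=> None]
  | Some (inl b) => Some (cell_set [ffun=> None] 0 (Some (bit b)))
  | Some (inr c) => c
  end.

Definition cell_sym (c : cell) : tsym := Some (inr (Some c)).

(** A piece of finite control; the next state [None] leaves it. Compiled fragments are entered and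
    left with the head on the end marker, which makes sequencing immediate. [entry] is optional so
    that the empty program takes no step. *)
Record frag := Frag {
  fstate : finType;
  entry : option fstate;
  ftrans : fstate -> tsym -> option fstate * tsym * move }.

Definition shift d (i : nat) := match d with Left => i.-1 | Stay => i | Right => i.+1 end.

Definition fstep (F : frag) (c : option (fstate F) * nat * (nat -> tsym)) :=
  let: (o, p, f) := c in
  if o is Some a then
    let: (o', x, d) := ftrans a (f p) in (o', shift d p, upd f p x)
  else c.

Lemma steps_right F (a : fstate F) f j :
  (forall q, q < j -> ftrans a (f q) = (Some a, f q, Right)) ->
  iter j (@fstep F) (Some a, 0, f) = (Some a, j, f).
Proof.
elim: j => [//|j IH] h.
by rewrite iterS IH => [|q lt_q]; rewrite /= ?h ?upd_same //; lia.
Qed.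

Lemma steps_left F (a : fstate F) f j :
  (forall q, 0 < q <= j -> ftrans a (f q) = (Some a, f q, Left)) ->
  iter j (@fstep F) (Some a, j, f) = (Some a, 0, f).
Proof.
elim: j => [//|j IH] h; rewrite iterSr /= h ?upd_same ?leqnn //=.
by apply: IH => q lt_q; apply: h; lia.
Qed.

(** [fstep] idles once the fragment is left, so the embedded run, which stops at [exit], may take
    fewer than [n] steps. *)
Lemma embed_steps F H (inj : fstate F -> fstate H) (exit : option (fstate H)) n
    o p f p' f' :
  (forall a x, ftrans (inj a) x =
     let: (o, x', d) := ftrans a x in
     (if o is Some a' then Some (inj a') else exit, x', d)) ->
  iter n (@fstep F) (o, p, f) = (None, p', f') ->
  exists2 n', n' <= n &
    iter n' (@fstep H) (if o is Some a then Some (inj a) else exit, p, f)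
      = (exit, p', f').
Proof.
move=> hinj; elim: n o p f => [|n IH] o p f.
  by case=> -> -> ->; exists 0.
case: o => [a|]; last first.
  rewrite iterSr /= => h.
  by have [n' le_n' e] := IH None p f h; exists n'; rewrite // ltnW.
rewrite iterSr /= => h; case e: (ftrans a (f p)) h => [[o x] d] h.
have [n' le_n' e'] := IH _ _ _ h.
by exists n'.+1 => //; rewrite iterSr /= hinj e.
Qed.

Definition skip_frag : frag :=
  @Frag void None (fun _ x => (None, x, Stay)).

(** Walk right to the first cell whose track [r] is empty, write there, walk back to the marker. The
    boolean state is the direction. *)
Definition push_frag r g : frag :=
  @Frag bool (Some false) (fun back x =>
    match back, view x with
    | false, Some c => if cell_get c r then (Some false, x, Right)
                       else (Some true, cell_sym (cell_set c r (Some g)), Left)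
    | false, None => (Some false, x, Right)
    | true, Some _ => (Some true, x, Left)
    | true, None => (None, x, Stay)
    end).

Definition seq_frag (F H : frag) : frag :=
  let exit := omap (@inr (fstate F) (fstate H)) (entry H) in
  @Frag (fstate F + fstate H)%type
    (if entry F is Some a then Some (inl a) else exit)
    (fun a x => match a with
       | inl a => let: (o, x', d) := ftrans a x in
                  (if o is Some a' then Some (inl a') else exit, x', d)
       | inr a => let: (o, x', d) := ftrans a x in (omap inr o, x', d)
       end).

(* Pop register [r] and continue with the fragment selected by the popped
   symbol; with [lp], start again after it unless nothing was popped. *)
Definition pop_frag (lp : bool) r (F : option G -> frag) : frag :=
  let T := ((bool + G) + {o : option G & fstate (F o)})%type in
  let exit (o : option G) : option T :=
    if lp && o then Some (inl (inl false)) else None in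
  let inj o (a : fstate (F o)) : T :=
    inr (Tagged (fun o => fstate (F o)) a) in
  let branch o := if entry (F o) is Some a then Some (inj o a) else exit o in
  @Frag T (Some (inl (inl false)))
    (fun a x => match a with
       | inl (inl false) =>
           if view x is Some c then
             if cell_get c r then (Some (inl (inl false)), x, Right)
             else (Some (inl (inl true)), x, Left)
           else (Some (inl (inl false)), x, Right)
       | inl (inl true) =>
           if view x is Some c then
             if cell_get c r is Some g then
               (Some (inl (inr g)), cell_sym (cell_set c r None), Left)
             else (None, x, Stay)
           else (branch None, x, Stay)
       | inl (inr g) =>
           if view x is Some _ then (Some (inl (inr g)), x, Left)
           else (branch (Some g), x, Stay)
       | inr u => let: (o, x', d) := ftrans (tagged u) x in
                  (if o is Some a' then Some (inj _ a') else exit (tag u), x', d)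
       end).

Fixpoint compile (p : prog) : frag :=
  match p with
  | Skip => skip_frag
  | Push r g => push_frag r g
  | Seq p q => seq_frag (compile p) (compile q)
  | Case r k => pop_frag false r (fun o => compile (k o))
  | Loop r k => pop_frag true r (fun o => if o is Some g then compile (k g)
                                          else skip_frag)
  end.

Definition stored s r i : option G := nth None [seq Some g | g <- rev (s r)] i.

Definition represents s (f : nat -> tsym) : Prop :=
  view (f 0) = None /\
  forall i, exists2 c, view (f i.+1) = Some c &
    forall r, r < R -> cell_get c r = stored s r i.

Lemma stored_lt s r i : (stored s r i : bool) = (i < size (s r)).
Proof.
rewrite /stored; have [lt_i|le_i] := ltnP i (size (s r)).
  by case: (s r) lt_i => // g l lt_i; rewrite (nth_map g) // size_rev.
by rewrite nth_default // size_map size_rev.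
Qed.

Lemma stored_push s r g r' i :
  stored (upd s r (g :: s r)) r' i =
  if (r' == r) && (i == size (s r)) then Some g else stored s r' i.
Proof.
rewrite /stored /upd; case: eqP => [->|//] /=.
rewrite rev_cons map_rcons nth_rcons size_map size_rev.
by case: ltngtP => // h; rewrite nth_default // size_map size_rev ltnW.
Qed.

Lemma stored_pop s r g l r' i : s r = g :: l ->
  stored (upd s r l) r' i =
  if (r' == r) && (i == size l) then None else stored s r' i.
Proof.
move=> e; rewrite /stored /upd; case: eqP => [->|//] /=.
rewrite e rev_cons map_rcons nth_rcons size_map size_rev.
case: ltngtP => // h; last by rewrite h nth_default // size_map size_rev.
by rewrite nth_default // size_map size_rev ltnW.
Qed.

Lemma stored_top s r g l : s r = g :: l -> stored s r (size l) = Some g.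
Proof.
by move=> e; rewrite /stored e rev_cons map_rcons nth_rcons size_map size_rev ltnn eqxx.
Qed.

Lemma push_steps r g s f : r < R -> represents s f ->
  exists f', [/\ iter (2 * size (s r) + 3) (@fstep (push_frag r g))
                      (Some false, 0, f) = (None, 0, f')
              & represents (upd s r (g :: s r)) f'].
Proof.
move=> lt_r [f0 hf]; set n := size (s r).
have [c vc hc] := hf n.
have getn : cell_get c r = None.
  by rewrite hc //; have := stored_lt s r n; rewrite ltnn; case: stored.
exists (upd f n.+1 (cell_sym (cell_set c r (Some g)))); split; last first.
  split; first by rewrite /upd.
  move=> i; rewrite /upd eqSS; case: eqP => [->|ne_i] /=.
    exists (cell_set c r (Some g)) => // r' lt_r'.
    rewrite cell_get_set // stored_push -/n eqxx andbT.
    by case: eqP => // _; apply: hc.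
  have [c' vc' hc'] := hf i; exists c' => // r' lt_r'.
  by rewrite hc' // stored_push -/n (introF eqP ne_i) andbF.
(* Read from right to left: the marker and [n] full cells, the writing step, [n] cells back, the
   exit at the marker. *)
rewrite (_ : 2 * n + 3 = 1 + (n + (1 + n.+1))); last by lia.
rewrite !iterD steps_right; last first.
  case=> [_|q]; first by rewrite /= f0.
  rewrite ltnS => lt_q /=; have [c' vc' hc'] := hf q.
  by rewrite vc' hc' // stored_lt lt_q.
rewrite [iter 1 _ (Some false, _, _)]/= vc getn /=.
rewrite (@steps_left (push_frag r g) true); first by rewrite /= {1}/upd /= f0 upd_same.
move=> q /andP[q_gt0 le_q].
have -> : upd f n.+1 (cell_sym (cell_set c r (Some g))) q = f q.
  by rewrite /upd ltn_eqF.
by case: q q_gt0 le_q => // q _ _ /=; have [c' -> _] := hf q.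
Qed.

Lemma pop_steps lp r F s f : r < R -> represents s f ->
  let P := pop_frag lp r F in
  exists f', iter (2 * size (s r) + 3)
       (@fstep P) (entry P, 0, f) =
     (if entry (F (ohead (s r))) is Some a
      then Some (inr (Tagged (fun o => fstate (F o)) a))
      else if lp && ohead (s r) then Some (inl (inl false)) else None, 0, f')
    /\ represents (upd s r (behead (s r))) f'.
Proof.
move=> lt_r [f0 hf] P; set n := size (s r).
have right_ : iter n.+1 (@fstep P) (entry P, 0, f) = (entry P, n.+1, f).
  apply: steps_right; case=> [_|q]; first by rewrite /= f0.
  rewrite ltnS => lt_q /=; have [c' vc' hc'] := hf q.
  by rewrite vc' hc' // stored_lt lt_q.
have [c vc hc] := hf n.
have getn : cell_get c r = None.
  by rewrite hc //; have := stored_lt s r n; rewrite ltnn; case: stored.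
case e: (s r) @n right_ vc hc getn => [|g l] n right_ vc hc getn.
  exists f; split; last by rewrite /= -e upd_same.
  rewrite (_ : 2 * n + 3 = 2 + n.+1) // iterD right_ /= vc getn /= upd_same f0 /=.
  by rewrite upd_same andbF.
have [c2 vc2 hc2] := hf (size l).
set f' := upd f (size l).+1 (cell_sym (cell_set c2 r None)).
exists f'; split; last first.
  split; first by rewrite /f' /upd.
  move=> i; rewrite /f' {1}/upd eqSS; case: eqP => [->|ne_i] /=.
    exists (cell_set c2 r None) => // r' lt_r'.
    rewrite cell_get_set // (stored_pop _ _ e) eqxx andbT.
    by case: eqP => // _; apply: hc2.
  have [c' vc' hc'] := hf i; exists c' => // r' lt_r'.
  by rewrite hc' // (stored_pop _ _ e) (introF eqP ne_i) andbF.
rewrite (_ : 2 * n + 3 = (1 + (size l + 2)) + n.+1); last by rewrite /n /=; lia.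
rewrite !iterD right_ [iter 2 _ _]/= vc getn /= upd_same vc2 hc2 //.
rewrite (stored_top e) /= -/f'.
rewrite (@steps_left P (inl (inr g))).
  have f'0 : f' 0 = f 0 by [].
  by rewrite /= f'0 f0 -f'0 upd_same andbT.
move=> q /andP[q_gt0 le_q].
have -> : f' q = f q by rewrite /f' /upd ltn_eqF.
by case: q q_gt0 le_q => // q _ _ /=; have [c' -> _] := hf q.
Qed.

(** Each unit of program time costs at most one round trip over the tape, whose used length never
    exceeds [b + t] by [exec_size]; hence a quadratic overhead. *)
Lemma compileP p s s' t b f :
  exec p s s' t -> registers p <= R ->
  (forall r, r < R -> size (s r) <= b) -> represents s f ->
  exists n f', [/\ n <= t * (2 * (b + t) + 3),
    iter n (@fstep (compile p)) (entry (compile p), 0, f) = (None, 0, f')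
    & represents s' f'].
Proof.
move=> ex; elim: ex b f => {p s s' t}.
- by move=> s b f _ _ rf; exists 0, f.
- move=> r g s b f /= lt_r hb rf.
  have [f' [e rf']] := push_steps g lt_r rf.
  by exists (2 * size (s r) + 3), f'; split=> //; have := hb r lt_r; lia.
- move=> p q s s1 s2 t1 t2 ex1 IH1 ex2 IH2 b f /=.
  rewrite geq_max => /andP[hp hq] hb rf.
  have [n1 [f1 [le1 e1 rf1]]] := IH1 b f hp hb rf.
  have hb1 r : r < R -> size (s1 r) <= b + t1.
    by move=> lt_r; have := exec_size r ex1; have := hb r lt_r; lia.
  have [n2 [f2 [le2 e2 rf2]]] := IH2 (b + t1) f1 hq hb1 rf1.
  set H := seq_frag _ _; set exit := omap inr (entry (compile q)).
  have [n1' le1' e1'] := @embed_steps _ H inl exit _ _ _ _ _ _ (fun _ _ => erefl) e1.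
  have tr2 a x : ftrans (inr a : fstate H) x =
     let: (o, x', d) := ftrans a x in
     (if o is Some a' then Some (inr a') else None, x', d).
    by rewrite /=; case: ftrans => [[[]]].
  have [n2' le2' e2'] := @embed_steps _ H inr None _ _ _ _ _ _ tr2 e2.
  exists (n2' + n1'), f2; split=> //; last first.
    by rewrite iterD e1' /exit; move: e2'; case: (entry (compile q)).
  by clear -le1 le2 le1' le2'; nia.
- move=> r k s s' t ex IH b f /=; rewrite geq_max => /andP[lt_r hk] hb rf.
  have [f1 [e1 rf1]] := @pop_steps false r (fun o => compile (k o)) s f lt_r rf.
  have hk1 : registers (k (ohead (s r))) <= R.
    by apply: leq_trans hk; exact: (@leq_bigmax _ (fun o => registers (k o))).
  have hb1 r' : r' < R -> size (upd s r (behead (s r)) r') <= b.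
    move=> lt_r'; rewrite /upd; case: eqP => [_|_]; last exact: hb.
    by rewrite size_behead; have := hb r lt_r; lia.
  have [n2 [f2 [le2 e2 rf2]]] := IH b f1 hk1 hb1 rf1.
  set H := pop_frag _ _ _ in e1 *; set o := ohead (s r) in e1 e2 *.
  have tr2 (a : fstate (compile (k o))) x :
     ftrans (inr (Tagged (fun o => fstate (compile (k o))) a) : fstate H) x =
     let: (o', x', d) := ftrans a x in
     (if o' is Some a' then Some (inr (Tagged (fun o => fstate (compile (k o))) a'))
      else None, x', d) by [].
  have [n2' le2' e2'] := @embed_steps _ H _ None _ _ _ _ _ _ tr2 e2.
  exists (n2' + (2 * size (s r) + 3)), f2; split=> //; last first.
    by rewrite iterD e1.
  by have := hb r lt_r; nia.
- move=> r k s e b f /=; rewrite geq_max => /andP[lt_r hk] hb rf.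
  have := @pop_steps true r (fun o => if o is Some g then compile (k g) else skip_frag) s f lt_r rf.
  rewrite /= e /= => -[f1 [e1 rf1]].
  exists 3, f1; split=> //; first by lia.
  by rewrite -e upd_same in rf1.
- move=> r k g l s s1 s2 t1 t2 e ex1 IH1 ex2 IH2 b f hR hb rf.
  move: (hR) => /=; rewrite geq_max => /andP[lt_r hk].
  pose F o := if o is Some g then compile (k g) else skip_frag.
  have [f1 [e1 rf1]] := @pop_steps true r F s f lt_r rf.
  rewrite e in e1 rf1.
  have hk1 : registers (k g) <= R.
    by apply: leq_trans hk; exact: (@leq_bigmax _ (fun g => registers (k g))).
  have sz := hb r lt_r; rewrite e /= in sz.
  have hb1 r' : r' < R -> size (upd s r l r') <= b.
    by move=> lt_r'; rewrite /upd; case: eqP => [_|_]; [lia | exact: hb].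
  have [n2 [f2 [le2 e2 rf2]]] := IH1 b f1 hk1 hb1 rf1.
  have hb2 r' : r' < R -> size (s1 r') <= b + t1.
    by move=> lt_r'; have := exec_size r' ex1; have := hb1 r' lt_r'; lia.
  have [n3 [f3 [le3 e3 rf3]]] := IH2 (b + t1) f2 hR hb2 rf2.
  rewrite -/compile -/F in e1.
  rewrite /= -/compile -/F in e3; rewrite /= -/compile -/F.
  set H := pop_frag _ _ _ in e1 e3 *.
  have tr2 (a : fstate (F (Some g))) x :
     ftrans (inr (Tagged (fun o => fstate (F o)) a) : fstate H) x =
     let: (o', x', d) := ftrans a x in
     (if o' is Some a' then Some (inr (Tagged (fun o => fstate (F o)) a'))
      else Some (inl (inl false)), x', d) by [].
  have [n2' le2' e2'] := @embed_steps _ H _ _ _ _ _ _ _ _ tr2 e2.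
  exists (n3 + (n2' + (2 * size (g :: l) + 3))), f3; split=> //; last first.
    by rewrite iterD [iter (n2' + _) _ _]iterD e1 /= e2' e3.
  by rewrite [size _]/=; clear -le2 le3 le2' sz; nia.
Qed.

End Programs.

(** * Tapes as functions on the natural numbers *)

Section Tape.
Variable M : machine.
Implicit Types (c : config M) (h i : nat).

(* The cells are numbered so that the head of [c] is at [h]. *)
Definition tape_at c h i : symbol M :=
  if i < h then @nth (symbol M) None (before c) (h - i).-1
  else @nth (symbol M) None (scanned c :: after c) (i - h).

Definition next c : config M := odflt c (step c).

(** Numbering cells by natural numbers is faithful while the head does not leave cell 0 to the left,
    hence the guard on [h]. The last two clauses bound the part of the tape in use on either
    side. *)
Lemma next_transition c q x d : delta (cstate c) (scanned c) = Some (q, x, d) ->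
  cstate (next c) = q /\
  forall h, (d = Left -> 0 < h) ->
    tape_at (next c) (shift d h) = upd (tape_at c h) h x
    /\ (size (before c) <= h -> size (before (next c)) <= shift d h)
    /\ (shift d h + size (after (next c)) <= maxn (h + size (after c)) h.+1).
Proof.
rewrite /next /step => -> /=; case: d => /=; split=> // h hd.
- have h0 := hd erefl; split; last first.
    by split=> /=; [case: (before c) => [|a l] /=; lia | case: (before c) => [|a l] /=; lia].
  apply: funext => i; rewrite /tape_at /upd /=.
  case: (ltngtP i h.-1) => hi.
  + rewrite (ltn_trans hi) ?prednK // ltn_eqF; last by lia.
    rewrite nth_behead; congr nth; lia.
  + rewrite ltnNge (_ : h <= i); last by lia.
    case: (ltngtP i h) => hi'; first by lia.
    * rewrite (_ : i - h.-1 = (i - h).+1); last by lia.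
      by rewrite (_ : i - h = (i - h.+1).+1) //=; lia.
    * by rewrite (_ : i - h.-1 = 1) //; lia.
  + rewrite (_ : i < h); last by lia.
    rewrite ltn_eqF; last by lia.
    rewrite (_ : i - h.-1 = 0); last by lia.
    rewrite (_ : (h - i).-1 = 0) /= -?nth0 //; lia.
- split=> //=; last by split=> //; lia.
  apply: funext => i; rewrite /tape_at /upd /=.
  case: ltngtP => hi //=; last by rewrite hi subnn.
  by rewrite (_ : i - h = (i - h.+1).+1) //=; lia.
- split; last by split=> //=; case: (after c) => [|a l] /=; lia.
  apply: funext => i; rewrite /tape_at /upd /=.
  case: (ltngtP i h) => hi.
  + rewrite ltnS (ltnW hi).
    by rewrite (_ : (h.+1 - i).-1 = ((h - i).-1).+1) //=; lia.
  + rewrite ltnS leqNgt hi /= (_ : i - h = (i - h.+1).+1) /=; last by lia.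
    by case: (i - h.+1) => [|k] /=; case: (after c) => //=; case: k.
  + by rewrite hi ltnSn subSnn.
Qed.

Lemma next_halted c : halted c -> next c = c.
Proof. by rewrite /halted /next; case: step. Qed.

Lemma iter_halted c n : halted c -> iter n next c = c.
Proof. by move=> hc; elim: n => //= n ->; apply: next_halted. Qed.

Lemma run_stable x t n : halted (run M x t) -> t <= n -> run M x n = run M x t.
Proof.
by move=> ht /subnK <-; rewrite /run iterD; apply: iter_halted.
Qed.

Lemma tape_head c h : tape_at c h h = scanned c.
Proof. by rewrite /tape_at ltnn subnn. Qed.

Definition bit_of (x : symbol M) : option bool :=
  if x is Some (inl b) then Some b else None.

(** Blanks contribute nothing to the output, so any window that covers both lists of the
    configuration may be read instead. *)
Lemma output_tape c h n : size (before c) <= h -> h + size (after c) < n ->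
  output c = pmap bit_of (mkseq (tape_at c h) n).
Proof.
move=> hb ha.
have -> : mkseq (tape_at c h) n = nseq (h - size (before c)) (None : symbol M) ++
    (rev (before c) ++ scanned c :: after c) ++ nseq (n - h - (size (after c)).+1) (None : symbol M).
  apply: (@eq_from_nth (symbol M) None).
    by rewrite size_mkseq !size_cat !size_nseq size_rev /=; lia.
  rewrite size_mkseq => i lt_i; rewrite nth_mkseq // /tape_at.
  rewrite !nth_cat !size_cat !size_nseq size_rev /=.
  case: ltnP => hi.
    case: ltnP => hi2; first by rewrite nth_nseq hi2 nth_default //; lia.
    rewrite ifT; last by lia.
    rewrite ifT; last by lia.
    rewrite nth_rev; last by lia.
    congr nth; lia.
  rewrite ifF; last by lia.
  case: ltnP => hi2.
    rewrite ifF; last by lia.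
    congr nth; lia.
  rewrite nth_default; last by rewrite /=; lia.
  by rewrite nth_nseq; case: ifP.
have pmap0 k : pmap bit_of (nseq k (None : symbol M)) = [::] by elim: k.
by rewrite pmap_cat pmap0 pmap_cat pmap0 cats0.
Qed.

End Tape.

(** * A deciding machine from a stack program *)

Section Decider.
Variables (G : finType) (bit : bool -> G) (p : prog G).

Let R := (registers p + 3)%N.
Let F := compile R bit p.
Let St := option ((bool * bool) + fstate F).

Definition resume (o : option (fstate F)) : St :=
  if o is Some a then Some (inr a) else Some (inl (true, false)).

(** The head leaves the input to the left and writes the end marker there; then the compiled program
    runs; finally track 2 of cell 1 shows whether register 2 is nonempty, and if so [true] is
    written. *)
Definition decider_delta (a : St) (x : tsym G R) : option (St * tsym G R * move) :=
  match a with
  | None => None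
  | Some (inl (false, false)) => Some (Some (inl (false, true)), x, Left)
  | Some (inl (false, true)) => Some (resume (entry F), Some (inr None), Stay)
  | Some (inr a) => let: (o, x', d) := ftrans a x in Some (resume o, x', d)
  | Some (inl (true, false)) => Some (Some (inl (true, true)), x, Right)
  | Some (inl (true, true)) =>
      if view bit x is Some c then
        if cell_get c 2 then Some (None, Some (inl true), Stay) else None
      else None
  end.

Definition decider : machine :=
  @Machine St (option (cell G R)) (Some (inl (false, false))) decider_delta.

(** Hence the simulated head never gets to the left of the marker. *)
Lemma marker_kept (q : prog G) (a : fstate (compile R bit q)) x o x' d :
  ftrans a x = (o, x', d) -> view bit x = None -> x' = x /\ d <> Left.
Proof.
elim: q a o x' d => [|r g|q1 IH1 q2 IH2|r k IH|r k IH] /=.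
- by [].
- by case=> o x' d e vx; rewrite vx in e; case: e => _ <- <-.
- case=> a o x' d; case e: ftrans => [[o1 x1] d1] [_ <- <-] vx.
    exact: IH1 e vx.
  exact: IH2 e vx.
- case=> [[[]|g]|[i a]] o x' d /=; try by move=> e vx; rewrite vx in e; case: e => _ <- <-.
  case e: ftrans => [[o1 x1] d1] [_ <- <-] vx.
  exact: IH e vx.
- case=> [[[]|g]|[[g|] a]] o x' d //=; try by move=> e vx; rewrite vx in e; case: e => _ <- <-.
  case e: ftrans => [[o1 x1] d1] [_ <- <-] vx.
  exact: IH e vx.
Qed.

Definition simulates (c : config decider) (o : option (fstate F)) h f :=
  [/\ cstate c = resume o, tape_at c h = f, size (before c) <= h
    & view bit (f 0) = None].

Lemma simulates_steps n c o h f h' f' : simulates c o h f ->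
  iter n (@fstep _ _ F) (o, h, f) = (None, h', f') ->
  exists2 n', n' <= n & simulates (iter n' (@next decider) c) None h' f'.
Proof.
elim: n c o h f => [|n IH] c o h f sc.
  by case=> eo <- <-; exists 0 => //; rewrite eo in sc.
case: o sc => [a|] sc; last first.
  rewrite iterSr /= => e; have [n' le_n' sn'] := IH _ _ _ _ sc e.
  by exists n'; rewrite // ltnW.
rewrite iterSr /=; case e: (ftrans a (f h)) => [[o x] d] en.
case: sc => cc cf cb f0.
have de : delta (cstate c) (scanned c) = Some (resume o, x, d).
  by rewrite cc /= -(tape_head c h) cf e.
have [nq nt] := next_transition de.
have hd : d = Left -> 0 < h.
  move=> dl; case: h {cb} e cf nt en => // e *.
  by have [_] := marker_kept e f0.
have [nt1 [nt2 _]] := nt h hd.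
have sc' : simulates (next c) o (shift d h) (upd f h x).
  split=> //; [by rewrite nt1 cf | exact: nt2 |].
  rewrite /upd; case: eqP => // h0; rewrite -h0 in e.
  by have [-> _] := marker_kept e f0.
have [n' le_n' sn'] := IH _ _ _ _ sc' en.
by exists n'.+1 => //; rewrite iterSr.
Qed.

Definition input_store (x : seq bool) : nat -> seq G :=
  upd (fun _ => [::]) 0 (rev (map bit x)).

(** The output collects all raw bits on the tape, wherever they are. A raw bit counts as an entry of
    register 0, so the emptiness of that register guarantees that no input bit survives. The summand
    4 pays for two steps before the program and at most two after it. *)
Lemma decider_run x s t : exec p (input_store x) s t -> s 0 = [::] ->
  forall n, t * (2 * (size x + t) + 3) + 4 <= n ->
  halted (run decider x n) /\
  output (run decider x n) = (if s 2 is [::] then [::] else [:: true]).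
Proof.
move=> ex s0 n le_n.
pose w : seq (tsym G R) := [seq Some (inl b) | b <- x].
pose c2 : config decider := iter 2 (@next decider) (init decider x).
pose f : nat -> tsym G R := fun i => if i is i'.+1 then nth None w i' else Some (inr None).
have sc2 : simulates c2 (entry F) 0 f.
  split=> //; apply: funext => -[|i] //.
  rewrite /c2 /= /next /= /tape_at /= /w.
  by case: x {ex le_n c2 f w} => [|b x] //=; case: i => [|[]].
have rf : represents bit (input_store x) f.
  split=> // i /=; have [lt_i|le_i] := ltnP i (size x); last first.
    rewrite nth_default ?size_map //; exists [ffun=> None] => // r _.
    rewrite /stored /input_store /upd [RHS](_ : _ = None).
      by rewrite /cell_get; case: insub => // j; rewrite ffunE.
    case: eqP => _; last by rewrite nth_nil.
    by rewrite nth_default // size_map size_rev size_rev size_map.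
  rewrite (nth_map false) //; exists (cell_set [ffun=> None] 0 (Some (bit (nth false x i)))) => // r lt_r.
  rewrite cell_get_set /stored /input_store /upd; last by rewrite /R addn3.
  case: eqP => _; last by rewrite nth_nil /cell_get; case: insub => // j; rewrite ffunE.
  by rewrite revK -map_comp (nth_map false).
have hb r : r < R -> size (input_store x r) <= size x.
  by move=> _; rewrite /input_store /upd; case: eqP => // _; rewrite size_rev size_map.
have hR : registers p <= R by rewrite leq_addr.
have [n1 [f1 [le1 e1 rf1]]] := compileP ex hR hb rf.
have [n2 le2 sc3] := simulates_steps sc2 e1.
set c3 := iter n2 _ c2 in sc3.
case: sc3 => q3 t3 b3 v3.
have d3 : delta (cstate c3) (scanned c3) = Some (Some (inl (true, true)), scanned c3, Right).
  by rewrite q3.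
have [q4 nt4] := next_transition d3.
have [t4 [b4 _]] : _ /\ (_ -> _) /\ _ := nt4 0 (fun h => ltac:(discriminate h)).
have {}b4 := b4 b3.
rewrite /shift -(tape_head c3 0) upd_same t3 in t4 b4.
set c4 := next c3 in q4 t4 b4.
have e4 : c4 = iter (n2 + 3) (@next decider) (init decider x).
  by rewrite (_ : n2 + 3 = (n2 + 2).+1) ?iterS ?iterD //; lia.
have scan4 : scanned c4 = f1 1 by rewrite -(tape_head c4 1) t4.
have [c v1 gc] := rf1.2 0.
have hR0 : 0 < R by rewrite /R addn3.
have hR2 : 2 < R by rewrite /R addn3.
have delta4 : delta (cstate c4) (scanned c4) =
    if s 2 is [::] then None else Some (None, Some (inl true), Stay).
  rewrite q4 scan4 /= v1.
  have := stored_lt s 2 0; rewrite -gc //.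
  by case: cell_get => [g|]; case: (s 2).
have noraw i : @bit_of decider (f1 i) = None.
  case: i => [|i]; first by have := rf1.1; case: (f1 0) => [[b|o]|].
  have [c' v' gc'] := rf1.2 i.
  have := stored_lt s 0 i; rewrite s0 -gc' //.
  case: (f1 i.+1) v' => [[b|o]|] //= [<-].
  by rewrite cell_get_set.
have none_of l : (forall y, y \in l -> @bit_of decider y = None) -> pmap (@bit_of decider) l = [::].
  elim: l => //= y l IH hl; rewrite hl ?mem_head //= IH // => z zl.
  by rewrite hl // inE zl orbT.
have fin c5 k : c5 = iter k (@next decider) (init decider x) -> halted c5 ->
    k <= n -> run decider x n = c5.
  move=> -> hk le_k; exact: run_stable.
have b5 : 1 + size (after c4) < (1 + size (after c4)).+1 by [].
case e2: (s 2) delta4 => [|g l] delta4.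
  have h4 : halted c4 by rewrite /halted /step delta4.
  have -> : run decider x n = c4 by apply: fin e4 h4 _; lia.
  split=> //; rewrite (output_tape b4 b5) t4.
  by apply: none_of => y /mapP[i _ ->].
have [q5 nt5] := next_transition delta4.
have [t5 [{}b6 _]] := nt5 1 (fun h => ltac:(discriminate h)).
have {}b6 := b6 b4.
set c5 := next c4 in q5 t5 b6.
have e5 : c5 = iter (n2 + 4) (@next decider) (init decider x).
  by rewrite (_ : n2 + 4 = (n2 + 3).+1) ?iterS /c5 ?e4 //; lia.
have h5 : halted c5 by rewrite /halted /step q5.
have -> : run decider x n = c5 by apply: fin e5 h5 _; lia.
split=> //; have b7 : 1 + size (after c5) < (size (after c5)).+2 by [].
rewrite (output_tape b6 b7) t5 t4 /mkseq -[_.+2]/(2 + _) iotaD map_cat pmap_cat.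
rewrite [X in _ ++ X]none_of ?cats0.
  by have := noraw 0; rewrite /= /upd /=; case: (f1 0) => [[b|o]|].
move=> y /mapP[i]; rewrite mem_iota => /andP[lt_i _] ->.
by rewrite /upd gtn_eqF.
Qed.

End Decider.

(** * Compilation of arithmetic expressions *)

(** From 2 on a bare power absorbs constants and sums, so no coefficients are needed. *)
Definition poly_bounded (h : nat -> nat) :=
  exists d, forall y, 2 <= y -> h y <= y ^ d.

Lemma pb_const c : poly_bounded (fun _ => c).
Proof.
exists c => y y2; apply: (@leq_trans (2 ^ c)); first by apply: ltnW; apply: ltn_expl.
by case: c => // c; rewrite leq_exp2r.
Qed.

Lemma pb_id : poly_bounded (fun y => y).
Proof. by exists 1 => y _; rewrite expn1. Qed.

Lemma pb_mul g h : poly_bounded g -> poly_bounded h ->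
  poly_bounded (fun y => g y * h y).
Proof.
move=> [d1 h1] [d2 h2]; exists (d1 + d2) => y y2.
by rewrite expnD leq_mul ?h1 ?h2.
Qed.

Lemma pb_add g h : poly_bounded g -> poly_bounded h ->
  poly_bounded (fun y => g y + h y).
Proof.
move=> [d1 h1] [d2 h2]; exists (maxn d1 d2).+1 => y y2.
have le1 : g y <= y ^ maxn d1 d2.
  by apply: leq_trans (h1 y y2) _; rewrite leq_exp2l // leq_maxl.
have le2 : h y <= y ^ maxn d1 d2.
  by apply: leq_trans (h2 y y2) _; rewrite leq_exp2l // leq_maxr.
rewrite expnS; apply: (@leq_trans (2 * y ^ maxn d1 d2)); first by lia.
by rewrite leq_mul2r y2 orbT.
Qed.

Lemma pb_pow h d : poly_bounded h -> poly_bounded (fun y => h y ^ d).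
Proof.
move=> [d1 h1]; exists (d1 * d) => y y2.
by case: d => [|d]; rewrite ?muln0 // expnM leq_exp2r // h1.
Qed.

Ltac pb := repeat first [apply: pb_add | apply: pb_mul | apply: pb_pow
                        | apply: pb_id | apply: pb_const].

Lemma drop_consE (T : Type) (l : seq T) i g l' : drop i l = g :: l' ->
  take i.+1 l = rcons (take i l) g /\ drop i.+1 l = l'.
Proof.
move=> e; rewrite -addn1 takeD e -cats1 /= take0; split=> //.
by rewrite addnC -drop_drop e /= drop0.
Qed.

Section Runs.
Variable G : finType.
Implicit Types (s : nat -> seq G) (p q : prog G).

Definition runs p s s' b := exists2 t, t <= b & exec p s s' t.

Lemma runs_le p s s' b b' : b <= b' -> runs p s s' b -> runs p s s' b'.
Proof. by move=> le_b [t le_t ex]; exists t => //; apply: leq_trans le_b. Qed.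

Lemma runs_seq p q s s1 s2 b1 b2 :
  runs p s s1 b1 -> runs q s1 s2 b2 -> runs (Seq p q) s s2 (b1 + b2).
Proof.
move=> [t1 le1 ex1] [t2 le2 ex2]; exists (t1 + t2); first exact: leq_add.
exact: ESeq ex1 ex2.
Qed.

Lemma runs_push r g s : runs (Push r g) s (upd s r (g :: s r)) 1.
Proof. by exists 1 => //; apply: EPush. Qed.

Lemma runs_skip s : runs (Skip G) s s 0.
Proof. by exists 0 => //; apply: ESkip. Qed.

Lemma runs_case r k s s' b :
  runs (k (ohead (s r))) (upd s r (behead (s r))) s' b -> runs (Case r k) s s' b.+1.
Proof. by move=> [t le_t ex]; exists t.+1 => //; apply: ECase. Qed.

(** [st i] is the store after [i] iterations; the body may change any register, provided that [r]
    ends up holding the remaining suffix. *)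
Lemma runs_loop r k (st : nat -> nat -> seq G) l b :
  (forall i, i <= size l -> st i r = drop i l) ->
  (forall i g l', drop i l = g :: l' -> runs (k g) (upd (st i) r l') (st i.+1) b) ->
  runs (Loop r k) (st 0) (st (size l)) (size l * b.+1 + 1).
Proof.
elim: l st => [|g l IH] st hr hk.
  by exists 1 => //=; apply: ELoop0; rewrite hr.
have [t1 le1 ex1] := hk 0 g l (drop0 _).
have [t2 le2 ex2] : runs (Loop r k) (st 1) (st (size l).+1) (size l * b.+1 + 1).
  by apply: (IH (fun i => st i.+1)) => [i le_i|i g' l' e]; [exact: hr | exact: hk].
exists (t1 + t2).+1; first by rewrite [size _]/= mulSn; lia.
by apply: ELoop ex1 ex2; rewrite hr // drop0.
Qed.

Lemma runs_cast p s s' s'' b : s' = s'' -> runs p s s' b -> runs p s s'' b.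
Proof. by move=> ->. Qed.

End Runs.

Ltac regs := rewrite /upd;
  repeat match goal with
  | |- context [@eq_op ?T ?a ?b] =>
      first [rewrite (_ : @eq_op T a b = false); last lia
            | rewrite (_ : @eq_op T a b = true); last lia]
  end.

Ltac store_eq :=
  let j := fresh "j" in
  apply: funext => j; rewrite /upd;
  repeat match goal with
  | |- context [j == ?r] =>
      let E := fresh "E" in
      case: (j =P r) => [E|E] /=; try (exfalso; lia)
  end; try subst j; regs; rewrite //.

Section Expressions.
Variables (G : finType) (bit : bool -> G).
Hypothesis bit_inj : injective bit.
Let one := bit true.
Let u n : seq G := nseq n one.

(* The power is capped by its second argument, so that all values are bounded
   by a polynomial in the arguments. *)
Inductive expr :=
| Var (i : nat) | Cst (c : nat)
| Add (e1 e2 : expr) | Mul (e1 e2 : expr) | Sub (e1 e2 : expr)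
| Sum (e1 e2 : expr)
| Pow (e1 e2 : expr)
| Len | At (b : bool) (e : expr).

Fixpoint eval (x : seq bool) (env : seq nat) (e : expr) : nat :=
  match e with
  | Var i => nth 0 env i
  | Cst c => c
  | Add e1 e2 => eval x env e1 + eval x env e2
  | Mul e1 e2 => eval x env e1 * eval x env e2
  | Sub e1 e2 => eval x env e1 - eval x env e2
  | Sum e1 e2 => \sum_(0 <= z < eval x env e1) eval x (z :: env) e2
  | Pow e1 e2 => minn (2 ^ eval x env e1) (eval x env e2)
  | Len => size x
  | At b e => nth None (map Some x) (eval x env e) == Some b
  end.

Definition drain r := Loop r (fun _ => Skip G).
Definition move_to r d := Loop r (fun _ => Push d one).
Definition copy_to r d d' := Loop r (fun _ => Seq (Push d one) (Push d' one)).

(** Numbers are unary; the value is left in register [f], with temporaries above. Reading a register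
    empties it, hence the double copy in [Var] and the transfers through register 0 in [Len] and
    [At]. [Pow] starts with a stock of [e2] units in [f.+2] and draws every new unit of the doubled
    value from it, which is how the cap is enforced. *)
Fixpoint comp (rho : seq nat) (f : nat) (e : expr) : prog G :=
  match e with
  | Var i => let r := nth 0 rho i in
             Seq (copy_to r f f.+1) (move_to f.+1 r)
  | Cst c => iter c (fun p => Seq p (Push f one)) (Skip G)
  | Add e1 e2 =>
      Seq (comp rho f e1) (Seq (comp rho f.+1 e2) (move_to f.+1 f))
  | Mul e1 e2 =>
      Seq (comp rho f.+1 e1)
          (Loop f.+1 (fun _ => Seq (comp rho f.+2 e2) (move_to f.+2 f)))
  | Sub e1 e2 =>
      Seq (comp rho f e1)
          (Seq (comp rho f.+1 e2) (Loop f.+1 (fun _ => Case f (fun _ => Skip G))))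
  | Sum e1 e2 =>
      Seq (comp rho f.+1 e1)
       (Seq (Loop f.+1 (fun _ => Seq (comp (f.+2 :: rho) f.+3 e2)
                                  (Seq (move_to f.+3 f) (Push f.+2 one))))
            (drain f.+2))
  | Pow e1 e2 =>
      let grow := Case f.+2 (fun o => if o then Push f one else Skip G) in
      Seq (comp rho f.+1 e1)
       (Seq (comp rho f.+2 e2)
        (Seq grow
         (Seq (Loop f.+1 (fun _ =>
                 Seq (move_to f f.+3)
                     (Loop f.+3 (fun _ => Seq (Push f one) grow))))
              (drain f.+2))))
  | Len => Seq (Loop 1 (fun g => Seq (Push 0 g) (Push f one)))
               (Loop 0 (fun g => Push 1 g))
  | At b e =>
      Seq (comp rho f.+1 e)
       (Seq (Loop f.+1 (fun _ => Case 1 (fun o => if o is Some g then Push 0 g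
                                                else Skip G)))
        (Seq (Case 1 (fun o => if o is Some g then
                       Seq (Push 1 g) (if g == bit b then Push f one else Skip G)
                     else Skip G))
             (Loop 0 (fun g => Push 1 g))))
  end.

Lemma drop_u i n g l : drop i (u n) = g :: l -> [/\ g = one, i < n & l = u (n - i.+1)].
Proof.
rewrite /u drop_nseq; case e: (n - i) => [//|k] [<- <-].
by split=> //; [lia | congr nseq; lia].
Qed.

Lemma cat_u m n : u m ++ u n = u (m + n).
Proof. by rewrite /u nseqD. Qed.

Lemma cons_u n : one :: u n = u n.+1. Proof. by []. Qed.

Lemma runs_uloop (r : nat) (k : G -> prog G) (st : nat -> nat -> seq G) n b s s' :
  s = upd (st 0) r (u n) -> s' = upd (st n) r [::] ->
  (forall i, i < n -> runs (k one) (upd (st i) r (u (n - i.+1)))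
                       (upd (st i.+1) r (u (n - i.+1))) b) ->
  runs (Loop r k) s s' (n * b.+1 + 1).
Proof.
move=> -> -> hk; pose st' i := upd (st i) r (u (n - i)).
have e0 : upd (st 0) r (u n) = st' 0 by rewrite /st' subn0.
have en : upd (st n) r [::] = st' (size (u n)) by rewrite /st' size_nseq subnn.
rewrite e0 en -[n * _](congr1 (muln^~ _) (size_nseq n one)); apply: runs_loop => [i _|i g l /drop_u[-> lt_i ->]].
  by rewrite /st' /upd eqxx drop_nseq.
have -> : upd (st' i) r (u (n - i.+1)) = upd (st i) r (u (n - i.+1)) by rewrite /st'; store_eq.
exact: hk.
Qed.

Lemma runs_move r d n s : r != d -> s r = u n ->
  runs (move_to r d) s (upd (upd s r [::]) d (u n ++ s d)) (n * 2 + 1).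
Proof.
move=> ne sr; apply: (@runs_uloop r _ (fun i => upd s d (u i ++ s d))) => //.
- by rewrite -sr; store_eq.
- by move/eqP: ne => ne; store_eq.
- move=> i _; apply: runs_cast (runs_push _ _ _).
  by move/eqP: ne => ne; store_eq.
Qed.

Lemma runs_copy r d d' n s : r != d -> r != d' -> d != d' -> s r = u n ->
  runs (copy_to r d d') s
    (upd (upd (upd s r [::]) d (u n ++ s d)) d' (u n ++ s d')) (n * 3 + 1).
Proof.
move=> /eqP n1 /eqP n2 /eqP n3 sr.
apply: (@runs_uloop r _ (fun i => upd (upd s d (u i ++ s d)) d' (u i ++ s d'))) => //.
- by rewrite -sr; store_eq.
- by store_eq.
- move=> i _; apply: runs_cast (runs_seq (runs_push _ _ _) (runs_push _ _ _)).
  by store_eq.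
Qed.

Lemma runs_drain r s : runs (drain r) s (upd s r [::]) (size (s r) + 1).
Proof.
have := @runs_loop _ r (fun _ => Skip G) (fun i => upd s r (drop i (s r))) (s r) 0.
rewrite drop0 drop_size upd_same muln1; apply.
  by move=> i _; rewrite /upd eqxx.
move=> i g l e; apply: runs_cast (runs_skip _).
by have [_ <-] := drop_consE e; store_eq.
Qed.

(* Register 0 is scratch, 1 holds the string and 2 the output; the registers
   [rho] hold the variables [env], and those from [f] on are free. *)
Definition ready rho f x env (s : nat -> seq G) :=
  [/\ s 0 = [::] /\ s 1 = map bit x, 2 < f,
      size rho = size env /\ (forall i, i < size env -> 2 < nth 0 rho i < f),
      forall i, i < size env -> s (nth 0 rho i) = u (nth 0 env i)
    & forall r, f <= r -> s r = [::]].

Lemma ready_upd rho f f' x env s s' : ready rho f x env s -> f <= f' ->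
  (forall r, r < f -> r != 2 -> s' r = s r) -> (forall r, f' <= r -> s' r = [::]) ->
  ready rho f' x env s'.
Proof.
move=> [[s0 s1] f2 [sz hr] hs he] le_f hs' he'; split=> //.
- by rewrite !hs' //; lia.
- by lia.
- by split=> // i /hr; lia.
- move=> i lt_i; have := hr i lt_i => lt_r.
  by rewrite hs' ?hs //; lia.
Qed.

Lemma ready_var rho f f' fz z x env s s' : ready rho f x env s -> f <= fz < f' ->
  (forall r, r < f -> r != 2 -> s' r = s r) -> (forall r, f' <= r -> s' r = [::]) ->
  s' fz = u z -> ready (fz :: rho) f' x (z :: env) s'.
Proof.
move=> rd lt_f hs' he' hz.
have [[s0 s1] f2 [sz hr] hs he] : ready rho f' x env s'.
  by apply: ready_upd rd _ hs' he'; lia.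
have f2' : 2 < f by case: rd.
split=> //=.
- by split; [rewrite sz | case=> [|i] /=; [lia | rewrite ltnS => /hr]].
- by case=> [//|i]; rewrite ltnS => /hs.
Qed.

(** The summand 2 puts the argument into the range covered by [poly_bounded]. *)
Definition measure (x : seq bool) (env : seq nat) := size x + sumn env + 2.

Lemma leq_pow y z d : y <= z -> y ^ d <= z ^ d.
Proof. by case: d => // d le_yz; rewrite leq_exp2r. Qed.

Lemma measure_cons x env i n b d h : (forall y, 2 <= y -> h y <= y ^ d) ->
  i < n -> n <= b -> h (measure x (i :: env)) <= (measure x env + b) ^ d.
Proof.
move=> hd lt_i le_n; apply: leq_trans (hd _ _) _; first by rewrite /measure; lia.
by apply: leq_pow; rewrite /measure /=; lia.
Qed.

Lemma nth_measure x env i : nth 0 env i <= measure x env.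
Proof.
rewrite /measure; elim: env i => [|v env IH] [|i] //=; first lia.
by have := IH i; lia.
Qed.

(** The polynomial has to bound the value along with the time, because values become loop counters
    of enclosing expressions. It is independent of the register allocation. *)
Definition compiled e := exists2 h, poly_bounded h &
  forall rho f x env s, ready rho f x env s ->
    eval x env e <= h (measure x env) /\
    runs (comp rho f e) s (upd s f (u (eval x env e))) (h (measure x env)).

Lemma free_upd f x env rho s n : ready rho f x env s ->
  ready rho f.+1 x env (upd s f (u n)).
Proof.
move=> rd; have [_ _ _ _ he] := rd.
apply: (ready_upd rd) => // r h; regs=> //; apply: he; lia.
Qed.

Lemma runs_transfer r d (s : nat -> seq G) : r != d ->
  runs (Loop r (fun g => Push d g)) s
    (upd (upd s r [::]) d (rev (s r) ++ s d)) (size (s r) * 2 + 1).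
Proof.
move=> /eqP ne; set l := s r.
have := @runs_loop _ r (fun g => Push d g)
  (fun i => upd (upd s r (drop i l)) d (rev (take i l) ++ s d)) l 1.
rewrite drop0 take0 drop_size take_size /=.
have {1}-> : upd (upd s r l) d (s d) = s by rewrite /l !upd_same.
apply=> [i _|i g l' e]; first by regs.
have [-> ->] := drop_consE e; apply: runs_cast (runs_push _ _ _).
by rewrite rev_rcons; store_eq.
Qed.

Lemma restore_string x (s : nat -> seq G) a : s 0 = [::] -> s 1 = map bit x ->
  runs (Loop 0 (fun g => Push 1 g))
    (upd (upd s 0 (rev (take a (map bit x)))) 1 (drop a (map bit x)))
    s (size x * 2 + 1).
Proof.
move=> s0 s1; set T := upd _ 1 _.
apply: runs_le (runs_cast _ (@runs_transfer 0 1 T isT)).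
  by rewrite /T; regs; rewrite size_rev size_take_min size_map; nia.
by rewrite /T; store_eq; rewrite ?s0 // revK cat_take_drop s1.
Qed.

Lemma ready_free f f' x env rho s : ready rho f x env s -> f <= f' ->
  ready rho f' x env s.
Proof.
move=> rd le_f; have [_ _ _ _ he] := rd.
by apply: (ready_upd rd) => // r le_r; apply: he; lia.
Qed.

Lemma runs_cst c f s : runs (comp [::] f (Cst c)) s (upd s f (u c ++ s f)) c.
Proof.
elim: c => [|c IH] /=; first by rewrite upd_same; apply: runs_skip.
apply: runs_le (runs_cast _ (runs_seq IH (runs_push _ _ _))); first lia.
by store_eq.
Qed.

Lemma compiled_cst c : compiled (Cst c).
Proof.
exists (fun _ => c); first by pb.
move=> rho f x env s [_ _ _ _ he]; split=> //.
by apply: runs_cast (runs_cst c f s); rewrite he ?cats0.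
Qed.

Lemma compiled_add e1 e2 : compiled e1 -> compiled e2 -> compiled (Add e1 e2).
Proof.
move=> [h1 p1 H1] [h2 p2 H2]; exists (fun y => h1 y + h2 y * 3 + 1); first by pb.
move=> rho f x env s rd /=; have [v1 r1] := H1 _ _ _ _ _ rd.
have [v2 r2] := H2 _ _ _ _ _ (free_upd (eval x env e1) rd).
split; first lia.
have ne : f.+1 != f by lia.
apply: runs_le (runs_cast _ (runs_seq r1 (runs_seq r2 (@runs_move f.+1 f (eval x env e2) _ ne _)))).
- lia.
- by have [_ _ _ _ he] := rd; store_eq; rewrite ?he ?cat_u 1?addnC //; lia.
- by regs.
Qed.

Lemma compiled_mul e1 e2 : compiled e1 -> compiled e2 -> compiled (Mul e1 e2).
Proof.
move=> [h1 p1 H1] [h2 p2 H2].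
exists (fun y => h1 y + (h1 y * (h2 y * 3 + 2) + 1)); first by pb.
move=> rho f x env s rd /=.
have [v1 r1] := H1 _ _ _ _ _ (ready_free rd (leqnSn f)).
have [_ _ _ _ he] := rd.
set n1 := eval x env e1 in v1 r1 *; set n2 := eval x env e2.
have step i k : let T := upd (upd s f (u i)) f.+1 (u k) in
  n2 <= h2 (measure x env) /\
  runs (Seq (comp rho f.+2 e2) (move_to f.+2 f)) T (upd (upd s f (u (n2 + i))) f.+1 (u k))
    (h2 (measure x env) * 3 + 1).
  move=> T; have rd2 : ready rho f.+2 x env T.
    by apply: free_upd; apply: free_upd.
  have [v2 r2] := H2 _ _ _ _ _ rd2; split=> //.
  have ne : f.+2 != f by lia.
  apply: runs_le (runs_cast _ (runs_seq r2 (@runs_move f.+2 f n2 _ ne _))); first lia.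
    by rewrite /T; store_eq; rewrite ?he ?cat_u //; lia.
  by regs.
have [v2 _] := step 0 0.
split; first by nia.
apply: runs_le (runs_seq r1 (@runs_uloop f.+1 _ (fun i => upd s f (u (i * n2))) n1
   (h2 (measure x env) * 3 + 1) _ _ _ _ _)); first by nia.
- by store_eq; rewrite he.
- by store_eq; rewrite he //; lia.
- by move=> i lt_i; have [_] := step (i * n2) (n1 - i.+1); rewrite -mulSn.
Qed.

Lemma compiled_sub e1 e2 : compiled e1 -> compiled e2 -> compiled (Sub e1 e2).
Proof.
move=> [h1 p1 H1] [h2 p2 H2]; exists (fun y => h1 y + h2 y * 3 + 1); first by pb.
move=> rho f x env s rd /=; have [v1 r1] := H1 _ _ _ _ _ rd.
have [v2 r2] := H2 _ _ _ _ _ (free_upd (eval x env e1) rd).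
have [_ _ _ _ he] := rd.
set n1 := eval x env e1 in v1 r1 r2 *; set n2 := eval x env e2 in v2 r2 *.
split; first lia.
apply: runs_le (runs_seq r1 (runs_seq r2 (@runs_uloop f.+1 _ (fun i => upd s f (u (n1 - i)))
   n2 1 _ _ _ _ _))); first lia.
- by rewrite subn0; store_eq; rewrite he.
- by store_eq; rewrite he //; lia.
- move=> i lt_i; apply: runs_case; apply: runs_cast (runs_skip _).
  store_eq; rewrite (_ : n1 - i.+1 = (n1 - i).-1); last lia.
  by case: (n1 - i).
Qed.

Lemma compiled_sum e1 e2 : compiled e1 -> compiled e2 -> compiled (Sum e1 e2).
Proof.
move=> [h1 p1 H1] [h2 [d2 p2] H2].
(* The bound variable stays below [h1 y], so the body is evaluated at measure at most [y + h1 y]. *)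
exists (fun y => h1 y + (h1 y * ((y + h1 y) ^ d2 * 3 + 3) + 1 + (h1 y + 1))); first by pb.
move=> rho f x env s rd /=.
have [v1 r1] := H1 _ _ _ _ _ (ready_free rd (leqnSn f)).
have [_ _ _ _ he] := rd; set y := measure x env in v1 r1 *.
set n1 := eval x env e1 in v1 r1 *; set g := fun z => eval x (z :: env) e2.
have step i a k : i < n1 -> let T := upd (upd (upd s f (u a)) f.+2 (u i)) f.+1 (u k) in
  g i <= (y + h1 y) ^ d2 /\
  runs (Seq (comp (f.+2 :: rho) f.+3 e2) (Seq (move_to f.+3 f) (Push f.+2 one))) T
    (upd (upd (upd s f (u (g i + a))) f.+2 (u i.+1)) f.+1 (u k))
    ((y + h1 y) ^ d2 * 3 + 2).
  move=> lt_i T; have rd2 : ready (f.+2 :: rho) f.+3 x (i :: env) T.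
    apply: (ready_var rd); [lia | | | ].
    - by move=> r lt_r _; rewrite /T; regs.
    - by move=> r le_r; rewrite /T; regs; rewrite he //; lia.
    - by rewrite /T; regs.
  have [v2 r2] := H2 _ _ _ _ _ rd2.
  have := measure_cons x env p2 lt_i v1; rewrite -/y => le_h.
  have le_g := leq_trans v2 le_h; split=> //.
  have ne : f.+3 != f by lia.
  apply: runs_le (runs_cast _ (runs_seq r2 (runs_seq (@runs_move f.+3 f (g i) _ ne _) (runs_push _ _ _)))).
  - by rewrite /g; lia.
  - by rewrite /T; store_eq; rewrite ?he ?cat_u ?cons_u //; lia.
  - by regs.
have le_sum n : n <= n1 -> \sum_(0 <= z < n) g z <= n * (y + h1 y) ^ d2.
  elim: n => [|n IH] lt_n; first by rewrite big_nil.
  rewrite big_nat_recr //= mulSn; have := IH (ltnW lt_n).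
  by have [+ _] := step n 0 0 lt_n; lia.
split.
  have := le_sum n1 (leqnn _); move: v1; set B := _ ^ d2.
  by move: (h1 y) B (\sum_(_ <= _ < _) _) => H B S v1 le_S; nia.
apply: runs_le (runs_seq r1 (runs_seq (s1 := upd (upd s f (u (\sum_(0 <= z < n1) g z))) f.+2 (u n1)) (@runs_uloop f.+1 _
   (fun i => upd (upd s f (u (\sum_(0 <= z < i) g z))) f.+2 (u i)) n1
   ((y + h1 y) ^ d2 * 3 + 2) _ _ _ _ _) (runs_cast _ (runs_drain f.+2 _)))).
- by regs; rewrite size_nseq; nia.
- by rewrite big_nil; store_eq; rewrite he //; lia.
- by store_eq; rewrite he //; lia.
- move=> i lt_i; have [_] := step i (\sum_(0 <= z < i) g z) (n1 - i.+1) lt_i.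
  by rewrite big_nat_recr //= addnC.
- by store_eq; rewrite he //; lia.
Qed.

Lemma compiled_pow e1 e2 : compiled e1 -> compiled e2 -> compiled (Pow e1 e2).
Proof.
move=> [h1 p1 H1] [h2 p2 H2].
exists (fun y => h1 y + (h2 y + (2 + (h1 y * (h2 y * 6 + 3) + 1 + (h2 y + 1))))); first by pb.
move=> rho f x env s rd /=.
have [v1 r1] := H1 _ _ _ _ _ (ready_free rd (leqnSn f)).
have [v2 r2] := H2 _ _ _ _ _ (free_upd (eval x env e1) (ready_free rd (leqnSn f))).
have [_ _ _ _ he] := rd.
set n1 := eval x env e1 in v1 r1 r2 *; set n2 := eval x env e2 in v2 r2 *.
set y := measure x env in v1 r1 v2 r2 *.
split.
  by rewrite geq_min (leq_trans v2) ?orbT // addnCA leq_addr.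
set grow := Case f.+2 _.
have growP (T : nat -> seq G) a r : T f = u a -> T f.+2 = u r ->
   runs grow T (upd (upd T f (u (a + minn 1 r))) f.+2 (u (r - 1))) 2.
  move=> Tf T2; case: r T2 => [|r] T2; apply: runs_case; rewrite T2 /=.
    apply: runs_le (runs_cast _ (runs_skip _)) => //.
    by rewrite addn0; store_eq; rewrite ?Tf.
  apply: runs_cast (runs_push _ _ _).
  by store_eq; rewrite ?Tf ?cons_u ?subn1 //; congr u; lia.
(* Invariant of the doubling loop: the value in [f] and the stock in [f.+2] add up to [n2]. *)
pose a i := minn (2 ^ i) n2.
have inner i k : let T := upd (upd (upd s f (u (a i))) f.+2 (u (n2 - a i))) f.+1 (u k) in
  runs (Seq (move_to f f.+3) (Loop f.+3 (fun _ => Seq (Push f one) grow))) T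
   (upd (upd (upd s f (u (a i.+1))) f.+2 (u (n2 - a i.+1))) f.+1 (u k)) (n2 * 6 + 2).
  move=> T; have ne : f != f.+3 by lia.
  have le_a : a i <= n2 by rewrite /a geq_minr.
  have mv := @runs_move f f.+3 (a i) T ne.
  apply: runs_le (runs_seq (mv _) (@runs_uloop f.+3 _
    (fun j => upd (upd T f (u (j + minn j (n2 - a i)))) f.+2 (u (n2 - a i - j)))
    (a i) 3 _ _ _ _ _)).
  - by lia.
  - by rewrite /T; regs.
  - by rewrite /T subn0 min0n; store_eq; rewrite ?he ?cats0 //; lia.
  - rewrite /T; store_eq; rewrite ?he //; try lia; congr u; rewrite /a expnS; lia.
  - move=> j lt_j; apply: runs_cast (runs_seq (runs_push _ _ _) (@growP _ (j + minn j (n2 - a i)).+1 (n2 - a i - j) _ _)).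
    + by store_eq; first [congr (u _); lia | congr (_ :: u _); lia].
    + by regs.
    + by regs.
have d1 : runs grow (upd (upd s f.+1 (u n1)) f.+2 (u n2))
    (upd (upd (upd s f.+1 (u n1)) f (u (a 0))) f.+2 (u (n2 - a 0))) 2.
  apply: runs_cast (@growP _ 0 n2 _ _); last 2 first.
  - by regs; rewrite he.
  - by regs.
  - by rewrite /a expn0; store_eq; congr u; lia.
apply: runs_le (runs_seq r1 (runs_seq r2 (runs_seq d1
  (runs_seq (s1 := upd (upd s f (u (a n1))) f.+2 (u (n2 - a n1))) (@runs_uloop f.+1 _ (fun i => upd (upd s f (u (a i))) f.+2 (u (n2 - a i))) n1
   (n2 * 6 + 2) _ _ _ _ _) (runs_cast _ (runs_drain f.+2 _)))))).
- by regs; rewrite size_nseq; nia.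
- by store_eq.
- by store_eq; rewrite he //; lia.
- by move=> i _; apply: inner.
- by store_eq; rewrite he //; lia.
Qed.

Lemma compiled_len : compiled Len.
Proof.
exists (fun y => y * 5 + 2); first by pb.
move=> rho f x env s rd /=; have [[s0 s1] f2 _ _ he] := rd.
split; first by rewrite /measure; lia.
set w := map bit x in s1 *.
have r1 : runs (Loop 1 (fun g => Seq (Push 0 g) (Push f one))) s
    (upd (upd (upd s f (u (size x))) 0 (rev (take (size w) w))) 1 (drop (size w) w))
    (size w * 3 + 1).
  pose st i := upd (upd (upd s f (u i)) 0 (rev (take i w))) 1 (drop i w).
  have {1}-> : s = st 0.
    by rewrite /st take0 drop0; store_eq; rewrite ?s0 ?s1 ?he.
  rewrite -{1}(size_map bit x) -/w.
  apply: (@runs_loop _ 1 _ st w 2) => [i _|i g l e]; first by rewrite /st; regs.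
  have [e1 e2] := drop_consE e.
  apply: runs_cast (runs_seq (runs_push _ _ _) (runs_push _ _ _)).
  by rewrite /st e1 e2 rev_rcons; store_eq.
have r2 : runs (Loop 0 (fun g => Push 1 g)) _ (upd s f (u (size x))) _ :=
  @restore_string x _ (size w) _ _.
apply: runs_le (runs_seq r1 (r2 _ _)).
- by rewrite /w size_map /measure; lia.
- by regs.
- by regs.
Qed.

Lemma compiled_at b e : compiled e -> compiled (At b e).
Proof.
move=> [h1 p1 H1]; exists (fun y => h1 y * 4 + y * 2 + 10); first by pb.
move=> rho f x env s rd /=.
have [v1 r1] := H1 _ _ _ _ _ (ready_free rd (leqnSn f)).
have [[s0 s1] f2 _ _ he] := rd.
set n1 := eval x env e in v1 r1 *; set w := map bit x in s1 *.
set res := (_ == Some b).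
split; first by case: res; lia.
pose st i := upd (upd s 0 (rev (take i w))) 1 (drop i w).
have r2 : runs (Loop f.+1 (fun _ => Case 1 (fun o => if o is Some g then Push 0 g else Skip G)))
   (upd s f.+1 (u n1)) (st n1) (n1 * 3 + 1).
  apply: (@runs_uloop f.+1 _ st).
  - by rewrite /st take0 drop0; store_eq.
  - by rewrite /st; store_eq; rewrite he //; lia.
  - move=> i lt_i; apply: runs_case; rewrite /st; regs.
    have [lt_w|le_w] := ltnP i (size w).
      case e1: w lt_w => [//|g0 w0] lt_w; rewrite -e1 in lt_w *.
      rewrite (drop_nth g0) //= (take_nth g0) // rev_rcons.
      by apply: runs_cast (runs_push _ _ _); store_eq.
    rewrite !drop_oversize ?(leqW le_w) //= !take_oversize ?(leqW le_w) //.
    by apply: runs_le (runs_cast _ (runs_skip _)) => //; store_eq.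
have r3 : runs (Case 1 (fun o => if o is Some g then
      Seq (Push 1 g) (if g == bit b then Push f one else Skip G) else Skip G))
   (st n1) (upd (upd (upd s f (u res)) 0 (rev (take n1 w))) 1 (drop n1 w)) 3.
  apply: runs_case; rewrite /st; regs.
  have [lt_w|le_w] := ltnP n1 (size x); last first.
    rewrite drop_oversize ?size_map //= /res nth_default ?size_map //.
    by apply: runs_le (runs_cast _ (runs_skip _)) => //; store_eq; rewrite he.
  rewrite (drop_nth (bit b)) ?size_map //= (nth_map b) //.
  have -> : res = (nth b x n1 == b) by rewrite /res (nth_map b).
  rewrite (inj_eq bit_inj); case: eqP => [e1|ne1].
    by apply: runs_cast (runs_seq (runs_push _ _ _) (runs_push _ _ _)); store_eq; rewrite he.
  apply: runs_le (runs_cast _ (runs_seq (runs_push _ _ _) (runs_skip _))) => //.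
  by store_eq; rewrite he.
have r4 := @restore_string x (upd s f (u res)) n1.
apply: runs_le (runs_seq r1 (runs_seq r2 (runs_seq r3 (r4 _ _)))).
- by have : size x <= measure x env; [rewrite /measure; lia | lia].
- by regs.
- by regs.
Qed.

Lemma compiled_var i : compiled (Var i).
Proof.
exists (fun y => y * 5 + 2); first by pb.
move=> rho f x env s rd; have le_v := nth_measure x env i.
split; first by rewrite /=; lia.
have [[s0 s1] f2 [sz hr] hs he] := rd.
set r := nth 0 rho i; have sr : s r = u (nth 0 env i).
  rewrite /r; have [lt_i|ge_i] := ltnP i (size env); first exact: hs.
  by rewrite !nth_default ?sz.
have lt_r : r < f.
  rewrite /r; have [/hr|ge_i] := ltnP i (size env); first lia.
  by rewrite nth_default ?sz; lia.
apply: runs_le (runs_cast _ (runs_seq (runs_copy _ _ _ sr) (@runs_move f.+1 r (nth 0 env i) _ _ _))).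
all: try lia.
- by rewrite -/r; store_eq; rewrite ?sr ?he ?cats0 //; lia.
- by regs; rewrite he ?cats0 //; lia.
Qed.

Lemma compiledP e : compiled e.
Proof.
elim: e => *; [exact: compiled_var | exact: compiled_cst | exact: compiled_add
  | exact: compiled_mul | exact: compiled_sub | exact: compiled_sum
  | exact: compiled_pow | exact: compiled_len | exact: compiled_at].
Qed.

End Expressions.

(** * Expressions for strings *)

Section Strings.
Variables (G : finType) (bit : bool -> G).
Hypothesis bit_inj : injective bit.
Let one := bit true.
Let u n : seq G := nseq n one.

Inductive sexp :=
| SNil | SBit (b : bool) | SCat (s1 s2 : sexp) | SIf (e : expr) (s1 s2 : sexp)
| SFor (e : expr) (s : sexp).

Fixpoint evals (x : seq bool) (env : seq nat) (w : sexp) : seq bool :=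
  match w with
  | SNil => [::]
  | SBit b => [:: b]
  | SCat w1 w2 => evals x env w1 ++ evals x env w2
  | SIf e w1 w2 => if 0 < eval x env e then evals x env w1 else evals x env w2
  | SFor e w => flatten [seq evals x (z :: env) w | z <- iota 0 (eval x env e)]
  end.

Fixpoint comps (rho : seq nat) (f : nat) (w : sexp) : prog G :=
  match w with
  | SNil => Skip G
  | SBit b => Push 2 (bit b)
  | SCat w1 w2 => Seq (comps rho f w1) (comps rho f w2)
  | SIf e w1 w2 =>
      Seq (comp bit rho f e)
        (Case f (fun o => if o then Seq (drain G f) (comps rho f w1) else comps rho f w2))
  | SFor e w =>
      Seq (comp bit rho f e)
       (Seq (Loop f (fun _ => Seq (comps (f.+1 :: rho) f.+2 w) (Push f.+1 one)))
            (drain G f.+1))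
  end.

(** Register 2 is a stack, so the output is kept reversed, with its last bit on top. *)
Definition emit (v : seq bool) (s : nat -> seq G) := upd s 2 (rev (map bit v) ++ s 2).

Lemma emit_cat v w s : emit (v ++ w) s = emit w (emit v s).
Proof. by rewrite /emit map_cat rev_cat; store_eq; rewrite catA. Qed.

Definition scompiled w := exists2 h, poly_bounded h &
  forall rho f x env s, ready bit rho f x env s ->
    runs (comps rho f w) s (emit (evals x env w) s) (h (measure x env)).

Lemma ready_emit rho f x env s v : ready bit rho f x env s ->
  ready bit rho f x env (emit v s).
Proof.
move=> rd; have [_ f2 _ _ he] := rd; apply: (ready_upd rd) => // r h.
  by move=> ne; rewrite /emit; regs.
by rewrite /emit; regs; rewrite he.
Qed.

Lemma scompiledP w : scompiled w.
Proof.
elim: w => [|b|w1 [h1 p1 H1] w2 [h2 p2 H2]|e w1 [h1 p1 H1] w2 [h2 p2 H2]|e w [h2 [d2 p2] H2]].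
- exists (fun _ => 0); first by pb.
  by move=> rho f x env s _; apply: runs_cast (runs_skip _); rewrite /emit upd_same.
- exists (fun _ => 1); first by pb.
  by move=> rho f x env s _; apply: runs_cast (runs_push _ _ _).
- exists (fun y => h1 y + h2 y); first by pb.
  move=> rho f x env s rd; rewrite /= emit_cat.
  by apply: runs_seq (H1 _ _ _ _ _ rd) (H2 _ _ _ _ _ (ready_emit _ rd)).
- have [h0 p0 H0] := compiledP bit_inj e.
  exists (fun y => h0 y * 2 + h1 y + h2 y + 2); first by pb.
  move=> rho f x env s rd /=; have [v0 r0] := H0 _ _ _ _ _ rd.
  have [_ f2 _ _ he] := rd; set n := eval x env e in v0 r0 *.
  case: n v0 r0 => [|n] v0 r0 /=.
    apply: runs_le (runs_seq r0 (runs_case _)); last first.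
      rewrite (_ : upd s f (u 0) f = [::]) /=; last by regs.
      have -> : upd (upd s f (u 0)) f [::] = s by store_eq; rewrite he.
      exact: H2 rd.
    by lia.
  have st : upd (upd s f (u n)) f [::] = s by store_eq; rewrite he.
  apply: runs_le (runs_seq r0 (runs_case _)); last first.
    rewrite (_ : upd s f (u n.+1) f = u n.+1) /=; last by regs.
    have -> : upd (upd s f (u n.+1)) f (nseq n one) = upd s f (u n) by store_eq.
    by apply: runs_seq (runs_cast st (runs_drain _ _)) _; apply: H1 rd.
  by regs; rewrite size_nseq; lia.
- have [h1 p1 H1] := compiledP bit_inj e.
  exists (fun y => h1 y + (h1 y * ((y + h1 y) ^ d2 + 2) + 1 + (h1 y + 1))); first by pb.
  move=> rho f x env s rd /=; have [v1 r1] := H1 _ _ _ _ _ rd.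
  have [_ f2 _ _ he] := rd; set y := measure x env in v1 r1 *.
  set n1 := eval x env e in v1 r1 *; set g := fun z => evals x (z :: env) w.
  pose st i := upd (emit (flatten [seq g z | z <- iota 0 i]) s) f.+1 (u i).
  apply: runs_le (runs_seq r1 (runs_seq (s1 := upd (st n1) f [::]) (@runs_uloop _ bit f _ st n1
    ((y + h1 y) ^ d2 + 1) _ _ _ _ _) (runs_cast _ (runs_drain f.+1 _)))).
  + by rewrite /st /emit; regs; rewrite size_nseq; nia.
  + by rewrite /st /emit /=; store_eq; rewrite he //; lia.
  + by [].
  + move=> i lt_i; set T := upd (st i) f _.
    have rd2 : ready bit (f.+1 :: rho) f.+2 x (i :: env) T.
      apply: (ready_var rd); [lia | | | ].
      - by move=> r lt_r ne2; rewrite /T /st /emit; regs.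
      - by move=> r le_r; rewrite /T /st /emit; regs; rewrite he //; lia.
      - by rewrite /T /st; regs.
    have := measure_cons x env p2 lt_i v1; rewrite -/y => le_h.
    apply: runs_le (runs_cast _ (runs_seq (H2 _ _ _ _ _ rd2) (runs_push _ _ _))).
      by rewrite leq_add2r.
    have fl : flatten [seq g z | z <- iota 0 i.+1] = flatten [seq g z | z <- iota 0 i] ++ g i.
      by rewrite -addn1 iotaD map_cat flatten_cat /= cats0.
    by rewrite /T /st fl emit_cat -/(g i) /emit; store_eq.
  + by rewrite /st /emit; store_eq; rewrite he //; lia.
Qed.

End Strings.

(** * Functions definable by expressions *)

(** Quotients, logarithms and code lengths are defined by counting: they are sums of a condition on
    [z] that holds exactly for [z < q]. *)
Lemma sum_ltn q n : \sum_(0 <= z < n) (z < q) = minn q n.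
Proof.
elim: n => [|n IH]; first by rewrite big_nil minn0.
by rewrite big_nat_recr //= IH; lia.
Qed.

(** The carrier is any type of parameters from which a string and a list of variables can be read
    off. Definability thereby becomes a property of ordinary functions, and [ext] adds a bound
    variable as the second component of a pair. *)
Record context := Context {
  carrier : Type; cstr : carrier -> seq bool; cvars : carrier -> seq nat }.

Definition ext (C : context) : context :=
  @Context (carrier C * nat) (fun p => cstr p.1) (fun p => p.2 :: cvars p.1).

(* [rud] stands for rudimentary. *)
Definition rud (C : context) (f : carrier C -> nat) :=
  exists e, forall c, eval (cstr c) (cvars c) e = f c.

Definition srud (C : context) (f : carrier C -> seq bool) :=
  exists w, forall c, evals (cstr c) (cvars c) w = f c.

Fixpoint lift (k : nat) (e : expr) : expr :=
  match e with
  | Var i => if i < k then Var i else Var i.+1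
  | Cst c => Cst c
  | Add e1 e2 => Add (lift k e1) (lift k e2)
  | Mul e1 e2 => Mul (lift k e1) (lift k e2)
  | Sub e1 e2 => Sub (lift k e1) (lift k e2)
  | Sum e1 e2 => Sum (lift k e1) (lift k.+1 e2)
  | Pow e1 e2 => Pow (lift k e1) (lift k e2)
  | Len => Len
  | At b e => At b (lift k e)
  end.

Lemma eval_lift x e env1 env2 v :
  eval x (env1 ++ v :: env2) (lift (size env1) e) = eval x (env1 ++ env2) e.
Proof.
elim: e env1 => //=.
- move=> i env1; case: ltnP => h /=; rewrite !nth_cat ?h //.
  by rewrite ltnNge (leqW h) ltnNge h /= subSn.
- by move=> e1 IH1 e2 IH2 env1; rewrite IH1 IH2.
- by move=> e1 IH1 e2 IH2 env1; rewrite IH1 IH2.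
- by move=> e1 IH1 e2 IH2 env1; rewrite IH1 IH2.
- move=> e1 IH1 e2 IH2 env1; rewrite IH1; apply: eq_bigr => z _.
  exact: (IH2 (z :: env1)).
- by move=> e1 IH1 e2 IH2 env1; rewrite IH1 IH2.
- by move=> b e IH env1; rewrite IH.
Qed.

Section Rud.
Variable C : context.
Implicit Types (f g : carrier C -> nat) (P Q : carrier C -> bool).

Lemma rud_wk f : rud f -> rud (C := ext C) (fun p => f p.1).
Proof.
move=> [e he]; exists (lift 0 e) => -[c z] /=.
exact: etrans (eval_lift _ _ [::] _ _) (he c).
Qed.

Lemma rud_ext f g : f =1 g -> rud f -> rud g.
Proof. by move=> fg [e he]; exists e => c; rewrite he. Qed.

Lemma rud_cst n : rud (fun _ : carrier C => n).
Proof. by exists (Cst n). Qed.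

Lemma rud_v0 : rud (C := ext C) (fun p => p.2).
Proof. by exists (Var 0). Qed.

Lemma rud_add f g : rud f -> rud g -> rud (fun c => f c + g c).
Proof. by move=> [e he] [e' he']; exists (Add e e') => c /=; rewrite he he'. Qed.

Lemma rud_mul f g : rud f -> rud g -> rud (fun c => f c * g c).
Proof. by move=> [e he] [e' he']; exists (Mul e e') => c /=; rewrite he he'. Qed.

Lemma rud_sub f g : rud f -> rud g -> rud (fun c => f c - g c).
Proof. by move=> [e he] [e' he']; exists (Sub e e') => c /=; rewrite he he'. Qed.

Lemma rud_sum f (g : carrier C -> nat -> nat) :
  rud f -> rud (C := ext C) (fun p => g p.1 p.2) ->
  rud (fun c => \sum_(0 <= z < f c) g c z).
Proof.
move=> [e he] [e' he']; exists (Sum e e') => c /=; rewrite he.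
by apply: eq_bigr => z _; apply: (he' (c, z)).
Qed.

Lemma rud_minpow f g : rud f -> rud g -> rud (fun c => minn (2 ^ f c) (g c)).
Proof. by move=> [e he] [e' he']; exists (Pow e e') => c /=; rewrite he he'. Qed.

(** The cap of [Pow] is harmless as soon as a definable function dominates the power. *)
Lemma rud_pow f g : (forall c, 2 ^ f c <= g c) -> rud f -> rud g ->
  rud (fun c => 2 ^ f c).
Proof.
move=> le_fg hf hg; apply: rud_ext (rud_minpow hf hg) => c.
exact/minn_idPl.
Qed.

Lemma rud_len : rud (fun c : carrier C => size (cstr c)).
Proof. by exists Len. Qed.

Lemma rud_at b f : rud f ->
  rud (fun c => (nth None (map Some (cstr c)) (f c) == Some b : nat)).
Proof. by move=> [e he]; exists (At b e) => c /=; rewrite he. Qed.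

Lemma rud_succ f : rud f -> rud (fun c => (f c).+1).
Proof.
by move=> hf; apply: rud_ext (rud_add hf (rud_cst 1)) => c; rewrite addn1.
Qed.

Lemma rud_exp f n : rud f -> rud (fun c => f c ^ n).
Proof.
move=> hf; elim: n => [|n IH]; first exact: rud_cst.
by apply: rud_ext (rud_mul hf IH) => c; rewrite expnS.
Qed.

Lemma rud_leq f g : rud f -> rud g -> rud (fun c => (f c <= g c : nat)).
Proof.
move=> hf hg; apply: rud_ext (rud_sub (rud_cst 1) (rud_sub hf hg)) => c.
by case: leqP => h; lia.
Qed.

Lemma rud_ltn f g : rud f -> rud g -> rud (fun c => (f c < g c : nat)).
Proof. by move=> hf hg; apply: rud_leq (rud_succ hf) hg. Qed.

Lemma rud_and P Q : rud (fun c => (P c : nat)) -> rud (fun c => (Q c : nat)) ->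
  rud (fun c => (P c && Q c : nat)).
Proof.
by move=> hP hQ; apply: rud_ext (rud_mul hP hQ) => c; case: (P c); case: (Q c).
Qed.

Lemma rud_not P : rud (fun c => (P c : nat)) -> rud (fun c => (~~ P c : nat)).
Proof.
by move=> hP; apply: rud_ext (rud_sub (rud_cst 1) hP) => c; case: (P c).
Qed.

Lemma rud_or P Q : rud (fun c => (P c : nat)) -> rud (fun c => (Q c : nat)) ->
  rud (fun c => (P c || Q c : nat)).
Proof.
move=> hP hQ; apply: rud_ext (rud_not (rud_and (rud_not hP) (rud_not hQ))) => c.
by case: (P c); case: (Q c).
Qed.

Lemma rud_eq f g : rud f -> rud g -> rud (fun c => (f c == g c : nat)).
Proof.
move=> hf hg; apply: rud_ext (rud_and (rud_leq hf hg) (rud_leq hg hf)) => c.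
by rewrite eqn_leq.
Qed.

Lemma rud_if P f g : rud (fun c => (P c : nat)) -> rud f -> rud g ->
  rud (fun c => if P c then f c else g c).
Proof.
move=> hP hf hg.
apply: rud_ext (rud_add (rud_mul hP hf) (rud_mul (rud_not hP) hg)) => c.
by case: (P c); rewrite ?mul1n ?mul0n ?addn0.
Qed.

End Rud.

Arguments rud_cst {C} n.
Arguments rud_v0 {C}.
Arguments rud_len {C}.

Section RudLibrary.
Variable C : context.
Implicit Types (f g : carrier C -> nat) (P Q : carrier C -> bool).

(** The quotient counts the [z] with [z.+1 * g c <= f c]; the factor in front settles division by
    zero. *)
Lemma rud_div f g : rud f -> rud g -> rud (fun c => f c %/ g c).
Proof.
move=> hf hg; have := rud_mul (rud_ltn (rud_cst 0) hg)
  (rud_sum (g := fun c z => (z.+1 * g c <= f c : nat)) hf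
    (rud_leq (rud_mul (rud_succ rud_v0) (rud_wk hg)) (rud_wk hf))).
apply: rud_ext => c; case: posnP => [->|g0]; first by rewrite divn0.
rewrite mul1n (eq_bigr (fun z => (z < f c %/ g c : nat))); last first.
  by move=> z _; rewrite leq_divRL.
rewrite sum_ltn; apply/minn_idPl; exact: leq_div.
Qed.

Lemma rud_mod f g : rud f -> rud g -> rud (fun c => f c %% g c).
Proof.
move=> hf hg; apply: rud_ext (rud_sub hf (rud_mul (rud_div hf hg) hg)) => c.
by rewrite {1}(divn_eq (f c) (g c)) addKn.
Qed.

Lemma rud_odd f : rud f -> rud (fun c => (odd (f c) : nat)).
Proof. by move=> hf; apply: rud_ext (rud_mod hf (rud_cst 2)) => c; rewrite modn2. Qed.

(** Counts the [z] with 2^(z+1) at most [f c]; capping the power at [(f c).+1] does not affect this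
    comparison. *)
Lemma rud_log f : rud f -> rud (fun c => trunc_log 2 (f c)).
Proof.
move=> hf; have := rud_sum
  (g := fun c z => (minn (2 ^ z.+1) (f c).+1 <= f c : nat)) hf
    (rud_leq (rud_minpow (rud_succ rud_v0) (rud_succ (rud_wk hf))) (rud_wk hf)).
apply: rud_ext => c; case: (posnP (f c)) => [->|f0]; first by rewrite big_nil trunc_log0.
rewrite (eq_bigr (fun z => (z < trunc_log 2 (f c) : nat))); last first.
  move=> z _; rewrite geq_min ltnn orbF; congr nat_of_bool; apply/idP/idP => h.
    exact: trunc_log_max.
  by apply: leq_trans (trunc_logP (isT : 1 < 2) f0); rewrite leq_exp2l.
rewrite sum_ltn; apply/minn_idPl.
by apply: leq_trans (trunc_logP (isT : 1 < 2) f0); apply: ltnW; apply: ltn_expl.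
Qed.

Lemma rud_sumseq (T : Type) (l : seq T) (h : T -> carrier C -> nat) :
  (forall y, rud (h y)) -> rud (fun c => \sum_(y <- l) h y c).
Proof.
move=> hh; elim: l => [|y l IH].
  by apply: rud_ext (rud_cst 0) => c; rewrite big_nil.
by apply: rud_ext (rud_add (hh y) IH) => c; rewrite big_cons.
Qed.

(** A finite function written as a sum of products of indicators on the ranks of its arguments,
    which turns it into arithmetic; it is 0 off the ranks. *)
Definition table (T1 T2 : finType) (h : T1 -> T2 -> nat) (i j : nat) : nat :=
  \sum_(a : T1) \sum_(b : T2)
    (i == enum_rank a :> nat) * ((j == enum_rank b :> nat) * h a b).

Lemma rud_table (T1 T2 : finType) (h : T1 -> T2 -> nat) f g :
  rud f -> rud g -> rud (fun c => table h (f c) (g c)).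
Proof.
move=> hf hg; apply: rud_sumseq => a; apply: rud_sumseq => b.
by apply: rud_mul (rud_eq hf (rud_cst _)) (rud_mul (rud_eq hg (rud_cst _)) (rud_cst _)).
Qed.

Lemma srud_ext (f g : carrier C -> seq bool) : f =1 g -> srud f -> srud g.
Proof. by move=> fg [w hw]; exists w => c; rewrite hw. Qed.

Lemma srud_cat (f g : carrier C -> seq bool) :
  srud f -> srud g -> srud (fun c => f c ++ g c).
Proof. by move=> [e he] [e' he']; exists (SCat e e') => c /=; rewrite he he'. Qed.

Lemma srud_cst v : srud (fun _ : carrier C => v).
Proof.
elim: v => [|b v [w hw]]; first by exists SNil.
by exists (SCat (SBit b) w) => c /=; rewrite hw.
Qed.

Lemma srud_if P (f g : carrier C -> seq bool) :
  rud (fun c => (P c : nat)) -> srud f -> srud g ->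
  srud (fun c => if P c then f c else g c).
Proof.
move=> [e he] [w hw] [w' hw']; exists (SIf e w w') => c /=.
by rewrite he hw hw'; case: (P c).
Qed.

Lemma srud_for f (g : carrier C -> nat -> seq bool) :
  rud f -> srud (C := ext C) (fun p => g p.1 p.2) ->
  srud (fun c => flatten [seq g c z | z <- iota 0 (f c)]).
Proof.
move=> [e he] [w hw]; exists (SFor e w) => c /=; rewrite he.
by congr flatten; apply: eq_map => z; apply: (hw (c, z)).
Qed.

End RudLibrary.

Arguments srud_cst {C} v.

Lemma table_rank (T1 T2 : finType) (h : T1 -> T2 -> nat) a b :
  table h (enum_rank a) (enum_rank b) = h a b.
Proof.
rewrite /table (bigD1 a) //= (bigD1 b) //= !eqxx !mul1n !big1 ?addn0 //.
  move=> a' /negPf ne; rewrite big1 // => b' _.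
  by rewrite (inj_eq val_inj) (inj_eq enum_rank_inj) eq_sym ne.
move=> b' /negPf ne.
by rewrite (inj_eq val_inj) (inj_eq enum_rank_inj) eq_sym ne.
Qed.

Lemma rud_v1 {C} : rud (C := ext (ext C)) (fun p => p.1.2).
Proof. exact: (rud_wk rud_v0). Qed.
Lemma rud_v2 {C} : rud (C := ext (ext (ext C))) (fun p => p.1.1.2).
Proof. exact: (rud_wk rud_v1). Qed.

Lemma srud_nat C (f : carrier C -> nat) : rud f -> srud (fun c => code_nat (f c)).
Proof.
move=> hf; have := srud_cat (srud_for (g := fun c z =>
    [:: true] ++ if odd (f c %/ minn (2 ^ z) (f c).+1) then [:: true] else [:: false])
    (rud_succ (rud_log hf)) (srud_cat (srud_cst _) (srud_if (rud_odd (rud_div (rud_wk hf) (rud_minpow rud_v0 (rud_succ (rud_wk hf)))))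
      (srud_cst _) (srud_cst _))))
  (srud_cst [:: false]).
apply: srud_ext => c; rewrite /code_nat /block /nat_bits -map_comp; congr (flatten _ ++ _).
apply/eq_in_map => z; rewrite mem_iota add0n ltnS => /andP[_ le_z] /=.
have [f0|f0] := posnP (f c).
  by move: le_z; rewrite f0 trunc_log0 leqn0 => /eqP->.
have -> : minn (2 ^ z) (f c).+1 = 2 ^ z.
  apply/minn_idPl; apply: leqW; apply: leq_trans (trunc_logP (isT : 1 < 2) f0).
  by rewrite leq_exp2l.
by case: odd.
Qed.

(** * Composition with a given polynomial-time machine *)

Section Pipeline.
Variable A : machine.
Variables (dA : nat) (fA : seq bool -> seq bool).
Hypothesis hA : computes A (fun s => s ^ dA + dA) fA.
Variables (eW eT eAcc : expr) (w0 : sexp).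

Let G : finType := (option (bool + aux A) + state A)%type.
Let bit (b : bool) : G := inl (Some (inl b)).
Let one := bit true.
Let u n : seq G := nseq n one.
Let blank : G := inl None.

Lemma bit_inj : injective bit. Proof. by move=> b b' []. Qed.

Definition regs_of (l : seq (seq G)) : nat -> seq G := nth [::] ([::] :: l).

Ltac st_eq := apply: funext; rewrite /regs_of /upd;
  do 10 (case; [by rewrite /= ?revK ?cats0|]); by move=> ?; rewrite /= ?nth_nil.

Lemma comp_runs e : exists d, forall rho f x env s, ready bit rho f x env s ->
  eval x env e <= (measure x env) ^ d /\
  runs (comp bit rho f e) s (upd s f (u (eval x env e))) ((measure x env) ^ d).
Proof.
have [h [d hd] H] := compiledP bit_inj e; exists d => rho f x env s rd.
have [le_v r] := H _ _ _ _ _ rd.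
have le_h : h (measure x env) <= measure x env ^ d by apply: hd; rewrite /measure; lia.
by split; [exact: leq_trans le_h | exact: runs_le r].
Qed.

Lemma comps_runs w : exists d, forall rho f x env s, ready bit rho f x env s ->
  size (evals x env w) <= (measure x env) ^ d /\
  runs (comps bit rho f w) s (emit bit (evals x env w) s) ((measure x env) ^ d).
Proof.
have [h [d hd] H] := scompiledP bit_inj w; exists d => rho f x env s rd.
have r := H _ _ _ _ _ rd.
have le_h : h (measure x env) <= measure x env ^ d by apply: hd; rewrite /measure; lia.
split; last exact: runs_le r.
have [t le_t /(exec_size 2)] := r; rewrite /emit /upd /= size_cat size_rev size_map.
lia.
Qed.

Definition pull r d : prog G :=
  Case r (fun o => Push d (if o is Some g then g else blank)).

Lemma pull_runs r d (s : nat -> seq G) : r != d ->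
  runs (pull r d) s (upd (upd s r (behead (s r))) d (head blank (s r) :: s d)) 2.
Proof.
move=> /eqP ne; apply: runs_case; apply: runs_cast (runs_push _ _ _).
by store_eq; case: (s r).
Qed.

(** Registers 1 and 2 hold the tape to the right and to the left of the head, 6 the scanned symbol,
    7 the state. Where [delta] is undefined the configuration is put back, so surplus iterations do
    no harm. *)
Definition simulate_step : prog G :=
  Case 7 (fun oq => if oq is Some (inr q) then
    Case 6 (fun oa => if oa is Some (inl a) then
      match delta q a with
      | None => Seq (Push 6 (inl a)) (Push 7 (inr q))
      | Some (q', a', d) =>
          Seq (Push 7 (inr q'))
            match d with
            | Stay => Push 6 (inl a')
            | Left => Seq (Push 1 (inl a')) (pull 2 6)
            | Right => Seq (Push 2 (inl a')) (pull 1 6)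
            end
      end
     else Skip G)
   else Skip G).

Definition config_regs (c : config A) (th k : nat) : nat -> seq G :=
  regs_of [:: map inl (after c); map inl (before c); [::]; u th; u k;
              [:: inl (scanned c)]; [:: inr (cstate c)]].

Lemma simulate_step_runs c th k :
  runs simulate_step (config_regs c th k) (config_regs (next c) th k) 6.
Proof.
apply: runs_case; rewrite {1}/config_regs /=.
apply: runs_le (leqnn 5) (runs_case _); rewrite /=.
rewrite /next /step; case e: delta => [[[q' a'] d]|] /=; last first.
  apply: runs_le (runs_cast _ (runs_seq (runs_push _ _ _) (runs_push _ _ _))) => //.
  by rewrite /config_regs; st_eq.
case: d e => /= e.
- apply: runs_le (runs_cast _ (runs_seq (runs_push _ _ _) (runs_seq (runs_push _ _ _) (pull_runs _ _)))) => //.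
  rewrite /config_regs; case: (before c) => [|g l] /=; st_eq.
- apply: runs_le (runs_cast _ (runs_seq (runs_push _ _ _) (runs_push _ _ _))) => //.
  by rewrite /config_regs; st_eq.
- apply: runs_le (runs_cast _ (runs_seq (runs_push _ _ _) (runs_seq (runs_push _ _ _) (pull_runs _ _)))) => //.
  rewrite /config_regs; case: (after c) => [|g l] /=; st_eq.
Qed.

Lemma simulate_runs c th n :
  runs (Loop 5 (fun _ => simulate_step)) (config_regs c th n)
    (config_regs (iter n (@next A) c) th 0) (n * 7 + 1).
Proof.
apply: (@runs_uloop _ bit 5 _ (fun i => config_regs (iter i (@next A) c) th 0)).
- by rewrite /config_regs; st_eq.
- by rewrite /config_regs; st_eq.
- move=> i _; have e c' k : upd (config_regs c' th 0) 5 (u k) = config_regs c' th k.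
    by rewrite /config_regs; st_eq.
  by rewrite !e iterS; apply: simulate_step_runs.
Qed.

(** Expressions are polynomially bounded, so the power 2^W is made outside of them: register 5 is
    doubled as often as register 3 says. Each other stage is polynomial in the data it receives. *)
Definition double : prog G :=
  Loop 3 (fun _ => Seq (move_to bit 5 6) (Loop 6 (fun _ => Seq (Push 5 one) (Push 5 one)))).

Definition keep_bits : prog G :=
  Loop 1 (fun g => if g is inl (Some (inl b)) then Push 2 (bit b) else Skip G).

Lemma double_runs x th n :
  runs double (regs_of [:: map bit x; [::]; u n; u th; u 1])
              (regs_of [:: map bit x; [::]; [::]; u th; u (2 ^ n)])
              (n * (2 ^ n * 5 + 3) + 1).
Proof.
pose st i := regs_of [:: map bit x; [::]; [::]; u th; u (2 ^ i)].
have le2 i : i < n -> 2 ^ i <= 2 ^ n by move=> lt_i; rewrite leq_exp2l // ltnW.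
apply: runs_le (@runs_uloop _ bit 3 _ st n (2 ^ n * 5 + 2) _ _ _ _ _).
- by rewrite -addnS.
- by rewrite /st; st_eq.
- by rewrite /st; st_eq.
- move=> i lt_i; set k := n - i.+1; have le_i := le2 i lt_i.
  have s5 : upd (st i) 3 (u k) 5 = u (2 ^ i) by [].
  have mv := @runs_move _ bit 5 6 _ _ isT s5.
  apply: runs_le (runs_seq mv (@runs_uloop _ bit 6 _
     (fun j => upd (upd (st i) 3 (u k)) 5 (u (j + j))) (2 ^ i) 2 _ _ _ _ _)).
  + by lia.
  + by rewrite /st /upd /= cats0; st_eq.
  + by rewrite /st expnS mul2n -addnn; st_eq.
  + move=> j _; apply: runs_cast (runs_seq (runs_push _ _ _) (runs_push _ _ _)).
    by rewrite /st addnS addSn; st_eq.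
Qed.

Lemma keep_bits_runs (l : seq (symbol A)) th :
  runs keep_bits (regs_of [:: map inl l; [::]; [::]; u th])
    (regs_of [:: [::]; rev (map bit (pmap (@bit_of A) l)); [::]; u th])
    (size l * 2 + 1).
Proof.
pose st i := regs_of [:: drop i (map inl l); rev (map bit (pmap (@bit_of A) (take i l)));
   [::]; u th].
have e0 : regs_of [:: map inl l; [::]; [::]; u th] = st 0.
  by rewrite /st drop0 take0.
have e1 : regs_of [:: [::]; rev (map bit (pmap (@bit_of A) l)); [::]; u th]
    = st (size (map inl l : seq G)).
  by rewrite /st drop_size size_map take_size.
have es : size (map inl l : seq G) = size l by rewrite size_map.
rewrite e0 e1 -es.
apply: (@runs_loop _ 1 _ st (map inl l) 1) => [i _|i g l' e]; first by [].
have [_ dr] := drop_consE e; move: e; rewrite -map_drop.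
case el : (drop i l) => [//|a l2] [<- _]; have [et _] := drop_consE el.
rewrite /st dr et -cats1 pmap_cat map_cat rev_cat.
case: a {el et} => [[b|a]|] /=.
- by apply: runs_cast (runs_push _ _ _); st_eq.
- by apply: runs_le (runs_cast _ (runs_skip _)) => //; st_eq.
- by apply: runs_le (runs_cast _ (runs_skip _)) => //; st_eq.
Qed.

(** Register 1 holds in turn the input, the code written by [w0] and the output of [A]. Register 4
    keeps the threshold for the final test; register 5 holds 2^W and later the fuel of the
    simulation. Strings accumulate reversed in register 2 and are transferred back to register 1. *)
Definition pipeline (eF : expr) : prog G :=
  foldr (@Seq G) (Skip G) [::
    Loop 0 (fun g => Push 1 g);
    comp bit [::] 3 eW;
    comp bit [::] 4 eT;
    Push 5 one;
    double;
    comps bit [:: 5] 6 w0;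
    drain G 1;
    drain G 5;
    Loop 2 (fun g => Push 1 g);
    comp bit [::] 5 eF;
    pull 1 6;
    Push 7 (inr (start A));
    Loop 5 (fun _ => simulate_step);
    drain G 7;
    pull 6 1;
    Loop 2 (fun g => Push 1 g);
    keep_bits;
    Loop 2 (fun g => Push 1 g);
    comp bit [:: 4] 5 eAcc;
    move_to bit 5 2].

Definition fuel_expr : expr := Add (iter dA (Mul Len) (Cst 1)) (Cst dA).

Lemma eval_fuel x env : eval x env fuel_expr = size x ^ dA + dA.
Proof.
by rewrite /=; congr addn; elim: dA => //= d ->; rewrite expnS.
Qed.

Definition final_value (x : seq bool) : nat :=
  let code := evals x [:: 2 ^ eval x [::] eW] w0 in
  eval (fA code) [:: eval x [::] eT] eAcc.

Lemma next_sizes n (c : config A) :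
  size (before (iter n (@next A) c)) <= size (before c) + n /\
  size (before (iter n (@next A) c)) + size (after (iter n (@next A) c))
     <= size (before c) + size (after c) + n.
Proof.
elim: n => [|n [IH1 IH2]]; first by rewrite !addn0.
rewrite iterS; move: (iter n _ c) IH1 IH2 => c'.
rewrite /next /step; case: delta => [[[q a] d]|] /=; last by lia.
by case: d => /=; [case: (before c') => [|? ?] /= | | case: (after c') => [|? ?] /=]; lia.
Qed.

Lemma ready_regs (l : seq (seq G)) rho f x env :
  nth [::] l 0 = map bit x -> size l < f -> 2 < f ->
  size rho = size env ->
  (forall i, i < size env -> 2 < nth 0 rho i < f /\
     nth [::] ([::] :: l) (nth 0 rho i) = u (nth 0 env i)) ->
  ready bit rho f x env (regs_of l).
Proof.
move=> l0 le_f f2 sz h; split=> //.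
- by split=> // i /h[].
- by move=> i /h[].
- by move=> r le_r; rewrite /regs_of nth_default //; apply: leq_trans le_r.
Qed.

Lemma pipeline_runs : exists p : prog G, exists2 h, poly_bounded h &
  forall x, exists s',
    [/\ runs p (input_store bit x) s' (h (size x + 2 + 2 ^ eval x [::] eW)),
        s' 0 = [::] & s' 2 = u (final_value x)].
Proof.
have [a Ha] := comp_runs eW; have [b Hb] := comp_runs eT.
have [c Hc] := comps_runs w0; have [e He] := comp_runs fuel_expr.
have [g Hg] := comp_runs eAcc.
exists (pipeline fuel_expr).
(* [F] bounds the fuel, computed from a code of length at most [y ^ c]; [O] bounds the tape of [A]
   after that many steps. *)
pose F y := (y ^ c + 2) ^ e.
pose O y := y ^ c + F y + 3.
exists (fun y => (y * 2 + 1) + (y ^ a + (y ^ b + (1 + ((y ^ a * (y * 5 + 3) + 1)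
  + (y ^ c + ((y + 1) + ((y + 1) + ((y ^ c * 2 + 1) + (F y + (2 + (1 +
  ((F y * 7 + 1) + (2 + (2 + ((O y * 2 + 1) + ((O y * 2 + 1) +
  ((O y * 2 + 1) + ((O y + y ^ b + 2) ^ g + ((O y + y ^ b + 2) ^ g * 2 + 1))))))))))))))))))));
  first by rewrite /O /F; pb.
move=> x; set W := eval x [::] eW; set th := eval x [::] eT.
set y := size x + 2 + 2 ^ W.
have mx : measure x [::] <= y by rewrite /measure /y /=; lia.
have y0 : 0 < y by rewrite /y; lia.
have powx d : measure x [::] ^ d <= y ^ d by apply: leq_pow.
set code := evals x [:: 2 ^ W] w0.
exists (regs_of [:: map bit (fA code); u (final_value x); [::]; u th]).
split=> //.
pose B := map bit x; pose D := map bit code.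
pose S1 := regs_of [:: B].
have rd0 : ready bit [::] 3 x [::] S1 by apply: ready_regs => // -[].
have le_W : W <= y ^ a.
  have [le_v _] := Ha _ _ _ _ _ rd0.
  exact: leq_trans le_v (powx a).
have r0 : runs (Loop 0 (fun g => Push 1 g)) (input_store bit x) S1 (y * 2 + 1).
  apply: runs_le (runs_cast _ (@runs_transfer G 0 1 _ isT)).
    by rewrite /input_store /upd /= size_rev size_map /y; lia.
  by rewrite /input_store /upd /= revK /S1; st_eq.
have r1 : runs (comp bit [::] 3 eW) S1 (regs_of [:: B; [::]; u W]) (y ^ a).
  have [_ r] := Ha _ _ _ _ _ rd0.
  by apply: runs_le (runs_cast _ r) => //; rewrite /S1; st_eq.
have rd2 : ready bit [::] 4 x [::] (regs_of [:: B; [::]; u W]).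
  by apply: ready_regs => // -[].
have [le_th r2] := Hb _ _ _ _ _ rd2.
have {}le_th : th <= y ^ b by apply: leq_trans (powx b).
have {}r2 : runs (comp bit [::] 4 eT) (regs_of [:: B; [::]; u W])
   (regs_of [:: B; [::]; u W; u th]) (y ^ b).
  by apply: runs_le (runs_cast _ r2) => //; st_eq.
have r3 : runs (Push 5 one) (regs_of [:: B; [::]; u W; u th])
   (regs_of [:: B; [::]; u W; u th; u 1]) 1.
  by apply: runs_cast (runs_push _ _ _); st_eq.
have r4 : runs double (regs_of [:: B; [::]; u W; u th; u 1])
   (regs_of [:: B; [::]; [::]; u th; u (2 ^ W)]) (y ^ a * (y * 5 + 3) + 1).
  apply: runs_le (double_runs x th W); rewrite leq_add2r leq_mul //.
  by rewrite leq_add2r leq_mul2r /= /y; lia.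
have rd5 : ready bit [:: 5] 6 x [:: 2 ^ W] (regs_of [:: B; [::]; [::]; u th; u (2 ^ W)]).
  by apply: ready_regs => // -[].
have [le_code r5] := Hc _ _ _ _ _ rd5.
have my : measure x [:: 2 ^ W] = y by rewrite /measure /y /=; lia.
rewrite -/code my in le_code r5.
have {}r5 : runs (comps bit [:: 5] 6 w0) (regs_of [:: B; [::]; [::]; u th; u (2 ^ W)])
  (regs_of [:: B; rev D; [::]; u th; u (2 ^ W)]) (y ^ c).
  by apply: runs_cast r5; rewrite /emit; st_eq.
have r6 : runs (drain G 1) (regs_of [:: B; rev D; [::]; u th; u (2 ^ W)])
   (regs_of [:: [::]; rev D; [::]; u th; u (2 ^ W)]) (y + 1).
  apply: runs_le (runs_cast _ (runs_drain _ _)); last by st_eq.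
  by rewrite /regs_of /= size_map /y; lia.
have r7 : runs (drain G 5) (regs_of [:: [::]; rev D; [::]; u th; u (2 ^ W)])
   (regs_of [:: [::]; rev D; [::]; u th]) (y + 1).
  apply: runs_le (runs_cast _ (runs_drain _ _)); last by st_eq.
  by rewrite /regs_of /= size_nseq /y; lia.
have r8 : runs (Loop 2 (fun g => Push 1 g)) (regs_of [:: [::]; rev D; [::]; u th])
   (regs_of [:: D; [::]; [::]; u th]) (y ^ c * 2 + 1).
  apply: runs_le (runs_cast _ (@runs_transfer G 2 1 _ isT)).
    by rewrite /regs_of /= size_rev size_map; lia.
  by st_eq.
have rd9 : ready bit [::] 5 code [::] (regs_of [:: D; [::]; [::]; u th]).
  by apply: ready_regs => // -[].
have [le_fuel r9] := He _ _ _ _ _ rd9; rewrite eval_fuel in le_fuel r9.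
set fuel := size code ^ dA + dA in le_fuel r9.
have le_mF : measure code [::] ^ e <= F y.
  by apply: leq_pow; rewrite /measure /=; lia.
have {}le_fuel := leq_trans le_fuel le_mF.
have {}r9 : runs (comp bit [::] 5 fuel_expr) (regs_of [:: D; [::]; [::]; u th])
   (regs_of [:: D; [::]; [::]; u th; u fuel]) (F y).
  by apply: runs_le le_mF (runs_cast _ r9); st_eq.
pose c0 := init A code.
have e0 : D = map inl [seq Some (inl b) | b <- code] by rewrite /D -map_comp.
have r10 : runs (pull 1 6) (regs_of [:: D; [::]; [::]; u th; u fuel])
   (regs_of [:: map inl (after c0); [::]; [::]; u th; u fuel; [:: inl (scanned c0)]]) 2.
  by apply: runs_cast (@pull_runs 1 6 _ isT); rewrite e0 /c0 /init /code; case: (evals _ _ _) => [|b0 l] /=; st_eq.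
have r11 : runs (Push 7 (inr (start A)))
   (regs_of [:: map inl (after c0); [::]; [::]; u th; u fuel; [:: inl (scanned c0)]])
   (config_regs c0 th fuel) 1.
  by apply: runs_cast (runs_push _ _ _); rewrite /config_regs /=; st_eq.
have r12 := simulate_runs c0 th fuel.
set c1 := iter fuel (@next A) c0 in r12.
pose B1 : seq G := map inl (before c1); pose A1 : seq G := map inl (after c1).
have r13 : runs (drain G 7) (config_regs c1 th 0)
   (regs_of [:: A1; B1; [::]; u th; [::]; [:: inl (scanned c1)]]) 2.
  by apply: runs_cast (runs_drain _ _); rewrite /config_regs; st_eq.
have r14 : runs (pull 6 1)
   (regs_of [:: A1; B1; [::]; u th; [::]; [:: inl (scanned c1)]])
   (regs_of [:: inl (scanned c1) :: A1; B1; [::]; u th]) 2.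
  by apply: runs_cast (@pull_runs 6 1 _ isT); st_eq.
have [le_b le_ba] := next_sizes fuel c0.
have le_a0 : size (after c0) <= size code.
  by rewrite /c0 /init /= size_behead size_map; lia.
rewrite -/c1 [size (before c0)]/= !add0n in le_b le_ba.
set tape := rev (before c1) ++ scanned c1 :: after c1.
have le_tape : size tape <= O y.
  by rewrite /tape size_cat size_rev /= /O; lia.
have r15 : runs (Loop 2 (fun g => Push 1 g))
   (regs_of [:: inl (scanned c1) :: A1; B1; [::]; u th])
   (regs_of [:: map inl tape; [::]; [::]; u th]) (O y * 2 + 1).
  apply: runs_le (runs_cast _ (@runs_transfer G 2 1 _ isT)).
    by rewrite /regs_of /= size_map /O; lia.
  by rewrite /tape map_cat map_rev; st_eq.
have out : pmap (@bit_of A) tape = fA code.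
  by have [_ <-] := hA code; rewrite /run -/c0 -/c1.
have r16 := keep_bits_runs tape th; rewrite out in r16.
have le_out : size (fA code) <= O y.
  by apply: leq_trans le_tape; rewrite -out size_pmap count_size.
have r17 : runs (Loop 2 (fun g => Push 1 g))
   (regs_of [:: [::]; rev (map bit (fA code)); [::]; u th])
   (regs_of [:: map bit (fA code); [::]; [::]; u th]) (O y * 2 + 1).
  apply: runs_le (runs_cast _ (@runs_transfer G 2 1 _ isT)).
    by rewrite /regs_of /= size_rev size_map; lia.
  by rewrite /regs_of /= revK; st_eq.
have rd19 : ready bit [:: 4] 5 (fA code) [:: th] (regs_of [:: map bit (fA code); [::]; [::]; u th]).
  by apply: ready_regs => // -[].
have [le_v r19] := Hg _ _ _ _ _ rd19.
have le_m : measure (fA code) [:: th] ^ g <= (O y + y ^ b + 2) ^ g.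
  by apply: leq_pow; rewrite /measure /=; lia.
have {}le_v := leq_trans le_v le_m.
rewrite -[eval _ _ _]/(final_value x) in le_v r19.
have {}r19 : runs (comp bit [:: 4] 5 eAcc) (regs_of [:: map bit (fA code); [::]; [::]; u th])
   (regs_of [:: map bit (fA code); [::]; [::]; u th; u (final_value x)]) ((O y + y ^ b + 2) ^ g).
  by apply: runs_le le_m (runs_cast _ r19); st_eq.
have r20 : runs (move_to bit 5 2)
   (regs_of [:: map bit (fA code); [::]; [::]; u th; u (final_value x)])
   (regs_of [:: map bit (fA code); u (final_value x); [::]; u th])
   ((O y + y ^ b + 2) ^ g * 2 + 1).
  apply: runs_le (runs_cast _ (@runs_move _ bit 5 2 (final_value x) _ isT erefl)); first by lia.
  by rewrite {3}/regs_of /= cats0; st_eq.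
have l12 : fuel * 7 + 1 <= F y * 7 + 1 by rewrite leq_add2r leq_mul2r le_fuel orbT.
have l17 : size tape * 2 + 1 <= O y * 2 + 1 by rewrite leq_add2r leq_mul2r le_tape orbT.
apply: runs_seq r0 (runs_seq r1 (runs_seq r2 (runs_seq r3 (runs_seq r4 (runs_seq r5
 (runs_seq r6 (runs_seq r7 (runs_seq r8 (runs_seq r9 (runs_seq r10 (runs_seq r11
 (runs_seq (runs_le l12 r12) (runs_seq r13 (runs_seq r14 (runs_seq r15
 (runs_seq (runs_le l17 r16) (runs_seq r17 (runs_seq r19 _)))))))))))))))))).
by rewrite -[X in runs _ _ _ X]addn0; apply: runs_seq r20 (runs_skip _).
Qed.

End Pipeline.

(** The exponent [Wf] depends on the length of the input only, so that the time bound is a function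
    of the length, as [decides] demands. *)
Lemma pipeline_decides (A : machine) dA fA eW eT eAcc w0 (Wf : nat -> nat) :
  @computes A (fun s => s ^ dA + dA) fA ->
  (forall x, eval x [::] eW = Wf (size x)) ->
  exists M d, @decides M (fun s => (s + 2 + 2 ^ Wf s) ^ d)
    (fun x => 0 < final_value fA eW eT eAcc w0 x).
Proof.
move=> hA hW; have [p [h hp H]] := pipeline_runs hA eW eT eAcc w0.
have [d hd] : poly_bounded (fun y => h y * (2 * (y + h y) + 3) + 4) by pb.
exists (decider (fun b => inl (Some (inl b)) : option (bool + aux A) + state A) p), d => x.
have [s' [[t le_t ex] s0 s2]] := H x; rewrite hW in le_t.
set y := size x + 2 + 2 ^ Wf (size x) in le_t *.
have le_n : t * (2 * (size x + t) + 3) + 4 <= y ^ d.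
  apply: leq_trans (hd y _); last by rewrite /y; lia.
  rewrite leq_add2r leq_mul // leq_add2r leq_mul2l /= leq_add //.
  by rewrite /y; lia.
have [hh ->] := decider_run ex s0 le_n; split=> //.
by rewrite s2; case: final_value.
Qed.

(** * Horn rules as hyperedges *)

Import Order.TTheory GRing.Theory Num.Theory.

Section Gadgets.
Variables (k theta V root : nat) (rule : nat -> nat -> nat -> bool) (free leaf : pred nat).
Hypotheses (theta3 : 3 <= theta) (theta_k : theta <= k).
Hypotheses (root_lt : root < V) (root_gt0 : 0 < root).

(* Node 0 is free; with the [nextra] further free nodes it brings a hyperedge
   within one of its threshold as soon as one more node is active. *)
Definition nextra := theta - 3.
Definition ninner := k - theta + 2.
Definition nnodes := V + nextra + V ^ 3 * ninner.
Definition nedges := 3 * V ^ 3.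

Definition arg1 g := g %% V.
Definition arg2 g := g %/ V %% V.
Definition arg3 g := g %/ V ^ 2.
(** A hyperedge needs two different nodes as premises, hence the test. A gadget that does not fire
    gets the premises [root] and 0 instead: it stays inactive until the root is active and then
    helps to activate everything else. *)
Definition fires g := rule (arg1 g) (arg2 g) (arg3 g) && (arg1 g != arg2 g).
Definition prem1 g := if fires g then arg1 g else root.
Definition prem2 g := if fires g then arg2 g else 0.
Definition inner g := V + nextra + g * ninner.

(** Together with the extra free nodes, two active ends out of three activate the rest of a
    hyperedge. The hyperedges of a gadget have the ends {[prem1], [prem2], i}, {0, i, i'} and
    {[arg3], i, i'} with private nodes i, i'. Activation is symmetric within a hyperedge: with a
    single private node, the conclusion and node 0 would activate it and run the rule backwards. *)
Definition end1 j := if j %% 3 == 0 then prem1 (j %/ 3)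
                     else if j %% 3 == 1 then 0 else arg3 (j %/ 3).
Definition end2 j := if j %% 3 == 0 then prem2 (j %/ 3) else inner (j %/ 3).
Definition end3 j := inner (j %/ 3) + (j %% 3 != 0).

Definition mem_edge j i : bool :=
  [|| i == end1 j, i == end2 j, i == end3 j,
      (V <= i) && (i < V + nextra)
    | (inner (j %/ 3) + 2 <= i) && (i < inner (j %/ 3) + ninner)].

(** The price [nnodes] is prohibitive: a single such seed already pays for any lower bound
    [K <= nnodes]. *)
Definition node_cost i : nat :=
  if i < V then if free i then 0 else if leaf i then 1 else nnodes
  else if i < V + nextra then 0 else nnodes.

Definition gadget_instance : instance :=
  @Instance nnodes nedges (fun j => [set i : 'I_nnodes | mem_edge j i])
    (fun _ _ => 1%R) (fun _ => 1%R) (fun i => (node_cost i)%:R%R) (fun _ => theta).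

Local Notation I := gadget_instance.

Definition edge_list j := [:: end1 j; end2 j; end3 j] ++ iota V nextra
  ++ iota (inner (j %/ 3) + 2) (ninner - 2).

Lemma mem_edge_list j i : (i \in edge_list j) = mem_edge j i.
Proof.
rewrite /edge_list !mem_cat !inE !mem_iota /mem_edge -!orbA.
by congr [|| _, _, _, _ | _ && _]; rewrite /ninner; lia.
Qed.

Lemma arg3_lt g : g < V ^ 3 -> arg3 g < V.
Proof. by move=> lt_g; rewrite /arg3 ltn_divLR ?expn_gt0; [rewrite -expnS | lia]. Qed.

Lemma arg1_lt g : arg1 g < V. Proof. by rewrite ltn_mod; lia. Qed.
Lemma arg2_lt g : arg2 g < V. Proof. by rewrite ltn_mod; lia. Qed.

Lemma prem_lt g : (prem1 g < V) && (prem2 g < V) && (prem1 g != prem2 g).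
Proof.
rewrite /prem1 /prem2; case: ifP => [/andP[_ ->]|_]; first by rewrite arg1_lt arg2_lt.
by lia.
Qed.

Lemma inner_bounds g : g < V ^ 3 -> V + nextra <= inner g /\ inner g + ninner <= nnodes.
Proof.
move=> lt_g; rewrite /inner /nnodes; split; first by lia.
by rewrite -addnA leq_add2l -mulSnr leq_mul2r lt_g orbT.
Qed.

Lemma edge_list_ok j : j < nedges ->
  [/\ uniq (edge_list j), size (edge_list j) = k & {in edge_list j, forall i, i < nnodes}].
Proof.
move=> lt_j; have lt_g : j %/ 3 < V ^ 3 by rewrite ltn_divLR // mulnC.
have [b1 b2] := inner_bounds lt_g; have := prem_lt (j %/ 3) => /andP[/andP[p1 p2] p3].
have c := arg3_lt lt_g; have r : j %% 3 < 3 by rewrite ltn_mod.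
have [e1 e2 e3] : [/\ end1 j < V, end2 j < V \/ end2 j = inner (j %/ 3) /\ j %% 3 != 0
    & end1 j != end2 j].
  rewrite /end1 /end2; case: (j %% 3 == 0); first by split; [|left|].
  by case: (j %% 3 == 1); split; try (by right); lia.
have e4 : end3 j <= inner (j %/ 3) + 1 /\ (end2 j < inner (j %/ 3) \/ end3 j = end2 j + 1).
  by rewrite /end3; case: e2 => [e2|[e2 e2']]; [split; [|left]|split; [|right]]; lia.
have e5 : inner (j %/ 3) <= end3 j by rewrite /end3; lia.
have n2 : 2 <= ninner by rewrite /ninner; lia.
split.
- rewrite /edge_list cat_uniq; apply/and3P; split.
  + by rewrite /= !inE; lia.
  + apply/hasPn => i; rewrite mem_cat !mem_iota !inE => h.
    by apply/negP => /or3P[] /eqP ?; lia.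
  + rewrite cat_uniq !iota_uniq andbT /=; apply/hasPn => i; rewrite !mem_iota => h.
    by lia.
- by rewrite /edge_list /= size_cat !size_iota /nextra /ninner; lia.
- by move=> i; rewrite !mem_cat !inE !mem_iota => /or3P[/or3P[]/eqP->||] *; lia.
Qed.

Lemma card_edge (S : {set 'I_nnodes}) (p : pred nat) j : j < nedges ->
  (forall i, (i \in S) = p (val i)) ->
  #|S :&: [set i : 'I_nnodes | mem_edge j i]| = count p (edge_list j).
Proof.
move=> lt_j Sp; have [ul _ hl] := edge_list_ok lt_j.
rewrite -size_filter; have -> : S :&: [set i : 'I_nnodes | mem_edge j i] =
    [set i : 'I_nnodes | val i \in filter p (edge_list j)].
  by apply/setP => i; rewrite !inE mem_filter mem_edge_list Sp.
set l := filter _ _; have ul' : uniq l by rewrite filter_uniq.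
have hl' i : i \in l -> i < nnodes by rewrite mem_filter => /andP[_ /hl].
rewrite cardE -(size_map val); apply: perm_size; apply: uniq_perm => //.
  by rewrite map_inj_uniq ?enum_uniq //; apply: val_inj.
move=> i; apply/mapP/idP => [[o]|il]; first by rewrite mem_enum inE => h ->.
by exists (Ordinal (hl' i il)) => //; rewrite mem_enum inE.
Qed.

Lemma gadget_edge_card j : #|@edge I j| = k.
Proof.
have lt_j : j < nedges := ltn_ord j.
have [_ <- _] := edge_list_ok lt_j; rewrite -[edge j]setTI.
by rewrite (@card_edge _ predT) ?count_predT // => i; rewrite inE.
Qed.

Definition closed_under (Z : pred nat) := forall a b c, a < V -> b < V -> c < V ->
  rule a b c -> a != b -> Z a -> Z b -> Z c.

Lemma influenceE (S : {set 'I_nnodes}) i :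
  (@acost I i <= influence (I := I) S i)%R =
  [exists j : 'I_nedges, mem_edge j i && (theta <= count (fun v => v \in map val (enum S)) (edge_list j) + 1)].
Proof.
rewrite /influence sumr_const -[(1%R *+ _)%R]/((#|active_edges (I := I) S i|)%:R%R : rat).
have card j : #|S :&: @edge I j| = count (fun v => v \in map val (enum S)) (edge_list j).
  by apply: card_edge => // o; rewrite (mem_map val_inj) mem_enum.
rewrite ler1n card_gt0; apply/set0Pn/existsP => -[j h]; exists j; move: h.
  by rewrite !inE card -[@threshold I j]/theta leq_subLR addnC.
by rewrite !inE card -[@threshold I j]/theta leq_subLR addnC.
Qed.

Lemma count_edge (p : pred nat) j :
  (forall i, V <= i < V + nextra -> p i) ->
  count p (edge_list j) = p (end1 j) + p (end2 j) + p (end3 j) + nextra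
     + count p (iota (inner (j %/ 3) + 2) (ninner - 2)).
Proof.
move=> pe; rewrite /edge_list !count_cat /= addn0 !addnA; congr (_ + _ + _).
apply/eqP; rewrite -{2}(size_iota V nextra) -all_count; apply/allP => i.
by rewrite mem_iota; apply: pe.
Qed.

(** * No activation beyond a closed set *)

Section Barrier.
Variable Z : pred nat.
Hypotheses (Z0 : Z 0) (Zroot : ~~ Z root) (Zclosed : closed_under Z).

(** Everything that can be active while the logical nodes stay within [Z]. A gadget that does not
    fire has the root among its premises, and the root is not in [Z], so its private nodes are
    excluded. *)
Definition barrier i : bool :=
  if i < V then Z i else if i < V + nextra then true
  else let g := (i - (V + nextra)) %/ ninner in Z (prem1 g) && Z (prem2 g).

Lemma barrier_inner g h : h < ninner -> barrier (inner g + h) = Z (prem1 g) && Z (prem2 g).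
Proof.
move=> lt_h; rewrite /barrier ifF; last by rewrite /inner; lia.
rewrite ifF; last by rewrite /inner; lia.
rewrite (_ : _ - _ = g * ninner + h); last by rewrite /inner; lia.
by rewrite divnMDl ?divn_small ?addn0 //; lia.
Qed.

(** If both premises of the gadget are in [Z], its rule fires, closure puts the conclusion into [Z],
    and the whole hyperedge is inside. Otherwise no private node is inside, and besides the extra
    free nodes at most one end is: one short of what activation takes. *)
Lemma barrier_edge j : j < nedges -> theta <= count barrier (edge_list j) + 1 ->
  all barrier (edge_list j).
Proof.
move=> lt_j; have lt_g : j %/ 3 < V ^ 3 by rewrite ltn_divLR // mulnC.
set g := j %/ 3 in lt_g; have := prem_lt g => /andP[/andP[p1 p2] p3].
have r : j %% 3 < 3 by rewrite ltn_mod.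
have n2 : 2 <= ninner by rewrite /ninner; lia.
have bV i : i < V -> barrier i = Z i by rewrite /barrier => ->.
have bi h : h < ninner -> barrier (inner g + h) = Z (prem1 g) && Z (prem2 g) by apply: barrier_inner.
have bi0 := bi 0 (ltnW n2); rewrite addn0 in bi0.
have bs : {in iota (inner g + 2) (ninner - 2), barrier =1 fun=> Z (prem1 g) && Z (prem2 g)}.
  move=> i; rewrite mem_iota => h; rewrite (_ : i = inner g + (i - inner g)); last by lia.
  by rewrite bi //; lia.
rewrite count_edge; last by move=> i h; rewrite /barrier ifF ?ifT //; lia.
rewrite -/g (eq_in_count bs) /end1 /end2 /end3 -/g.
case e : (Z (prem1 g) && Z (prem2 g)).
  move=> _; have Z3 : Z (arg3 g).
    move: e; rewrite /prem1 /prem2; case: ifP => [/andP[hr ne] /andP[Z1 Z2]|_].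
      by apply: Zclosed hr ne Z1 Z2; rewrite ?arg1_lt ?arg2_lt ?arg3_lt.
    by rewrite (negPf Zroot).
  rewrite /edge_list !all_cat /end1 /end2 /end3 -/g /=; apply/and3P; split.
  - apply/and4P; split=> //.
    + case: ifP => _; first by rewrite bV //; case/andP: e.
      by case: ifP => _; rewrite bV // ?arg3_lt //; lia.
    + by case: ifP => _; [rewrite bV //; case/andP: e | rewrite bi0].
    + by rewrite bi //; case: (j %% 3 == 0); lia.
  - by apply/allP => i; rewrite mem_iota => h; rewrite /barrier ifF ?ifT //; lia.
  - by apply/allP => i ih; rewrite bs.
rewrite count_pred0 addn0 bi; last by lia.
rewrite e; case: ifP => _.
  rewrite !bV // addn0 => h; exfalso; move: e h; rewrite /nextra.
  by case: (Z (prem1 g)); case: (Z (prem2 g)) => //= _; lia.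
by rewrite bi0 e addn0; move: theta3; rewrite /nextra; clear; set x := if _ then _ else _;
  case: (barrier x) => /=; lia.
Qed.

Lemma barrier_spread (S : {set 'I_nnodes}) t :
  (forall i, i \in S -> barrier (val i)) ->
  forall i, i \in spread (I := I) S t -> barrier (val i).
Proof.
move=> hS; elim: t => [//|t IH] i; rewrite /spread /= -/(@spread I S t) !inE.
case/orP => [/IH //|/andP[_]]; rewrite influenceE => /existsP[j /andP[ij th]].
have /allP : all barrier (edge_list j).
  apply: barrier_edge; first exact: ltn_ord.
  apply: leq_trans th _; rewrite leq_add2r; apply: sub_count => v /mapP[o].
  by rewrite mem_enum => /IH h ->.
by apply; rewrite mem_edge_list.
Qed.

End Barrier.

Definition members (S : {set 'I_nnodes}) : pred nat := fun v => v \in map val (enum S).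

Lemma membersE S (i : 'I_nnodes) : members S i = (i \in S).
Proof. by rewrite /members (mem_map val_inj) mem_enum. Qed.

Definition gadget a b c := a + V * b + V ^ 2 * c.

Lemma gadgetK a b c : a < V -> b < V -> c < V ->
  [/\ gadget a b c < V ^ 3, arg1 (gadget a b c) = a, arg2 (gadget a b c) = b
    & arg3 (gadget a b c) = c].
Proof.
move=> la lb lc; have V0 : 0 < V by lia.
have lab : a + V * b < V ^ 2.
  by apply: (@leq_trans (V * b.+1)); [rewrite mulnS; lia | rewrite expnS expn1 leq_mul2l lb orbT].
have e2 : gadget a b c = c * V ^ 2 + (a + V * b) by rewrite /gadget; lia.
have e1 : gadget a b c = (b + V * c) * V + a by rewrite /gadget expnS expn1; lia.
split.
- rewrite e2; apply: (@leq_trans (c.+1 * V ^ 2)); first by rewrite mulSn; lia.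
  by rewrite (expnS V 2) leq_mul2r lc orbT.
- by rewrite /arg1 e1 modnMDl modn_small.
- rewrite /arg2 e1 divnMDl // divn_small // addn0.
  by rewrite (_ : b + V * c = c * V + b) ?modnMDl ?modn_small //; lia.
- by rewrite /arg3 e2 divnMDl ?expn_gt0 ?V0 // divn_small ?addn0.
Qed.

Lemma div3 g q : q < 3 -> (3 * g + q) %/ 3 = g.
Proof. by move=> ?; rewrite mulnC divnMDl // divn_small ?addn0. Qed.

Lemma mod3 g q : q < 3 -> (3 * g + q) %% 3 = q.
Proof. by move=> ?; rewrite mulnC modnMDl modn_small. Qed.

Lemma edge_lt g q : g < V ^ 3 -> q < 3 -> 3 * g + q < nedges.
Proof. by rewrite /nedges; lia. Qed.

(** * Everything derivable becomes active *)

Section Fire.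
Variable T : {set 'I_nnodes}.
Hypothesis Tfix : spread_step (I := I) T = T.
Hypothesis Textra : forall i, V <= i < V + nextra -> members T i.
Hypothesis T0 : members T 0.

Lemma fire_edge j : j < nedges -> theta <= count (members T) (edge_list j) + 1 ->
  forall v, v \in edge_list j -> members T v.
Proof.
move=> lt_j th v vj; have [_ _ hl] := edge_list_ok lt_j.
pose o := Ordinal (hl v vj); rewrite -[v]/(val o) membersE.
apply/negPn/negP => oT; have := oT; rewrite -{1}Tfix !inE (negPf oT) /= influenceE.
by case/existsP; exists (Ordinal lt_j); rewrite -mem_edge_list vj.
Qed.

Lemma fire g : g < V ^ 3 -> members T (prem1 g) -> members T (prem2 g) ->
  members T (arg3 g) /\ forall h, h < ninner -> members T (inner g + h).
Proof.
move=> lt_g h1 h2.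
have f0 := fire_edge (edge_lt lt_g (isT : 0 < 3)).
have f1 := fire_edge (edge_lt lt_g (isT : 1 < 3)).
have f2 := fire_edge (edge_lt lt_g (isT : 2 < 3)).
pose rest := iota V nextra ++ iota (inner g + 2) (ninner - 2).
move: f0 f1 f2; rewrite !count_edge // /edge_list /end1 /end2 /end3 !div3 // !mod3 //= addn0.
rewrite h1 h2 T0 => f0 f1 f2.
have {}f0 : forall v, v \in [:: prem1 g, prem2 g, inner g & rest] -> members T v.
  by apply: f0; rewrite /nextra; lia.
have i0 : members T (inner g) by apply: f0; rewrite !inE eqxx !orbT.
have {}f1 : forall v, v \in [:: 0, inner g, inner g + 1 & rest] -> members T v.
  by apply: f1; rewrite i0 /nextra; lia.
have i1 : members T (inner g + 1) by apply: f1; rewrite !inE eqxx !orbT.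
have {}f2 : forall v, v \in [:: arg3 g, inner g, inner g + 1 & rest] -> members T v.
  by apply: f2; rewrite i0 i1 /nextra; lia.
split=> [|h lt_h]; first by apply: f2; rewrite !inE eqxx.
by apply: f2; rewrite !inE mem_cat !mem_iota; lia.
Qed.

Lemma fire_closed : closed_under (members T).
Proof.
move=> a b c la lb lc hr ne Ta Tb; have [lg e1 e2 e3] := gadgetK la lb lc.
have [] := @fire _ lg; rewrite ?e3 // /prem1 /prem2 /fires e1 e2 e3 hr ne //.
Qed.

(** The diagonal gadget of [c] cannot fire, its two arguments being equal; so it has the premises
    [root] and 0, and it activates [c]. Once all logical nodes are active, every gadget activates
    its private nodes. *)
Lemma fire_all : members T root -> T = setT.
Proof.
move=> Tr; have low c : c < V -> members T c.
  move=> lc; have [lg e1 e2 e3] := gadgetK lc lc lc.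
  by have [] := @fire _ lg; rewrite ?e3 // /prem1 /prem2 /fires e1 e2 eqxx andbF.
apply/setP => o; rewrite inE -membersE; case: (ltnP o V) => [/low //|le_o].
case: (ltnP o (V + nextra)) => [lt_o|le_o2]; first by apply: Textra; rewrite le_o.
have n0 : 0 < ninner by rewrite /ninner; lia.
pose i := o - (V + nextra).
have lg : i %/ ninner < V ^ 3.
  by rewrite ltn_divLR // /i; have := ltn_ord o; rewrite /nnodes; lia.
have /andP[/andP[p1 p2] _] := prem_lt (i %/ ninner).
have [_ /(_ (i %% ninner))] := fire lg (low _ p1) (low _ p2).
rewrite ltn_mod n0 /inner -addnA -divn_eq /i (_ : _ + _ = o) => [/(_ isT)//|].
by rewrite addnC subnK.
Qed.

End Fire.

Lemma spread_limit_fix (S : {set 'I_nnodes}) :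
  spread_step (I := I) (spread_limit (I := I) S) = spread_limit (I := I) S.
Proof. exact: (@spread_stable I S (nodes I).+1 (leqnSn _)). Qed.

Lemma spread_limit_sub (S : {set 'I_nnodes}) : S \subset spread_limit (I := I) S.
Proof.
have sub t : S \subset spread (I := I) S t.
  by elim: t => [|t IH] //=; apply: subset_trans IH (subsetUl _ _).
exact: sub.
Qed.

Lemma seed_costE (S : {set 'I_nnodes}) :
  seed_cost (I := I) S = (\sum_(0 <= i < nnodes | members S i) node_cost i)%:R%R.
Proof.
rewrite /seed_cost big_mkord natr_sum; apply: eq_bigl => i.
by rewrite membersE.
Qed.

(** Derivability as membership in every closed set, which spares derivation trees: refuting it takes
    one closed set without the root, and using it means instantiating [Z] with the final active
    set. *)
Definition derives (p : pred nat) := forall Z : pred nat, Z 0 -> closed_under Z ->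
  (forall i, i < V -> free i -> Z i) -> (forall i, p i -> Z i) -> Z root.

Lemma gadget_OPT_le (p : pred nat) : derives p ->
  (forall i, p i -> (i < V) && leaf i) -> free 0 ->
  (OPT I <= (\sum_(0 <= i < V) p i)%:R)%R.
Proof.
move=> hp pleaf f0; pose S := [set o : 'I_nnodes |
  (o < V) && (free o || p o) || (V <= o < V + nextra)].
pose T := spread_limit (I := I) S.
have lt_n i : i < V + nextra -> i < nnodes by rewrite /nnodes; lia.
have ST i : i < V + nextra -> (i < V) && (free i || p i) || (V <= i < V + nextra) -> members T i.
  move=> lt_i h; pose o := Ordinal (lt_n i lt_i); rewrite -[i]/(val o) membersE.
  by apply: (subsetP (spread_limit_sub S)); rewrite inE.
have Tr : members T root.
  apply: hp => [||i lt_i fi|i pi].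
  - by apply: ST; [lia | rewrite f0 (leq_ltn_trans _ root_lt)].
  - apply: fire_closed; first exact: spread_limit_fix.
      by move=> i hi; apply: ST; rewrite ?hi ?orbT //; case/andP: hi.
    by apply: ST; [lia | rewrite f0 (leq_ltn_trans _ root_lt)].
  - by apply: ST; [lia | rewrite lt_i fi].
  - by have /andP[lt_i _] := pleaf i pi; apply: ST; [lia | rewrite lt_i pi orbT].
have TT : T = setT.
  apply: fire_all Tr; first exact: spread_limit_fix.
    by move=> i hi; apply: ST; rewrite ?hi ?orbT //; case/andP: hi.
  by apply: ST; [lia | rewrite f0 (leq_ltn_trans _ root_lt)].
apply: le_trans (OPT_min TT) _; rewrite seed_costE ler_nat.
rewrite big_mkcond /= (@big_cat_nat _ _ _ V) //=; last by rewrite /nnodes; lia.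
rewrite [X in _ + X]big1_seq ?addn0; last first.
  move=> i /andP[_]; rewrite mem_index_iota => /andP[le_i lt_i].
  case: ifP => // /mapP[o]; rewrite mem_enum inE => h eo; move: h.
  rewrite -eo ltnNge le_i /= => lt_x.
  by rewrite /node_cost ltnNge le_i /= lt_x.
rewrite !big_nat; apply: leq_sum => i /andP[_ lt_i].
case: ifP => // /mapP[o]; rewrite mem_enum inE => h eo; move: h.
rewrite -eo lt_i /= [V <= i]leqNgt lt_i /= orbF /node_cost lt_i.
case: (free i) => //= pi; have /andP[_ ->] := pleaf i pi; by rewrite pi.
Qed.

Lemma gadget_OPT_ge K : K <= nnodes ->
  (forall p : pred nat, (forall i, p i -> [&& i < V, leaf i & ~~ free i]) ->
     derives p -> K <= \sum_(0 <= i < V) p i) ->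
  (K%:R <= OPT I)%R.
Proof.
move=> le_K hK; have [S limS ->] := OPT_attained I; rewrite seed_costE ler_nat.
(* A seed set containing a node of prohibitive cost is expensive enough already. *)
case: (boolP [exists o : 'I_nnodes, (o \in S) && (node_cost o == nnodes)]).
  move=> /existsP[o /andP[oS /eqP co]]; apply: leq_trans le_K _.
  by rewrite big_mkord (bigD1 o) /= ?membersE // co leq_addr.
move=> /existsPn hS.
(* The seeds that are paid for; all others now cost nothing. *)
pose p i := [&& i < V, leaf i, ~~ free i & members S i].
apply: (@leq_trans (\sum_(0 <= i < V) p i)).
  apply: hK => [i /and4P[-> -> -> _] //|Z Z0 Zc Zf Zp].
  apply/negPn/negP => Zr.
  have bS (i : 'I_nnodes) : i \in S -> barrier Z (val i).
    move=> iS; have := hS i; rewrite iS /= /node_cost /barrier.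
    case: ifP => lt_i; last by case: ifP => //; rewrite eqxx.
    case: ifP => [fi|nf] _; first exact: Zf.
    have := hS i; rewrite iS /= /node_cost lt_i nf.
    case: ifP => [li _|_]; last by rewrite eqxx.
    by apply: Zp; rewrite /p lt_i li nf membersE.
  have lt_r : root < nnodes by rewrite /nnodes; lia.
  have := @barrier_spread Z Z0 Zr Zc S nnodes bS (Ordinal lt_r).
  rewrite -[spread S nnodes]/(spread_limit (I := I) S) limS inE /barrier /= root_lt.
  by move=> /(_ isT); rewrite (negPf Zr).
rewrite [X in _ <= X]big_mkcond /= [X in _ <= X](@big_cat_nat _ _ _ V) //=; last by rewrite /nnodes; lia.
apply: leq_trans (leq_addr _ _); rewrite !big_nat; apply: leq_sum => i /andP[_ lt_i].
by rewrite /p /node_cost lt_i; case: (members S i); case: (leaf i); case: (free i).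
Qed.

(** For connectivity, diagonal gadgets join the root to every logical node, and any other node
    shares the third hyperedge of some gadget with the conclusion of that gadget. *)
Lemma gadget_unit_uniform : unit_uniform k theta I.
Proof.
have lt_r : root < nnodes by rewrite /nnodes; lia.
pose r : 'I_nnodes := Ordinal lt_r.
have adjP j (x y : 'I_nnodes) : j < nedges -> mem_edge j x -> mem_edge j y ->
   connect (@adjacent I) x y.
  move=> lt_j hx hy; apply: connect1; apply/existsP.
  by exists (Ordinal lt_j); rewrite !inE hx hy.
have csym : connect_sym (@adjacent I).
  by apply: sym_connect_sym => x y; apply: eq_existsb => j; rewrite andbC.
have low (c : 'I_nnodes) : c < V -> connect (@adjacent I) r c.
  move=> lc; have [lg e1 e2 e3] := gadgetK lc lc lc; set g := gadget c c c in lg e1 e2 e3.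
  have [b1 b2] := inner_bounds lg.
  have lt_i : inner g < nnodes by rewrite /ninner in b2; lia.
  have c1 : connect (@adjacent I) r (Ordinal lt_i).
    apply: (@adjP (3 * g + 0)); rewrite ?edge_lt // /mem_edge /end1 /end2 /end3 div3 // mod3 //=.
      by rewrite /prem1 /fires e1 e2 eqxx andbF eqxx.
    by rewrite addn0 eqxx !orbT.
  apply: connect_trans c1 _.
  apply: (@adjP (3 * g + 2)); rewrite ?edge_lt // /mem_edge /end1 /end2 /end3 div3 // mod3 //=.
    by rewrite eqxx !orbT.
  by rewrite e3 eqxx.
have anchor (c : 'I_nnodes) : exists (j : 'I_nedges) d, [/\ mem_edge j c, d < V & mem_edge j d].
  have top g : g < V ^ 3 -> mem_edge (3 * g + 2) c ->
      exists (j : 'I_nedges) d, [/\ mem_edge j c, d < V & mem_edge j d].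
    move=> lg mc; exists (Ordinal (edge_lt lg (isT : 2 < 3))), (arg3 g); split; rewrite ?arg3_lt //.
    by rewrite /mem_edge /end1 div3 // mod3 //= eqxx.
  case: (ltnP c V) => [lc|le_c].
    have [lg _ _ e3] := gadgetK lc lc lc; apply: top lg _.
    by rewrite /mem_edge /end1 div3 // mod3 //= e3 eqxx.
  case: (ltnP c (V + nextra)) => [lt_c|le_c2].
    by apply: (@top 0); rewrite ?expn_gt0 /mem_edge ?le_c ?lt_c ?orbT //; lia.
  have n0 : 0 < ninner by rewrite /ninner; lia.
  pose i := c - (V + nextra); have lm : i %% ninner < ninner by rewrite ltn_mod.
  apply: (top (i %/ ninner)).
    by rewrite ltn_divLR // /i; have := ltn_ord c; rewrite /nnodes; lia.
  have -> : val c = inner (i %/ ninner) + i %% ninner.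
    by rewrite /inner -addnA -divn_eq /i addnC subnK.
  by rewrite /mem_edge /end2 /end3 div3 // mod3 //=; lia.
have conn (c : 'I_nnodes) : connect (@adjacent I) r c.
  have [j [d [mc ld md]]] := anchor c; have ln : d < nnodes by rewrite /nnodes; lia.
  apply: connect_trans (low (Ordinal ln) ld) _.
  exact: (@adjP j (Ordinal ln) c (ltn_ord j) md mc).
split=> //; last by move=> j; apply: gadget_edge_card.
split=> //.
- split; first by rewrite /=; lia.
  by move=> x y; apply: connect_trans (conn y); rewrite csym.
- move=> c /=; rewrite sumr_const; have [j [_ [hj _ _]]] := anchor c.
  rewrite ler1n; apply/card_gt0P; exists j; have jc : c \in @edge I j by rewrite inE.
  exact: jc.
Qed.

End Gadgets.

(** * The tensor power of the line code *)

Lemma sum_split m n (f : nat -> nat) :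
  \sum_(0 <= i < m * n) f i = \sum_(0 <= j < m) \sum_(0 <= r < n) f (j * n + r).
Proof.
elim: m => [|m IH]; first by rewrite !big_nil.
rewrite mulSnr (@big_cat_nat _ _ _ (m * n)) ?leq_addr //= IH big_nat_recr //=.
congr (_ + _); rewrite -{1}[m * n]add0n big_addn addKn.
by apply: eq_bigr => i _; rewrite addnC.
Qed.

Lemma leq_sum_const n c (f : nat -> nat) :
  (forall i, i < n -> c <= f i) -> n * c <= \sum_(0 <= i < n) f i.
Proof.
move=> h; apply: (@leq_trans (\sum_(0 <= i < n) c)).
  by rewrite sum_nat_const_nat subn0.
by rewrite !big_nat; apply: leq_sum => i /andP[_ /h].
Qed.

Lemma leq_term n i (f : nat -> nat) : i < n -> f i <= \sum_(0 <= j < n) f j.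
Proof.
move=> lt_i; rewrite big_mkord (bigD1 (Ordinal lt_i)) //=; exact: leq_addr.
Qed.

Lemma leq_two_terms n i j (f : nat -> nat) : i < n -> j < n -> i != j ->
  f i + f j <= \sum_(0 <= j < n) f j.
Proof.
move=> lt_i lt_j ne; rewrite big_mkord (bigD1 (Ordinal lt_i)) //= leq_add2l.
by rewrite (bigD1 (Ordinal lt_j)) 1?eq_sym //=; exact: leq_addr.
Qed.

(* The line with intercept [a] and slope [b], whose last point is at infinity. *)
Definition line_point (F a b s : nat) := if s.+1 == F then b else a + s * b.

Lemma line_meet F a b a' b' s s' : s < F -> s' < F -> s != s' ->
  line_point F a b s = line_point F a' b' s ->
  line_point F a b s' = line_point F a' b' s' -> a = a' /\ b = b'.
Proof.
rewrite /line_point => lt_s lt_s' ne.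
case: eqP => e1; case: eqP => e2; [lia | | | ].
- by move=> -> /addIn.
- by move=> h h2; move: h2 h => -> /addIn.
- move=> h1 h2; suff eb : b = b' by split=> //; move: h1; rewrite eb => /addIn.
  (* The intercepts are eliminated by adding the two equations crosswise, which avoids
     subtraction. *)
  have : s * b + s' * b' = s * b' + s' * b by lia.
  case: (ltngtP s s') ne => // lt _ e.
    have : (s' - s) * b = (s' - s) * b' by rewrite !mulnBl; lia.
    by move/eqP; rewrite eqn_pmul2l ?subn_gt0 // => /eqP.
  have : (s - s') * b = (s - s') * b' by rewrite !mulnBl; lia.
  by move/eqP; rewrite eqn_pmul2l ?subn_gt0 // => /eqP.
Qed.

Section Decoding.
Variables (F m B : nat) (inp : pred nat).
Hypothesis F2 : 2 <= F.

(* The values that local decoding allows for the node [e] of the binary tree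
   at the residual point [w]. *)
Inductive decoded : nat -> nat -> nat -> Prop :=
| decoded_input w v : w < F ^ m -> v < B -> inp (w * B + v) -> decoded 1 w v
| decoded_left e w a b : e < 2 ^ m ->
    (forall s, s < F -> decoded e (s + F * w) (line_point F a b s)) ->
    decoded e.*2 w a
| decoded_right e w a b : e < 2 ^ m ->
    (forall s, s < F -> decoded e (s + F * w) (line_point F a b s)) ->
    decoded e.*2.+1 w b.

Lemma decoded_gt0 e w v : decoded e w v -> 0 < e.
Proof.
elim=> {e w v} // [e w a b _ _ IH]; by rewrite double_gt0 (IH 0) // ltnW.
Qed.

Lemma decoded_inv e w v : decoded e w v ->
  (e = 1 /\ exists2 v', v' = v & v < B /\ inp (w * B + v)) \/
  (exists a b, v = (if odd e then b else a) /\ 1 < e /\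
     forall s, s < F -> decoded e./2 (s + F * w) (line_point F a b s)).
Proof.
case=> {e w v} [w v _ lt_v iv|e w a b _ h|e w a b _ h]; first by left; split=> //; exists v.
  right; exists a, b; rewrite odd_double doubleK; split=> //.
  by split=> //; have := decoded_gt0 (h 0 (ltnW F2)); lia.
right; exists a, b; rewrite /= odd_double /= uphalf_double; split=> //.
by split=> //; have := decoded_gt0 (h 0 (ltnW F2)); lia.
Qed.

Definition alphabet w := \sum_(0 <= v < B) inp (w * B + v).
(** The positions [w * F ^ r + i] are those lying over the residual point [w] after [r] coordinates
    have been decoded; the weight counts the derived inputs there. *)
Definition weight r w := \sum_(0 <= i < F ^ r) alphabet (w * F ^ r + i).

Lemma weightS r w : weight r.+1 w = \sum_(0 <= s < F) weight r (s + F * w).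
Proof.
rewrite /weight expnS sum_split; apply: eq_bigr => s _; apply: eq_bigr => i _.
by congr alphabet; rewrite mulnDl; lia.
Qed.

(** A value is decoded only from values at all [F] points of a line, hence in the end from an input
    at every position over [w]. *)
Lemma weight_nonempty r e w v : 2 ^ r <= e < 2 ^ r.+1 -> decoded e w v ->
  F ^ r <= weight r w.
Proof.
elim: r e w v => [|r IH] e w v lt_e d.
  have e1 : e = 1 by lia.
  rewrite /weight big_nat1 expn0 muln1 addn0.
  have [[_ [_ _ [lt_v iv]]]|[a [b [_ [e_gt1 _]]]]] := decoded_inv d; last by lia.
  by apply: leq_trans (leq_term _ lt_v); rewrite iv.
have [[e1 _]|[a [b [_ [e_gt1 h]]]]] := decoded_inv d.
  by move: lt_e; rewrite e1 !expnS; have := expn_gt0 2 r; lia.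
rewrite weightS expnS; apply: leq_sum_const => s lt_s.
apply: (IH e./2 _ _ _ (h s lt_s)).
by move: lt_e; rewrite !(expnS 2); have := odd_double_half e; lia.
Qed.

(* Two values at one node make all but one point of the line below it bad. *)
Lemma weight_ambiguous r e w v v' : 2 ^ r <= e < 2 ^ r.+1 -> v != v' ->
  decoded e w v -> decoded e w v' -> F ^ r + F.-1 ^ r <= weight r w.
Proof.
elim: r e w v v' => [|r IH] e w v v' lt_e ne d d'.
  have e1 : e = 1 by lia.
  rewrite /weight big_nat1 !expn0 muln1 addn0.
  have [[_ [_ _ [lt_v iv]]]|[a [b [_ [e_gt1 _]]]]] := decoded_inv d; last by lia.
  have [[_ [_ _ [lt_v' iv']]]|[a [b [_ [e_gt1 _]]]]] := decoded_inv d'; last by lia.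
  by apply: leq_trans (leq_two_terms _ lt_v lt_v' ne); rewrite iv iv'.
have [[e1 _]|[a [b [ev [e_gt1 h]]]]] := decoded_inv d.
  by move: lt_e; rewrite e1 !expnS; have := expn_gt0 2 r; lia.
have [[e1 _]|[a' [b' [ev' [_ h']]]]] := decoded_inv d'; first by lia.
have lt_e2 : 2 ^ r <= e./2 < 2 ^ r.+1.
  by move: lt_e; rewrite !(expnS 2); have := odd_double_half e; lia.
have nep : a <> a' \/ b <> b'.
  by move: ne; rewrite ev ev'; case: odd => /eqP; tauto.
rewrite weightS; set X := F ^ r; set W := F.-1 ^ r.
have low s : s < F -> X <= weight r (s + F * w).
  by move=> lt_s; apply: weight_nonempty lt_e2 (h s lt_s).
have high s : s < F -> line_point F a b s != line_point F a' b' s ->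
    X + W <= weight r (s + F * w).
  by move=> lt_s nes; apply: IH lt_e2 nes (h s lt_s) (h' s lt_s).
have [s0 lt_s0 hs0] : exists2 s0, s0 < F &
    forall s, s < F -> s != s0 -> line_point F a b s != line_point F a' b' s.
  have [/existsP[s0 /eqP e0]|none] := boolP [exists s0 : 'I_F, line_point F a b s0 == line_point F a' b' s0].
    exists s0 => // s lt_s ne_s; apply/eqP => es.
    by have := line_meet lt_s (ltn_ord s0) ne_s es e0; tauto.
  exists 0; first exact: ltnW.
  by move=> s lt_s _; have /existsPn/(_ (Ordinal lt_s)) := none.
rewrite big_mkord (bigD1 (Ordinal lt_s0)) //=.
have le1 := low s0 lt_s0.
(* The point [s0] contributes at least [X] and each of the others [X + W], in all F X + (F - 1)
   W. *)
suff : F.-1 * (X + W) <= \sum_(i < F | i != Ordinal lt_s0) weight r (i + F * w).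
  rewrite !expnS -/X -/W mulnDr.
  have -> : F * X = X + F.-1 * X by rewrite -mulSn prednK // ltnW.
  by move: (F.-1 * X) (F.-1 * W) (\sum_(_ < _ | _) _) le1 => p q S; lia.
apply: (@leq_trans (\sum_(i < F | i != Ordinal lt_s0) (X + W))).
  by rewrite sum_nat_const cardC1 card_ord.
by apply: leq_sum => i ne_i; apply: high (ltn_ord i) (hs0 i (ltn_ord i) _).
Qed.

Lemma weight_total : weight m 0 = \sum_(0 <= i < F ^ m * B) inp i.
Proof. by rewrite sum_split; apply: eq_bigr => i _. Qed.

End Decoding.

Section Encoding.
Variables (F m : nat) (y : nat -> nat).
Hypothesis F2 : 2 <= F.
Hypothesis y_bit : forall i, y i <= 1.

(** The binary tree is numbered as a heap: the data sit at the nodes from 2^m on, and [k] is the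
    number of levels from [e] down to them. *)
Fixpoint codeword k e w : nat :=
  if k is k'.+1 then
    line_point F (codeword k' e.*2 (w %/ F)) (codeword k' e.*2.+1 (w %/ F)) (w %% F)
  else y (e - 2 ^ m).

Lemma codeword_line k e s w : s < F -> codeword k.+1 e (s + F * w) =
  line_point F (codeword k e.*2 w) (codeword k e.*2.+1 w) s.
Proof.
move=> lt_s; rewrite /= addnC mulnC divnMDl ?divn_small ?addn0 //; last by lia.
by rewrite modnMDl modn_small.
Qed.

(** A finite point of a line has [s <= F - 2], so a level multiplies the bound by at most [F - 1].
    Values thus stay below [F ^ m], and an alphabet of [points m] symbols is enough. *)
Lemma codeword_le k e w : codeword k e w <= F.-1 ^ k.
Proof.
elim: k e w => [|k IH] e w /=; first by rewrite expn0.
set a := codeword _ _ _; set b := codeword _ _ _.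
have le_a : a <= F.-1 ^ k by apply: IH.
have le_b : b <= F.-1 ^ k by apply: IH.
have lt_s : w %% F < F by rewrite ltn_mod; lia.
rewrite expnS /line_point; case: eqP => es.
  by apply: leq_trans le_b _; apply: leq_pmull; lia.
have : w %% F * b <= (F.-1).-1 * F.-1 ^ k by apply: leq_mul => //; lia.
have : F.-1 * F.-1 ^ k = F.-1 ^ k + (F.-1).-1 * F.-1 ^ k by rewrite -mulSn prednK //; lia.
lia.
Qed.

End Encoding.

(** * The Horn system of a Turing machine *)

Section Tableau.
Variable M : machine.

Definition rank_state (q : state M) : nat := enum_rank q.
Definition rank_symbol (a : symbol M) : nat := enum_rank (a : option (bool + aux M)).

(** A halted configuration repeats itself, so every run fills a tableau of height exactly [T]. *)
Definition transition (q : state M) (a : symbol M) : state M * symbol M * move :=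
  if delta q a is Some u then u else (q, a, Stay).

Definition move_code d := match d with Left => 0 | Stay => 1 | Right => 2 end.
(** With these weights the output is a single [true] exactly when no cell has code 2 and the codes
    add up to 1, a test that one scan of the tape can make. *)
Definition bit_code (a : symbol M) :=
  if a is Some (inl b) then (if b then 1 else 2) else 0.

Definition next_state := table (fun q (a : option (bool + aux M)) => rank_state (transition q a).1.1).
Definition next_symbol := table (fun q (a : option (bool + aux M)) => rank_symbol (transition q a).1.2).
Definition next_move := table (fun q (a : option (bool + aux M)) => move_code (transition q a).2).
Definition symbol_class := table (fun (_ : unit) (a : option (bool + aux M)) => bit_code a) 0.

Lemma next_stateE q a : next_state (rank_state q) (rank_symbol a) = rank_state (transition q a).1.1.
Proof. exact: table_rank. Qed.
Lemma next_symbolE q a : next_symbol (rank_state q) (rank_symbol a) = rank_symbol (transition q a).1.2.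
Proof. exact: table_rank. Qed.
Lemma next_moveE q a : next_move (rank_state q) (rank_symbol a) = move_code (transition q a).2.
Proof. exact: table_rank. Qed.
Lemma symbol_classE a : symbol_class (rank_symbol a) = bit_code a.
Proof.
rewrite /symbol_class -[0]/(nat_of_ord (Ordinal (isT : 0 < 1))).
have -> : Ordinal (isT : 0 < 1) = cast_ord card_unit (enum_rank tt).
  by apply: val_inj => /=; case: (enum_rank tt) => k; rewrite card_unit /=; case: k.
exact: table_rank.
Qed.

Variables (w : seq bool) (T : nat).

(* The run on [w], with the position of the head when it starts at cell [T]. *)
Definition head_next (ch : config M * nat) : config M * nat :=
  (next ch.1, shift (transition (cstate ch.1) (scanned ch.1)).2 ch.2).

Definition headed t := iter t head_next (init M w, T).
Definition head_at t := (headed t).2.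
Definition conf_at t := (headed t).1.
Definition cell_at t p := tape_at (conf_at t) (head_at t) p.

Lemma conf_run t : conf_at t = run M w t.
Proof. by rewrite /conf_at /headed /run; elim: t => //= t ->. Qed.

Lemma cell_head t : cell_at t (head_at t) = scanned (conf_at t).
Proof. exact: tape_head. Qed.

Lemma next_tape c h (u := transition (cstate c) (scanned c)) : (u.2 = Left -> 0 < h) ->
  [/\ cstate (next c) = u.1.1, tape_at (next c) (shift u.2 h) = upd (tape_at c h) h u.1.2,
      size (before c) <= h -> size (before (next c)) <= shift u.2 h
    & shift u.2 h + size (after (next c)) <= maxn (h + size (after c)) h.+1].
Proof.
rewrite /u /transition; case e: delta => [[[q a] d]|] /= hd.
  by have [e1 /(_ h hd) [e2 [e3 e4]]] := next_transition e.
have -> : next c = c by rewrite /next /step e.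
by split=> //; [rewrite -(tape_head c h) upd_same | rewrite leq_max leqnn].
Qed.

Lemma headed_step t (u := transition (cstate (conf_at t)) (scanned (conf_at t))) :
  (u.2 = Left -> 0 < head_at t) ->
  [/\ cstate (conf_at t.+1) = u.1.1, head_at t.+1 = shift u.2 (head_at t),
      cell_at t.+1 = upd (cell_at t) (head_at t) u.1.2,
      size (before (conf_at t)) <= head_at t ->
        size (before (conf_at t.+1)) <= head_at t.+1
    & head_at t.+1 + size (after (conf_at t.+1)) <=
      maxn (head_at t + size (after (conf_at t))) (head_at t).+1].
Proof. by move=> hd; have [e1 e2 e3 e4] := next_tape hd; split. Qed.

Lemma head_bounds t : t <= T -> [/\ T - t <= head_at t, head_at t <= T + t,
  size (before (conf_at t)) <= head_at t
  & head_at t + size (after (conf_at t)) <= T + size w + t.+1].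
Proof.
elim: t => [_|t IH lt_t].
  by rewrite /head_at /conf_at /=; split=> //; rewrite ?size_behead ?size_map; lia.
have [h1 h2 h3 h4] := IH (ltnW lt_t).
have h0 : 0 < head_at t by lia.
have [e1 e2 e3 e4 e5] := headed_step (fun _ => h0).
split; last by lia.
- by rewrite e2; case: (_.2) => /=; lia.
- by rewrite e2; case: (_.2) => /=; lia.
- exact: e4.
Qed.

Lemma head_pos t : t < T -> 0 < head_at t.
Proof. by move=> lt_t; have [] := head_bounds (ltnW lt_t); lia. Qed.

Lemma cell_init p : cell_at 0 p =
  if p < T then None else nth None [seq Some (inl b) | b <- w] (p - T).
Proof.
rewrite /cell_at /head_at /conf_at /headed /= /tape_at /init /=.
case: ltnP => _; first by rewrite nth_nil.
by case: (w) => [|b l] /=; case: (p - T) => [|[]].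
Qed.

Lemma bits_nseq (l : seq (symbol M)) n : pmap (@bit_of M) l = nseq n true <->
  all (fun a => bit_code a < 2) l /\ \sum_(a <- l) bit_code a = n.
Proof.
elim: l n => [|a l IH] n /=; first by rewrite big_nil; case: n => [|n]; split=> // -[].
rewrite big_cons; case: a => [[[]|a]|] /=; rewrite ?add0n; try exact: IH.
  case: n => [|n] /=; first by split=> // -[_]; rewrite add1n.
  by have := IH n; rewrite add1n => h; split=> [[/h[-> ->]]|[h1 [h2]]] //; congr cons; apply/h.
by case: n => [|n]; split=> // -[].
Qed.

Lemma accepts_cells n : 2 * T + size w + 1 < n ->
  output (run M w T) = [:: true] <->
  (forall p, p < n -> bit_code (cell_at T p) < 2) /\
  \sum_(0 <= p < n) bit_code (cell_at T p) = 1.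
Proof.
move=> lt_n; have [_ _ h3 h4] := head_bounds (leqnn T).
rewrite -conf_run (@output_tape _ _ (head_at T) n) //; last by lia.
rewrite -/(cell_at T) -[[:: true]]/(nseq 1 true) bits_nseq.
rewrite /mkseq big_map all_map /index_iota subn0; split=> -[h hs]; split=> //.
  by move=> p lt_p; apply: (allP h); rewrite mem_iota.
by apply/allP => p; rewrite mem_iota => /andP[_ lt_p]; apply: h.
Qed.

End Tableau.

(** A tag, the address of a copy and five arguments. Tag 2: tree node, point, value. Tag 3: tree
    node, point, intercept, slope, number of points checked. Tag 4: witness length, time, cell,
    symbol. Tag 5: witness length, time, state, head. Tag 6: witness length, number of cells
    scanned, sum of their codes. The length of the witness is unknown, so runs for all lengths
    coexist. *)
Definition node := (nat * nat * nat * nat * nat * nat * nat)%type.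

Section Rules.
Variables (V : machine) (m t T Y cells : nat) (x : seq bool).
Definition fsize := 2 ^ m.
(** An input is a position of the code with a value at it, hence the square in [inputs]. Copies form
    a tree with root 1 and [inputs] children per node; level [t] below the root has the addresses
    from [leaves] to [2 * leaves - 1], and [base] exceeds them all. *)
Definition points := fsize ^ m.
Definition inputs := points * points.
Definition leaves := inputs ^ t.
Definition base := 2 * leaves.
Definition bx := block x.
Definition rank_bit b := rank_symbol (Some (inl b) : symbol V).
Definition rank_blank := rank_symbol (None : symbol V).

(* Tags: 1 output of a copy, 2 value of a code position, 3 partial check of a
   line, 4 tape cell, 5 head, 6 scan of the final tape. The second component
   is the address of a copy of the base system. *)
Definition horn (one : bool) (A B C : node) : bool :=
  let: (ta, pa, a1, a2, a3, a4, a5) := A in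
  let: (tb, pb, b1, b2, b3, b4, b5) := B in
  let: (tc, pc, c1, c2, c3, c4, c5) := C in
  [|| [&& one, ta == 1, tc == 2, c1 == 1, pa == pc * inputs + (c2 * points + c3),
          c2 < points, c3 < points, 0 < pc & pc < leaves],
      [&& ta == 3, tb == 2, tc == 3, pb == pa, pc == pa, b1 == a1, c1 == a1, c2 == a2,
          c3 == a3, c4 == a4, c5 == a5.+1, a5 < fsize, b2 == a5 + fsize * a2
        & b3 == line_point fsize a3 a4 a5],
      [&& one, ta == 3, tc == 2, pc == pa, a5 == fsize, a1 < fsize, c2 == a2
        & (c1 == 2 * a1) && (c3 == a3) || (c1 == (2 * a1).+1) && (c3 == a4)],
      [&& one, ta == 2, tc == 4, pc == pa, a2 == 0, fsize <= a1, a1 - fsize < c1,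
          c2 == 0, c3 == T + (size bx + (a1 - fsize)), a3 < 2
        & c4 == if a3 == 1 then rank_bit true else rank_bit false],
      [&& ta == 5, tb == 4, pb == pa, pc == pa, b1 == a1, c1 == a1, b2 == a2,
          c2 == a2.+1, a2 < T
        & [&& tc == 5, b3 == a4, c3 == next_state V a3 b4
            & c4 + (next_move V a3 b4 == 0) == a4 + (next_move V a3 b4 == 2)]
          || [&& tc == 4, c3 == b3
               & c4 == if b3 == a4 then next_symbol V a3 b4 else b4]],
      [&& ta == 6, tb == 4, tc == 6, pb == pa, pc == pa, b1 == a1, c1 == a1, b2 == T,
          b3 == a2, c2 == a2.+1, symbol_class V b4 < 2 & c3 == a3 + symbol_class V b4]
    | [&& one, ta == 6, tc == 1, pc == pa, 0 < pa, pa < leaves, a1 <= Y,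
          a2 == cells & a3 == 1]].

(** Only cells that do not depend on the witness are axioms; the [l] cells after [bx] are left to
    the decoded data. *)
Definition initial_cell l p a : bool :=
  if (T <= p) && (p < T + size bx) then
    a == if nth false bx (p - T) then rank_bit true else rank_bit false
  else ~~ ((T + size bx <= p) && (p < T + size bx + l)) && (a == rank_blank).

Definition axiom (A : node) : bool :=
  let: (ta, pa, a1, a2, a3, a4, a5) := A in
  [|| (ta == 3) && (a5 == 0), [&& ta == 4, a2 == 0 & initial_cell a1 a3 a4],
      [&& ta == 5, a2 == 0, a3 == rank_state (start V) & a4 == T]
    | [&& ta == 6, a2 == 0 & a3 == 0]].

Definition digit a i := a %/ base ^ i %% base.
Definition unpack a : node :=
  (digit a 0, digit a 1, digit a 2, digit a 3, digit a 4, digit a 5, digit a 6).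
Definition pack (A : node) : nat :=
  let: (ta, pa, a1, a2, a3, a4, a5) := A in
  ta + base * (pa + base * (a1 + base * (a2 + base * (a3 + base * (a4 + base * a5))))).

(** A unary rule takes the free node 0 as its second premise, which the flag [one] records. *)
Definition rule a b c : bool := horn (b == 0) (unpack a) (unpack b) (unpack c).
Definition free a : bool := (a == 0) || axiom (unpack a).
(** No rule derives the output of a copy on the last level: these outputs are what is for sale. *)
Definition is_leaf a : bool :=
  let: (ta, pa, a1, a2, a3, a4, a5) := unpack a in
  [&& ta == 1, leaves <= pa, a1 == 0, a2 == 0, a3 == 0, a4 == 0 & a5 == 0].

Definition gap := points + fsize.-1 ^ m.

End Rules.

Ltac split_ands := repeat match goal with
  | H : is_true (_ && _) |- _ => let H1 := fresh in let H2 := fresh in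
      move/andP: H => [H1 H2]
  | H : is_true (@eq_op _ _ _) |- _ => move/eqP: H => H
  end.

Section Powers.
Variables (m t : nat).
Hypothesis m_gt0 : 0 < m.
Local Notation F := (fsize m).
Local Notation D := (points m).
Local Notation N := (inputs m).
Local Notation L := (leaves m t).
Local Notation Z := (base m t).

Lemma fsize_ge2 : 2 <= F.
Proof. by rewrite /fsize -{1}(expn1 2) leq_exp2l. Qed.

Lemma points_ge2 : 2 <= D.
Proof.
by apply: leq_trans fsize_ge2 _; rewrite /points -{1}(expn1 F) leq_exp2l // fsize_ge2.
Qed.

Lemma inputs_ge2 : 2 <= N.
Proof. by rewrite /inputs; have := points_ge2; nia. Qed.

Lemma leaves_gt0 : 0 < L.
Proof. by rewrite expn_gt0; have := inputs_ge2; lia. Qed.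

Lemma base_ge2 : 2 <= Z.
Proof. by rewrite /base; have := leaves_gt0; lia. Qed.

(** The children of [pi] are [pi * N + i], so the truncated logarithm in base [N] is the level in
    the tree of copies. *)
Lemma level_child pi i : 0 < pi -> i < N -> trunc_log N (pi * N + i) = (trunc_log N pi).+1.
Proof.
move=> pi0 lt_i; apply: trunc_log_eq; first exact: inputs_ge2.
have /andP[l1 l2] := trunc_log_bounds inputs_ge2 pi0.
apply/andP; split; rewrite expnSr.
  by apply: leq_trans (leq_addr _ _); rewrite leq_mul2r l1 orbT.
apply: (@leq_trans (pi.+1 * N)); first by rewrite mulSn; lia.
by rewrite leq_mul2r l2 orbT.
Qed.

Lemma level_lt pi : 0 < pi -> pi < L -> trunc_log N pi < t.
Proof.
move=> pi0 lt_pi; have le := trunc_logP inputs_ge2 pi0.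
have : N ^ trunc_log N pi < N ^ t by apply: leq_ltn_trans le _.
by rewrite ltn_exp2l // inputs_ge2.
Qed.

Lemma level_leaf pi : L <= pi < Z -> trunc_log N pi = t.
Proof.
move=> /andP[h1 h2]; apply: trunc_log_eq; first exact: inputs_ge2.
rewrite h1 expnS; apply: leq_trans h2 _; rewrite /base leq_mul2r inputs_ge2 orbT //.
Qed.

Lemma digit_lt a i : digit m t a i < Z.
Proof. by rewrite ltn_mod; have := base_ge2; lia. Qed.

Lemma digitS a b i : a < Z -> digit m t (a + Z * b) i.+1 = digit m t b i.
Proof.
move=> lt_a; rewrite /digit expnS divnMA [a + _]addnC [Z * b]mulnC divnMDl; last by have := base_ge2; lia.
by rewrite (divn_small lt_a) addn0.
Qed.

Lemma digit0 a b : a < Z -> digit m t (a + Z * b) 0 = a.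
Proof. by move=> lt_a; rewrite /digit expn0 divn1 addnC mulnC modnMDl modn_small. Qed.

Definition small (A : node) : bool :=
  let: (ta, pa, a1, a2, a3, a4, a5) := A in
  [&& ta < Z, pa < Z, a1 < Z, a2 < Z, a3 < Z, a4 < Z & a5 < Z].

Lemma packK A : small A -> unpack m t (pack m t A) = A.
Proof.
move: A => [[[[[[ta pa] a1] a2] a3] a4] a5] /and5P[h1 h2 h3 h4 /and3P[h5 h6 h7]].
have d0 : digit m t a5 0 = a5 by rewrite /digit expn0 divn1 modn_small.
by rewrite /unpack /pack !digitS // !digit0 // d0.
Qed.

Lemma pack_step a b n : a < Z -> b < Z ^ n -> a + Z * b < Z ^ n.+1.
Proof.
move=> la lb; apply: (@leq_trans (Z * b.+1)); first by rewrite mulnS; lia.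
by rewrite expnS leq_mul2l lb orbT.
Qed.

Lemma pack_lt A : small A -> pack m t A < Z ^ 7.
Proof.
move: A => [[[[[[ta pa] a1] a2] a3] a4] a5] /and5P[h1 h2 h3 h4 /and3P[h5 h6 h7]].
by do 6 apply: pack_step => //; rewrite expn1.
Qed.

Lemma digit_shift a i : digit m t a i.+1 = digit m t (a %/ Z) i.
Proof. by rewrite /digit expnS divnMA. Qed.

Lemma unpackK a : a < Z ^ 7 -> pack m t (unpack m t a) = a.
Proof.
have divZ b n : b < Z ^ n.+1 -> b %/ Z < Z ^ n.
  by rewrite ltn_divLR ?expnSr //; have := base_ge2; lia.
have e b : digit m t b 0 + Z * (b %/ Z) = b.
  by rewrite /digit expn0 divn1 addnC mulnC -divn_eq.
move=> lt_a; rewrite /pack /unpack !digit_shift.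
have lt6 : a %/ Z %/ Z %/ Z %/ Z %/ Z %/ Z < Z ^ 1 by do 6 apply: (divZ).
rewrite {7}/digit expn0 divn1 modn_small; last by rewrite -[Z]expn1.
by rewrite !e.
Qed.

End Powers.

(** * Soundness: a rejected input is expensive *)

Section Soundness.
Variables (V : machine) (m t T Y cells : nat) (x : seq bool).
Hypothesis m_gt0 : 0 < m.
Local Notation F := (fsize m).
Local Notation D := (points m).
Local Notation N := (inputs m).
Local Notation L := (leaves m t).
Local Notation Z := (base m t).
Local Notation K := (gap m).
Let coded := block x.
Hypothesis T_ge : size coded + Y <= T.
Hypothesis cells_gt : 3 * T + 1 < cells.
Hypothesis rejects : forall y, size y <= Y -> output (run V (coded ++ y) T) <> [:: true].
Variable p : pred nat.

Definition seeded pi := p (1 + Z * pi).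

(** An upper bound on what a buyer can achieve: a copy is granted its output only if at least [K] of
    its inputs are granted, down to the bought outputs [h] levels below. *)
Fixpoint lit (h pi : nat) : bool :=
  if h is h'.+1 then K <= \sum_(0 <= i < N) lit h' (pi * N + i) else seeded pi.

Definition output_lit pi := lit (t - trunc_log N pi) pi.
Definition input_lit pi i := output_lit (pi * N + i).
Definition dec pi := decoded F m D (input_lit pi).

(** If both values can be decoded the choice of 1 is arbitrary, but the copy is then lit anyway. *)
Definition data pi i : bool := `[< dec pi (F + i) 0 1 >].
Definition word pi l := coded ++ mkseq (data pi) l.

Definition is_copy pi := (0 < pi) && (pi < L).

(* The intended meaning of the nodes; everything holds in a copy of the base
   system whose output is lit, in particular when the decoded data are
   ambiguous. *)
Definition meaning (A : node) : Prop :=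
  let: (ta, pa, a1, a2, a3, a4, a5) := A in
  let local (P : Prop) := ~~ is_copy pa \/ output_lit pa \/ P in
  match ta with
  | 1 => output_lit pa
  | 2 => local (dec pa a1 a2 a3)
  | 3 => local (forall s, s < a5 -> dec pa a1 (s + F * a2) (line_point F a3 a4 s))
  | 4 => local (a4 = rank_symbol (cell_at V (word pa a1) T a2 a3))
  | 5 => local (a3 = rank_state (cstate (conf_at V (word pa a1) T a2)) /\
           a4 = head_at V (word pa a1) T a2)
  | 6 => local ((forall q, q < a2 -> bit_code (cell_at V (word pa a1) T T q) < 2) /\
           a3 = \sum_(0 <= q < a2) bit_code (cell_at V (word pa a1) T T q))
  | _ => True
  end.

Lemma decoded_lt G n inp e w v : decoded G m n inp e w v -> e < 2 * 2 ^ m.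
Proof. by case=> {e w v} *; [have := expn_gt0 2 m|..]; lia. Qed.

Lemma output_litE pi : is_copy pi -> output_lit pi = (K <= \sum_(0 <= i < N) input_lit pi i).
Proof.
move=> /andP[pi0 lt_pi]; have lt_l := level_lt m_gt0 pi0 lt_pi.
rewrite /output_lit (_ : t - _ = (t - (trunc_log N pi).+1).+1) /=; last by lia.
congr (_ <= _); rewrite !big_nat; apply: eq_bigr => i /andP[_ lt_i].
by rewrite /input_lit /output_lit level_child.
Qed.

Lemma ambiguous_lit pi e v v' : is_copy pi -> F <= e -> v != v' ->
  dec pi e 0 v -> dec pi e 0 v' -> output_lit pi.
Proof.
move=> cp le_e ne d d'; rewrite output_litE // -weight_total.
apply: (weight_ambiguous (fsize_ge2 m_gt0) _ ne d d').
by rewrite le_e expnS; apply: decoded_lt d.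
Qed.

Lemma size_word pi l : size (word pi l) = size coded + l.
Proof. by rewrite size_cat size_mkseq. Qed.

Lemma nth_word pi l i : nth None [seq Some (inl b) | b <- word pi l] i =
  if i < size coded then Some (inl (nth false coded i))
  else if i < size coded + l then Some (inl (data pi (i - size coded))) else None :> symbol V.
Proof.
case: (ltnP i (size coded + l)) => h; last first.
  by rewrite ltnNge (leq_trans (leq_addr _ _) h) /= nth_default // size_map size_word.
rewrite (nth_map false) ?size_word // nth_cat; case: ltnP => h2 //.
by rewrite nth_mkseq //; lia.
Qed.

Lemma horn_meaning one A B C : horn V m t T Y cells x one A B C ->
  meaning A -> meaning B -> meaning C.
Proof.
move: A B C => [[[[[[ta pa] a1] a2] a3] a4] a5] [[[[[[tb pb] b1] b2] b3] b4] b5]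
  [[[[[[tc pc] c1] c2] c3] c4] c5] /=.
case/or4P => [h|h|h|/or4P[h|h|h|h]].
- by split_ands; subst=> /= lp _; right; right; apply: decoded_input.
- split_ands; subst=> /= -[n|[o|hA]]; [by left | by right; left|].
  case=> [n|[o|hB]]; [by left | by right; left | right; right].
  by move=> s; rewrite ltnS leq_eqVlt => /predU1P[->|/hA].
- split_ands; subst=> /= -[n|[o|hA]] _; [by left | by right; left | right; right].
  match goal with H : is_true (_ || _) |- _ => case/orP: H end; move=> /andP[/eqP-> /eqP->];
    rewrite mul2n; [exact: decoded_left hA | exact: decoded_right hA].
- split_ands; subst=> /= -[n|[o|hA]] _; [by left | by right; left |].
  case: (boolP (is_copy pa)) => [cp|_]; last by left.
  right; rewrite cell_init ltnNge leq_addr /= addKn nth_word ltnNge leq_addr /=.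
  rewrite ltn_add2l (_ : a1 - F < c1) // addKn.
  (* If the decoded value is not 1 although [data] reads 1, two values are decoded at the same bit,
     so the copy is ambiguous and hence lit. *)
  case: (a3 =P 1) => [e3|ne3].
    have -> : data pa (a1 - F) = true by apply/asboolP; rewrite subnKC // -e3.
    by right.
  case e: (data pa (a1 - F)); last by right.
  left; move/asboolP: e; rewrite subnKC // => d1.
  by apply: (ambiguous_lit cp _ _ hA d1) => //; apply/eqP.
- split_ands; match goal with H : is_true (_ || _) |- _ => move: H => h end.
  subst=> /= -[n|[o|[h1 h2]]]; first by case/orP: h => h; split_ands; subst; left.
    by case/orP: h => h; split_ands; subst; right; left.
  case=> [n|[o|hB]]; first by case/orP: h => h; split_ands; subst; left.
    by case/orP: h => h; split_ands; subst; right; left.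
  have lt_T : a2 < T by [].
  have h0 := @head_pos V (word pa a1) T a2 lt_T.
  have [e1 e2 e3 _ _] := headed_step (fun _ => h0).
  case/orP: h => h; split_ands; subst; right; right.
    split; first by rewrite e1 -cell_head next_stateE.
    (* In the rule a left move is added on the side of the new position, which avoids a truncated
       subtraction. *)
    match goal with H : _ + _ = _ + _ |- _ => move: H end.
    rewrite next_moveE e2 cell_head; case: (_.2) => /=; lia.
  rewrite e3 /upd; case: eqP => [->|ne].
    by rewrite cell_head next_symbolE.
  by [].
- split_ands; subst=> /= -[n|[o|[h1 h2]]]; [by left | by right; left |].
  case=> [n|[o|hB]]; [by left | by right; left | right; right].
  match goal with H : is_true (symbol_class _ _ < 2) |- _ => move: H end.
  rewrite hB symbol_classE => lt2; split; last by rewrite big_nat_recr //= h2.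
  by move=> q; rewrite ltnS leq_eqVlt => /predU1P[->|/h1].
- split_ands; subst=> /= -[n|[o|[h1 h2]]] _ //.
    by move: n; rewrite /is_copy; move/negP; case; apply/andP.
  (* A complete scan with sum 1 would mean that the verifier accepts the decoded witness of length
     [a1], against [rejects]. *)
  have le_Y : a1 <= Y by [].
  case: (@rejects (mkseq (data pa) a1)); first by rewrite size_mkseq.
  apply/(@accepts_cells _ _ _ cells); last by [].
  by rewrite -/(word pa a1) size_word; lia.
Qed.

Lemma axiom_meaning A : axiom V T x A -> meaning A.
Proof.
move: A => [[[[[[ta pa] a1] a2] a3] a4] a5] /=.
case/or4P => h; split_ands; subst=> /=; right; right=> //.
- match goal with H : is_true (initial_cell _ _ _ _ _ _) |- _ => move: H end.
  rewrite /initial_cell /bx -/coded cell_init nth_word.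
  case: ifP => [/andP[h1 h2] /eqP->|h1 /andP[h2 /eqP->]].
    by rewrite ltnNge h1 /= (_ : a3 - T < size coded) ?ltn_subLR //; case: nth.
  case: ltnP => // h3; rewrite h3 /= in h1 h2.
  rewrite (_ : (a3 - T < size coded) = false); last by apply/negbTE; move/negbT: h1; rewrite -/coded; lia.
  rewrite (_ : (a3 - T < size coded + a1) = false) //; apply/negbTE; move: h2; move/negbT: h1.
  by rewrite -/coded; lia.
- by rewrite big_nil.
Qed.

Lemma lit_count h pi : lit h pi ->
  K ^ h <= \sum_(0 <= i < N ^ h) seeded (pi * N ^ h + i).
Proof.
elim: h pi => [|h IH] pi /=; first by rewrite !expn0 big_nat1 muln1 addn0 => ->.
move=> le_K; rewrite !expnS sum_split.
apply: (@leq_trans (\sum_(0 <= i < N) lit h (pi * N + i) * K ^ h)).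
  by rewrite -big_distrl /= leq_mul2r le_K orbT.
apply: leq_sum => i _; case li : (lit h _); last by [].
rewrite mul1n; apply: leq_trans (IH _ li) _.
by apply: leq_sum => j _; rewrite mulnDl addnA mulnA.
Qed.

Lemma soundness : (forall i, p i -> (i < Z ^ 7) && is_leaf m t i) ->
  derives (Z ^ 7) (1 + Z) (rule V m t T Y cells x) (free V m t T x) p ->
  K ^ t <= \sum_(0 <= i < Z ^ 7) p i.
Proof.
move=> pleaf hp; have Z2 := base_ge2 t m_gt0; have L0 := leaves_gt0 t m_gt0.
(* The closed set is that of the meaningful nodes. The root [1 + Z] packs tag 1 and address 1, the
   output of the top copy. *)
have : `[< meaning (unpack m t (1 + Z)) >].
  apply: (hp (fun i => `[< meaning (unpack m t i) >])).
  - by apply/asboolP; rewrite /unpack /digit div0n mod0n.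
  - move=> a b c _ _ _ hr _ /asboolP ma /asboolP mb; apply/asboolP.
    exact: horn_meaning hr ma mb.
  - move=> i _ /orP[/eqP->|hi]; apply/asboolP; last exact: axiom_meaning.
    by rewrite /unpack /digit div0n mod0n.
  - move=> i hi; apply/asboolP; have /andP[lt_i] := pleaf i hi.
    have := unpackK m_gt0 lt_i; rewrite /is_leaf.
    case e: (unpack m t i) => [[[[[[ta pa] a1] a2] a3] a4] a5] ei h.
    split_ands; subst ta a1 a2 a3 a4 a5; rewrite /= /output_lit.
    rewrite /pack !muln0 !addn0 in ei.
    rewrite (level_leaf m_gt0 (t := t)) ?subnn /= /seeded ?ei //.
    match goal with H : is_true (L <= _) |- _ => rewrite H end.
    by case: e => _ <- *; rewrite digit_lt.
have -> : 1 + Z = pack m t (1, 1, 0, 0, 0, 0, 0) by rewrite /pack !muln0 !addn0 muln1.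
rewrite (packK m_gt0); last by rewrite /small /=; lia.
move/asboolP => /=; rewrite /output_lit trunc_log1 subn0 => /lit_count.
rewrite mul1n => le_K; apply: (leq_trans le_K).
(* The outputs for sale are the numbers [1 + Z * pi] with [pi] from [L] to [2 L - 1]: residue 1
   modulo [Z], and quotients in that range. *)
rewrite (expnSr Z 6) sum_split.
apply: (@leq_trans (\sum_(0 <= j < Z ^ 6) p (j * Z + 1))); last first.
  by apply: leq_sum => j _; apply: leq_term.
have le6 : L + L <= Z ^ 6.
  rewrite addnn -mul2n -/(base m t) -{1}(expn1 Z) leq_exp2l //.
rewrite [X in _ <= X](@big_cat_nat _ _ _ L) //=; last by apply: leq_trans le6; apply: leq_addr.
apply: leq_trans (leq_addl _ _).
rewrite [X in _ <= X](@big_cat_nat _ _ _ (L + L)) ?leq_addr //=.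
apply: leq_trans (leq_addr _ _).
have -> : \sum_(L <= i < L + L) p (i * Z + 1) = \sum_(0 <= i < L) p ((i + L) * Z + 1).
  by rewrite -{1}[L]add0n big_addn addnK.
by apply: leq_sum => i _; rewrite /seeded addnC mulnC [i + _]addnC.
Qed.

End Soundness.

(** * Completeness: an accepted input is cheap *)

Section Completeness.
Variables (V : machine) (m t T Y cells : nat) (x y : seq bool).
Hypothesis m_gt0 : 0 < m.
Hypothesis t_gt0 : 0 < t.
Local Notation F := (fsize m).
Local Notation D := (points m).
Local Notation N := (inputs m).
Local Notation L := (leaves m t).
Local Notation Z := (base m t).
Hypothesis T_ge : size (bx x) + Y <= T.
Hypothesis cells_gt : 3 * T + 1 < cells.
Hypothesis cells_le : cells + #|state V| + #|{: option (bool + aux V)}| + 3 <= F.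
Hypothesis y_le : size y <= Y.
Hypothesis accepts : output (run V (bx x ++ y) T) = [:: true].

Definition datum i : nat := nth false y i.
Definition cw := codeword F m datum.

Lemma datum_bit i : datum i <= 1. Proof. exact: leq_b1. Qed.

(** Input [i] stands for the position [i %/ D] with the value [i %% D]; an honest buyer pays for one
    value per position. *)
Definition good i := i %% D == cw m 1 (i %/ D).

(** The last [h] digits of an address in base [N] are the inputs passed on the way down to it. *)
Fixpoint honest h pi : bool :=
  if h is h'.+1 then honest h' (pi %/ N) && good (pi %% N) else true.

Definition honest_leaf i := [&& i < Z ^ 7, is_leaf m t i & honest t (digit m t i 1)].

Lemma good_count : \sum_(0 <= i < N) good i <= D.
Proof.
have D2 := points_ge2 m_gt0.
rewrite /inputs sum_split; apply: (@leq_trans (\sum_(0 <= w < D) 1)); last first.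
  by rewrite sum_nat_const_nat subn0 muln1.
apply: leq_sum => w _.
rewrite (eq_big_nat _ _ (F2 := fun v => (v == cw m 1 w : nat))); last first.
  move=> v /andP[_ lt_v]; rewrite /good modnMDl modn_small //.
  by rewrite divnMDl ?divn_small ?addn0 //; lia.
elim: D => [|n IH]; first by rewrite big_nil.
case: (leqP n (cw m 1 w)) => h; last by rewrite big_nat_recr //= gtn_eqF ?addn0.
rewrite big_nat_recr //= big1_seq ?leq_b1 // => v /andP[_].
by rewrite mem_index_iota => /andP[_ lt_v]; rewrite ltn_eqF // (leq_trans lt_v).
Qed.

Lemma honest_child h pi i : i < N -> honest h.+1 (pi * N + i) = honest h pi && good i.
Proof.
have N2 := inputs_ge2 m_gt0; move=> lt_i /=.
by rewrite divnMDl ?divn_small ?addn0 ?modnMDl ?modn_small //; lia.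
Qed.

Lemma honest_count h pi : \sum_(0 <= i < N ^ h) honest h (pi * N ^ h + i) <= D ^ h.
Proof.
elim: h pi => [|h IH] pi; first by rewrite !expn0 big_nat1.
rewrite (expnSr N) sum_split (expnSr D).
apply: (@leq_trans (\sum_(0 <= j < N ^ h) honest h (pi * N ^ h + j) * D)); last first.
  by rewrite -big_distrl /= leq_mul2r IH orbT.
apply: leq_sum => j _.
rewrite (eq_big_nat _ _ (F2 := fun i => honest h (pi * N ^ h + j) * good i)); last first.
  move=> i /andP[_ lt_i]; rewrite addnA mulnA -mulnDl honest_child //.
  by case: (honest _ _); case: (good _).
by rewrite -big_distrr /= leq_mul2l good_count orbT.
Qed.

Lemma leaf_count : \sum_(0 <= i < Z ^ 7) honest_leaf i <= D ^ t.
Proof.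
have Z2 := base_ge2 t m_gt0; have L0 := leaves_gt0 t m_gt0.
rewrite (expnSr Z 6) sum_split.
apply: (@leq_trans (\sum_(0 <= j < Z ^ 6) [&& L <= j, j < L + L & honest t j])).
  apply: leq_sum => j _.
  apply: (@leq_trans (\sum_(0 <= r < Z) (r == 1) * [&& L <= j, j < L + L & honest t j])).
    rewrite !big_nat; apply: leq_sum => r /andP[_ lt_r].
    case hl : (honest_leaf _) => //; case/and3P: hl => lt_i; rewrite /is_leaf.
    have := unpackK m_gt0 lt_i; case e: (unpack _ _ _) => [[[[[[ta pa] a1] a2] a3] a4] a5].
    move=> ei h; split_ands; subst ta a1 a2 a3 a4 a5; rewrite /pack !muln0 !addn0 in ei.
    have epa : digit m t (j * Z + r) 1 = pa by case: e.
    have lt_pa : pa < Z by rewrite -epa digit_lt.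
    have er : r = 1.
      by have := congr1 (modn^~ Z) ei; rewrite modnMDl (modn_small lt_r) [Z * _]mulnC addnC modnMDl modn_small.
    have ej : pa = j.
      by move: ei; rewrite er addnC mulnC => /addIn/eqP; rewrite eqn_pmul2r => [/eqP|]; lia.
    rewrite epa ej => ->; move: lt_pa; rewrite ej /base mul2n -addnn => ->.
    by rewrite er eqxx -ej (_ : L <= pa).
  rewrite -big_distrl /= -[X in _ <= X]mul1n leq_mul2r; apply/orP; right.
  rewrite big_mkord (bigD1 (Ordinal (Z2 : 1 < Z))) //= big1 // => r ne.
  by case: eqP => // e1; case/eqP: ne; apply: val_inj.
have le6 : L + L <= Z ^ 6.
  by rewrite addnn -mul2n -/(base m t) -{1}(expn1 Z) leq_exp2l.
rewrite (@big_cat_nat _ _ _ (L + L)) //=.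
rewrite [X in _ + X]big1_seq ?addn0; last first.
  move=> j /andP[_]; rewrite mem_index_iota => /andP[le_j _].
  by rewrite (ltnNge j) le_j andbF.
rewrite (@big_cat_nat _ _ _ L) ?leq_addr //=.
rewrite [X in X + _]big1_seq ?add0n; last first.
  by move=> j /andP[_]; rewrite mem_index_iota => /andP[_ lt_j]; rewrite leqNgt lt_j.
apply: leq_trans (honest_count t 1); rewrite mul1n.
rewrite -{1}[L]add0n big_addn addnK; apply: leq_sum => i _.
by rewrite addnC; case: (L <= _) (_ < _) => -[] //=; rewrite ?leqnn.
Qed.

Lemma cw_lt k e w : k <= m -> cw k e w < D.
Proof.
have F2 := fsize_ge2 m_gt0 => le_k.
apply: leq_ltn_trans (@codeword_le F m datum F2 datum_bit k e w) _.
apply: (@leq_ltn_trans (F.-1 ^ m)); first by rewrite leq_pexp2l //; lia.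
by rewrite ltn_exp2r //; lia.
Qed.

Section Derivation.
Variable Zs : pred nat.
Hypothesis Zs0 : Zs 0.
Hypothesis Zs_closed : closed_under (Z ^ 7) (rule V m t T Y cells x) Zs.
Hypothesis Zs_free : forall i, i < Z ^ 7 -> free V m t T x i -> Zs i.
Hypothesis Zs_leaf : forall i, honest_leaf i -> Zs i.

Definition inZ A := Zs (pack m t A).
Definition zero : node := (0, 0, 0, 0, 0, 0, 0).

Lemma binary A B C : small m t A -> small m t B -> small m t C -> A != B ->
  horn V m t T Y cells x (pack m t B == 0) A B C -> inZ A -> inZ B -> inZ C.
Proof.
move=> sA sB sC ne hr; apply: Zs_closed; rewrite ?pack_lt //.
  by rewrite /rule !packK.
by apply: contra ne => /eqP e; rewrite -(packK m_gt0 sA) e packK.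
Qed.

Lemma unary A C : small m t A -> small m t C -> A != zero ->
  horn V m t T Y cells x true A zero C -> inZ A -> inZ C.
Proof.
have Z2 := base_ge2 t m_gt0.
move=> sA sC ne hr iA.
have p0 : pack m t zero = 0 by rewrite /= !muln0.
have s0 : small m t zero by rewrite /small /=; lia.
by apply: (binary sA s0 sC ne _ iA); rewrite /inZ p0.
Qed.

Lemma from_axiom A : small m t A -> axiom V T x A -> inZ A.
Proof.
move=> sA hA; apply: Zs_free; first exact: pack_lt.
by rewrite /free packK // hA orbT.
Qed.

Lemma big_base : F <= D /\ 2 * D <= Z.
Proof.
have F2 := fsize_ge2 m_gt0; have D2 := points_ge2 m_gt0.
split; first by rewrite /points -{1}(expn1 F) leq_exp2l.
rewrite /base leq_mul2l /= /leaves; apply: (@leq_trans N); first by rewrite /inputs; nia.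
by rewrite -{1}(expn1 N) leq_exp2l // inputs_ge2.
Qed.

Lemma rank_state_lt q : rank_state (M := V) q < F.
Proof.
have h : #|state V| <= F by lia.
exact: leq_trans (ltn_ord (enum_rank q)) h.
Qed.

Lemma rank_symbol_lt a : rank_symbol (M := V) a < F.
Proof.
have h : #|{: option (bool + aux V)}| <= F by lia.
exact: leq_trans (ltn_ord (enum_rank (a : option (bool + aux V)))) h.
Qed.

Section Copy.
Variable pi : nat.
Hypothesis pi_copy : 0 < pi < L.
Hypothesis pi_child : pi * N + N <= Z.
Hypothesis children : forall w, w < D -> inZ (1, pi * N + (w * D + cw m 1 w), 0, 0, 0, 0, 0).

Lemma pi_lt : pi < Z. Proof. by rewrite /base; lia. Qed.

Lemma child_lt w : w < D -> pi * N + (w * D + cw m 1 w) < Z.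
Proof.
move=> lt_w; have lt_c := cw_lt 1 w (leqnn m); have /andP[_ lt_pi] := pi_copy.
have lt_i : w * D + cw m 1 w < N by rewrite /inputs; nia.
by apply: leq_trans pi_child; rewrite ltn_add2l.
Qed.

Ltac small := rewrite /small /=; lia.

Lemma line_holds e w a b s : e < F -> w < D -> a < D -> b < D -> s <= F ->
  (forall s, s < F -> inZ (2, pi, e, s + F * w, line_point F a b s, 0, 0)) ->
  (forall s, s < F -> s + F * w < D /\ line_point F a b s < D) ->
  inZ (3, pi, e, w, a, b, s).
Proof.
have [FD DZ] := big_base; have F2 := fsize_ge2 m_gt0; have lp := pi_lt.
move=> le lw la lb ls h hb; elim: s ls => [|s IH] ls.
  by apply: from_axiom; [small | by rewrite /= ?eqxx].
have [b1 b2] := hb s ls.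
apply: binary (IH (ltnW ls)) (h s ls); [small | small | small | by [] |].
by rewrite /horn ?eqxx ls /= ?orbT.
Qed.

(** Induction on the depth [r]: the value at the parent of [e] holds at all [F] points of the line
    over [w], the line is checked point by point, and its intercept or slope is the value at [e]. *)
Lemma codewords_hold r e w : r <= m -> 2 ^ r <= e < 2 ^ r.+1 -> w < F ^ (m - r) ->
  inZ (2, pi, e, w, cw (m - r) e w, 0, 0).
Proof.
have [FD DZ] := big_base; have F2 := fsize_ge2 m_gt0; have lp := pi_lt.
elim: r e w => [|r IH] e w le_r lt_e lt_w.
  have -> : e = 1 by lia.
  rewrite subn0 in lt_w *; rewrite -/(points m) in lt_w; have lt_c := cw_lt 1 w (leqnn m).
  have lt_ch := child_lt lt_w.
  apply: unary (children lt_w); [small | small | by [] |].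
  by rewrite /horn /zero ?eqxx lt_w lt_c; case/andP: pi_copy => -> ->.
have le_w : w < D by apply: leq_trans lt_w _; rewrite leq_pexp2l; lia.
set e' := e./2; have lt_e' : 2 ^ r <= e' < 2 ^ r.+1.
  by move: lt_e; rewrite !(expnS 2) /e'; have := odd_double_half e; lia.
have lt_F : e' < F.
  by apply: leq_trans (proj2 (andP lt_e')) _; rewrite leq_exp2l.
set k := m - r.+1; have ek : m - r = k.+1 by lia.
set a := cw k e'.*2 w; set b := cw k e'.*2.+1 w.
have la : a < D by apply: cw_lt; lia.
have lb : b < D by apply: cw_lt; lia.
have hs s : s < F -> s + F * w < F ^ (m - r).
  move=> lt_s; rewrite ek expnS; apply: (@leq_trans (F * w.+1)); first by rewrite mulnS; lia.
  by rewrite leq_mul2l lt_w orbT.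
have el s : s < F -> cw (m - r) e' (s + F * w) = line_point F a b s.
  by move=> lt_s; rewrite ek /cw codeword_line.
have hL : inZ (3, pi, e', w, a, b, F).
  apply: line_holds => // [s lt_s|s lt_s]; first by rewrite -el //; apply: IH (hs s lt_s) => //; lia.
  rewrite -el //; split; last by apply: cw_lt; lia.
  by apply: leq_trans (hs s lt_s) _; rewrite leq_pexp2l; lia.
have ee := odd_double_half e; rewrite -/e' in ee.
case: (boolP (odd e)) ee => _ ee; rewrite -ee -/k ?[true + _]add1n ?[false + _]add0n.
  rewrite -/b; apply: unary hL; [small | small | by [] |].
  by rewrite /horn /zero ?eqxx lt_F /= -mul2n ?eqxx ?orbT.
rewrite -/a; apply: unary hL; [small | small | by [] |].
by rewrite /horn /zero ?eqxx lt_F /= -mul2n ?eqxx ?orbT.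
Qed.

Lemma datum_holds i : i < F -> inZ (2, pi, F + i, 0, datum i, 0, 0).
Proof.
move=> lt_i; have := @codewords_hold m (F + i) 0 (leqnn m).
by rewrite subnn /cw /= expn0 addKn expnS -/F; apply; rewrite ?leq_addr //=; lia.
Qed.

Let w := bx x ++ y.
Let l := size y.
Local Notation cell := (cell_at V w T).
Local Notation conf := (conf_at V w T).
Local Notation head := (head_at V w T).

Lemma initial_holds p : p < cells ->
  inZ (4, pi, l, 0, p, rank_symbol (cell 0 p), 0).
Proof.
have [FD DZ] := big_base; have lp := pi_lt => lt_p.
have rl := rank_symbol_lt (cell 0 p); have ll : l <= Y by [].
case: (boolP ((T + size (bx x) <= p) && (p < T + size (bx x) + l))) => [/andP[h1 h2]|h].
  pose i := p - T - size (bx x); have lt_i : i < F by rewrite /i; lia.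
  have dl := datum_bit i; have lt_il : i < l by rewrite /i; lia.
  apply: unary (datum_holds lt_i); [small | small | by [] |].
  rewrite /horn /zero ?eqxx /= addKn leq_addr (_ : p = T + (size (bx x) + i)); last by rewrite /i; lia.
  rewrite ?eqxx lt_il.
  rewrite ltnS dl cell_init ltnNge leq_addr /= addKn (nth_map false); last by rewrite /w size_cat ltn_add2l.
  rewrite /w nth_cat ltnNge leq_addr /= addKn /datum; case: (nth false y i) => /=; by rewrite ?eqxx ?orbT.
apply: from_axiom; first by small.
rewrite /= /initial_cell h /= cell_init.
case: ifP => [/andP[h1 h2]|h3].
  rewrite ltnNge h1 /= (nth_map false); last by rewrite /w size_cat ltn_subLR //; lia.
  rewrite /w nth_cat ltn_subLR // h2; case: (nth false (bx x) (p - T)) => /=; by rewrite ?eqxx.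
case: ltnP => h4; first by rewrite ?eqxx.
rewrite nth_default ?eqxx // size_map /w size_cat; move: h h3; rewrite h4 /= -/l; lia.
Qed.

Lemma run_holds tau : tau <= T ->
  inZ (5, pi, l, tau, rank_state (cstate (conf tau)), head tau, 0) /\
  forall p, p < cells -> inZ (4, pi, l, tau, p, rank_symbol (cell tau p), 0).
Proof.
have [FD DZ] := big_base; have lp := pi_lt; have ll : l <= Y by [].
elim: tau => [_|tau IH lt_t].
  split; last exact: initial_holds.
  have rl := rank_state_lt (cstate (conf 0)); have h0 : head 0 = T by [].
  have rl' : rank_state (start V) < F := rank_state_lt _.
  apply: from_axiom; first by small.
  by rewrite /= ?eqxx.
have [hS hC] := IH (ltnW lt_t).
have h0 := @head_pos V w T tau lt_t.
have [b1 b2 _ _] := head_bounds V w (ltnW lt_t); have [b3 b4 _ _] := head_bounds V w lt_t.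
have [e1 e2 e3 _ _] := headed_step (fun _ => h0).
have lt_h : head tau < cells by lia.
have r1 := rank_state_lt (cstate (conf tau)); have r2 := rank_symbol_lt (cell tau (head tau)).
have r3 := rank_state_lt (cstate (conf tau.+1)).
split.
  apply: binary hS (hC _ lt_h); [small | small | small | by [] |].
  rewrite /horn ?eqxx lt_t /= cell_head next_stateE next_moveE e1 ?eqxx /= e2.
  by case: (_.2) => /=; rewrite ?addn0 ?addn1 ?prednK ?eqxx ?orbT.
move=> p lt_p; have r4 := rank_symbol_lt (cell tau p); have r5 := rank_symbol_lt (cell tau.+1 p).
apply: binary hS (hC _ lt_p); [small | small | small | by [] |].
rewrite /horn ?eqxx lt_t /= e3 /upd; case: (p =P head tau) => [->|ne].
  by rewrite cell_head next_symbolE ?eqxx ?orbT.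
by rewrite ?eqxx ?orbT.
Qed.

Lemma scan_holds q : q <= cells ->
  inZ (6, pi, l, q, \sum_(0 <= j < q) bit_code (cell T j), 0, 0).
Proof.
have [FD DZ] := big_base; have lp := pi_lt; have ll : l <= Y by [].
have len : 2 * T + size w + 1 < cells by rewrite size_cat -/l; lia.
have [hb hs] := (accepts_cells V len).1 accepts.
have le1 q' : q' <= cells -> \sum_(0 <= j < q') bit_code (cell T j) <= 1.
  by move=> le_q; rewrite -hs [X in _ <= X](@big_cat_nat _ _ _ q') //= leq_addr.
elim: q => [|q IH] lt_q; first by rewrite big_nil; apply: from_axiom; [small | by rewrite /= ?eqxx].
have := le1 q (ltnW lt_q); have := le1 q.+1 lt_q; rewrite big_nat_recr //= => l1 l2.
have [_ hC] := run_holds (leqnn T).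
have r2 := rank_symbol_lt (cell T q).
apply: binary (IH (ltnW lt_q)) (hC q lt_q); [small | small | small | by [] |].
by rewrite /horn ?eqxx /= symbol_classE ?eqxx hb // ?orbT.
Qed.

Lemma copy_holds : inZ (1, pi, 0, 0, 0, 0, 0).
Proof.
have [FD DZ] := big_base; have lp := pi_lt; have ll : l <= Y by [].
have len : 2 * T + size w + 1 < cells by rewrite size_cat -/l; lia.
have [hb hs] := (accepts_cells V len).1 accepts.
have := scan_holds (leqnn cells); rewrite hs.
apply: unary; [small | small | by [] |].
by rewrite /horn /zero ?eqxx ll; case/andP: pi_copy => -> ->; rewrite ?orbT.
Qed.

End Copy.

(** Induction from the bought leaves up to the root: an honest address has an honest child for each
    position of the code, the one with the value of the codeword. *)
Lemma honest_holds h pi : h <= t -> N ^ (t - h) <= pi < 2 * N ^ (t - h) ->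
  honest (t - h) pi -> inZ (1, pi, 0, 0, 0, 0, 0).
Proof.
have N2 := inputs_ge2 m_gt0; have Z2 := base_ge2 t m_gt0.
elim: h pi => [|h IH] pi le_h lt_pi hon.
  rewrite subn0 in lt_pi hon; apply: Zs_leaf.
  have lt_Z : pi < Z by case/andP: lt_pi.
  have sA : small m t (1, pi, 0, 0, 0, 0, 0) by rewrite /small /=; lia.
  have e := packK m_gt0 sA; rewrite /honest_leaf pack_lt // /is_leaf e /=.
  by case/andP: lt_pi => -> _ /=; case: e => _ -> *.
set k := t - h.+1 in lt_pi hon; have ek : t - h = k.+1 by lia.
have Nk : N ^ k.+1 <= L by rewrite /leaves leq_exp2l //; lia.
have k0 : 0 < N ^ k by rewrite expn_gt0; lia.
apply: copy_holds => [||w lt_w].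
- by rewrite expnS in Nk; nia.
- have : 2 * N ^ k.+1 <= Z by rewrite /base leq_mul2l.
  by rewrite expnS; nia.
have lt_c := cw_lt 1 w (leqnn m).
have lt_i : w * D + cw m 1 w < N by rewrite /inputs; nia.
apply: IH; first exact: ltnW.
  rewrite ek expnS; nia.
rewrite ek honest_child // hon /= /good modnMDl modn_small // divnMDl ?divn_small ?addn0 //; lia.
Qed.

Lemma root_holds : Zs (1 + Z).
Proof.
have h := @honest_holds t 1 (leqnn t); rewrite subnn expn0 in h.
by have := h isT isT; rewrite /inZ /pack !muln0 !addn0 muln1.
Qed.

End Derivation.

Lemma completeness :
  derives (Z ^ 7) (1 + Z) (rule V m t T Y cells x) (free V m t T x) honest_leaf.
Proof. by move=> Zs h0 hc hf hl; apply: root_holds. Qed.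

End Completeness.

(** * Computing the instance *)

Lemma size_block x : size (block x) = (size x).*2.+1.
Proof.
rewrite /block size_cat /= addn1; congr _.+1.
by elim: x => //= b x ->; rewrite doubleS.
Qed.

Lemma nth_block x i : nth false (block x) i =
  (i < (size x).*2) && (~~ odd i || nth false x i./2).
Proof.
rewrite /block; elim: x i => [|b x IH] [|[|i]] //=.
by rewrite IH doubleS !ltnS negbK.
Qed.

Lemma code_rat_nat n : code_rat n%:R%R = false :: code_nat n ++ false :: code_nat 1.
Proof. by rewrite /code_rat pmulrn numq_int denq_int. Qed.

Section InstanceCode.
Variables (k theta V root : nat) (rule : nat -> nat -> nat -> bool) (free leaf : pred nat).
Hypotheses (theta3 : 3 <= theta) (theta_k : theta <= k).
Hypotheses (root_lt : root < V) (root_gt0 : 0 < root).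

(** The same code as nested loops over plain numbers: a hyperedge is listed by testing every node
    for membership, a form that string expressions can produce. *)
Definition instance_code : seq bool :=
  let n := nnodes k theta V in let E := nedges V in
  code_nat n ++ code_nat E ++
  flatten [seq code_nat theta ++ code_nat k ++
     flatten [seq if mem_edge k theta V root rule j i
                  then code_nat i ++ code_rat 1 else [::] | i <- iota 0 n]
   | j <- iota 0 E] ++
  flatten [seq code_rat 1 ++ false :: code_nat (node_cost k theta V free leaf i)
            ++ false :: code_nat 1 | i <- iota 0 n].

Lemma instance_codeE :
  code_instance (gadget_instance k theta V root rule free leaf) = instance_code.
Proof.
rewrite /code_instance /instance_code; congr (_ ++ (_ ++ (_ ++ _))).
  rewrite -[iota 0 (nedges V)]val_enum_ord -map_comp; congr flatten; apply: eq_map => j.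
  rewrite /comp gadget_edge_card //; congr (_ ++ (_ ++ _)).
  rewrite -[iota 0 (nnodes k theta V)]val_enum_ord -map_comp enumT.
  rewrite {1}/enum_mem; elim: (Finite.enum _) => // i l IH.
  rewrite [filter _ _]/= [map _ (i :: l)]/= [flatten (_ :: _)]/= -IH.
  by case: ifP; rewrite inE => ->.
rewrite -[iota 0 (nnodes k theta V)]val_enum_ord -map_comp; congr flatten; apply: eq_map => i.
by rewrite [code_rat (scost i)]code_rat_nat.
Qed.

End InstanceCode.

Lemma rud_ifb C (P Q R : carrier C -> bool) : rud (fun c => (P c : nat)) ->
  rud (fun c => (Q c : nat)) -> rud (fun c => (R c : nat)) ->
  rud (fun c => ((if P c then Q c else R c) : nat)).
Proof. by move=> hP hQ hR; apply: rud_ext (rud_if hP hQ hR) => c; case: (P c). Qed.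

Ltac rud_step := first
  [ assumption
  | match goal with H : forall _ : nat, rud _ |- _ => exact: (H _) end
  | lazymatch goal with
    | |- rud (fun _ => nat_of_bool (_ || _)) => apply: rud_or
    | |- rud (fun _ => nat_of_bool (_ && _)) => apply: rud_and
    | |- rud (fun _ => nat_of_bool (~~ _)) => apply: rud_not
    | |- rud (fun _ => nat_of_bool (@eq_op _ _ _)) => apply: rud_eq
    | |- rud (fun _ => nat_of_bool (leq _ _)) => apply: rud_leq
    | |- rud (fun _ => nat_of_bool (if _ then _ else _)) => apply: rud_ifb
    | |- rud (fun _ => nat_of_bool (odd _)) => apply: rud_odd
    | |- rud (fun _ => addn _ _) => apply: rud_add
    | |- rud (fun _ => muln _ _) => apply: rud_mul
    | |- rud (fun _ => subn _ _) => apply: rud_sub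
    | |- rud (fun _ => divn _ _) => apply: rud_div
    | |- rud (fun _ => modn _ _) => apply: rud_mod
    | |- rud (fun _ => expn _ _) => apply: rud_exp
    | |- rud (fun _ => table _ _ _) => apply: rud_table
    | |- rud (fun _ => if _ then _ else _) => apply: rud_if
    | |- rud (fun _ => S _) => apply: rud_succ
    | |- _ => fail
    end
  | exact: rud_v0 | exact: rud_v1 | exact: rud_v2 | exact: rud_cst ].

Ltac rud := repeat rud_step.

Section RudRules.
Variables (V : machine) (C : context) (m t T Y cells : carrier C -> nat).
Hypotheses (hF : rud (fun c => fsize (m c))) (hD : rud (fun c => points (m c))).
Hypotheses (hN : rud (fun c => inputs (m c))) (hL : rud (fun c => leaves (m c) (t c))).
Hypotheses (hZ : rud (fun c => base (m c) (t c))) (hT : rud T) (hY : rud Y) (hcells : rud cells).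

Lemma rud_digit f i : rud (C := C) f -> rud (C := C) (fun c => digit (m c) (t c) (f c) i).
Proof. by move=> hf; rewrite /digit; rud. Qed.

Lemma rud_bx_size : rud (C := C) (fun c => size (bx (cstr c))).
Proof.
apply: rud_ext (rud_succ (rud_add rud_len rud_len)) => c.
by rewrite /bx size_block addnn.
Qed.

Lemma rud_bx_nth f : rud (C := C) f -> rud (C := C) (fun c => (nth false (bx (cstr c)) (f c) : nat)).
Proof.
move=> hf; apply: rud_ext (rud_and (rud_ltn hf (rud_add rud_len rud_len))
  (rud_or (rud_not (rud_odd hf)) (rud_at true (rud_div hf (rud_cst 2))))) => c.
rewrite /bx nth_block addnn divn2; congr (nat_of_bool (_ && (_ || _))).
have [lt|ge] := ltnP (f c)./2 (size (cstr c)).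
  by rewrite (nth_map false) //; case: nth.
by rewrite !nth_default ?size_map.
Qed.

Lemma rud_rule a b c : rud (C := C) a -> rud (C := C) b -> rud (C := C) c -> rud (C := C) (fun e =>
  (rule V (m e) (t e) (T e) (Y e) (cells e) (cstr e) (a e) (b e) (c e) : nat)).
Proof.
move=> ha hb hc; have hsz := rud_bx_size.
have da i := rud_digit i ha; have db i := rud_digit i hb; have dc i := rud_digit i hc.
rewrite /rule /unpack /horn /line_point /next_state /next_symbol /next_move /symbol_class /=.
by rud.
Qed.

Lemma rud_free a : rud (C := C) a -> rud (C := C) (fun e =>
  (free V (m e) (t e) (T e) (cstr e) (a e) : nat)).
Proof.
move=> ha; have hsz := rud_bx_size; have da i := rud_digit i ha.
rewrite /free /axiom /unpack /initial_cell /=.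
by rud; apply: rud_bx_nth; rud.
Qed.

Lemma rud_leaf a : rud (C := C) a -> rud (C := C) (fun e => (is_leaf (m e) (t e) (a e) : nat)).
Proof.
move=> ha; have da i := rud_digit i ha.
by rewrite /is_leaf /unpack /=; rud.
Qed.

Variables (k theta : nat).
Definition nlogical e := base (m e) (t e) ^ 7.
Definition root_node e := 1 + base (m e) (t e).
Definition rules e := rule V (m e) (t e) (T e) (Y e) (cells e) (cstr e).

Lemma rud_mem_edge j i : rud (C := C) j -> rud (C := C) i -> rud (C := C) (fun e =>
  (mem_edge k theta (nlogical e) (root_node e) (rules e) (j e) (i e) : nat)).
Proof.
move=> hj hi.
rewrite /mem_edge /end1 /end2 /end3 /prem1 /prem2 /fires /inner /arg1 /arg2 /arg3
  /nlogical /root_node /rules.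
by rud; apply: rud_rule; rud.
Qed.

Lemma rud_node_cost i : rud (C := C) i -> rud (C := C) (fun e =>
  node_cost k theta (nlogical e) (free V (m e) (t e) (T e) (cstr e))
    (is_leaf (m e) (t e)) (i e)).
Proof.
move=> hi; rewrite /node_cost /nnodes /nlogical.
by rud; [apply: rud_free | apply: rud_leaf].
Qed.

End RudRules.

Section SrudInstance.
Variables (V : machine) (C : context) (m t T Y cells : carrier C -> nat) (k theta : nat).
Hypotheses (hF : rud (fun c => fsize (m c))) (hD : rud (fun c => points (m c))).
Hypotheses (hN : rud (fun c => inputs (m c))) (hL : rud (fun c => leaves (m c) (t c))).
Hypotheses (hZ : rud (fun c => base (m c) (t c))) (hT : rud T) (hY : rud Y) (hcells : rud cells).

Lemma srud_instance : srud (C := C) (fun e =>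
  instance_code k theta (nlogical m t e) (root_node m t e) (rules V m t T Y cells e)
    (free V (m e) (t e) (T e) (cstr e)) (is_leaf (m e) (t e))).
Proof.
have wk (f : carrier C -> nat) : rud f -> rud (C := ext C) (fun p => f p.1) by apply: rud_wk.
have wk2 (f : carrier C -> nat) : rud f -> rud (C := ext (ext C)) (fun p => f p.1.1).
  by move=> h; apply: (rud_wk (rud_wk h)).
have hn : rud (C := C) (fun e => nnodes k theta (nlogical m t e)).
  by rewrite /nnodes /nlogical; rud.
have hE : rud (C := C) (fun e => nedges (nlogical m t e)).
  by rewrite /nedges /nlogical; rud.
rewrite /instance_code.
apply: srud_cat (srud_nat hn) (srud_cat (srud_nat hE) (srud_cat _ _)).
  apply: srud_for hE _.
  apply: srud_cat (srud_cst _) (srud_cat (srud_cst _) (srud_for (wk _ hn) _)).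
  apply: srud_if; last by apply: srud_cst.
    exact: (@rud_mem_edge V (ext (ext C)) (fun p => m p.1.1) (fun p => t p.1.1)
      (fun p => T p.1.1) (fun p => Y p.1.1) (fun p => cells p.1.1) (wk2 _ hF) (wk2 _ hD)
      (wk2 _ hN) (wk2 _ hL) (wk2 _ hZ) (wk2 _ hT) (wk2 _ hY) (wk2 _ hcells) k theta _ _
      rud_v1 rud_v0).
  by apply: srud_cat (srud_nat rud_v0) (srud_cst _).
apply: srud_for hn _.
have hcost := @rud_node_cost V (ext C) (fun p => m p.1) (fun p => t p.1)
  (fun p => T p.1) (wk _ hL) (wk _ hZ) (wk _ hT) k theta _ rud_v0.
apply: srud_cat (srud_cst _) _.
exact: (srud_cat (srud_cst [:: false]) (srud_cat (srud_nat hcost) (srud_cst (false :: code_nat 1)))).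
Qed.

End SrudInstance.

(** * Parameters *)

Lemma points_pow m : points m = 2 ^ (m * m).
Proof. by rewrite /points /fsize -expnM. Qed.

Lemma inputs_pow m : inputs m = 2 ^ (2 * (m * m)).
Proof. by rewrite /inputs points_pow -expnD mul2n addnn. Qed.

Lemma leaves_pow m t : leaves m t = 2 ^ (2 * (m * m) * t).
Proof. by rewrite /leaves inputs_pow -expnM. Qed.

Lemma base_pow m t : base m t = 2 ^ (2 * (m * m) * t).+1.
Proof. by rewrite /base leaves_pow expnS. Qed.

(** Bernoulli's inequality (1 - 1/F)^j >= 1 - j/F, cleared of denominators. *)
Lemma bernoulli F j : j <= F -> F ^ j * (F - j) <= F.-1 ^ j * F.
Proof.
elim: j => [|j IH] lt_j; first by rewrite !expn0 subn0.
rewrite !expnS; have := IH (ltnW lt_j).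
set X := F ^ j; set W := F.-1 ^ j => le_XW.
have e1 : F = F.-1.+1 by lia.
have : F.-1 * (X * (F - j)) <= F.-1 * (W * F) by rewrite leq_mul2l le_XW orbT.
have : F * X * (F - j.+1) <= F.-1 * (X * (F - j)).
  rewrite -mulnA mulnCA [F.-1 * _]mulnCA leq_mul2l; apply/orP; right.
  by rewrite {1 2}e1 (_ : F.-1.+1 - j.+1 = (F - j).-1); [nia | lia].
by move=> h1 h2; rewrite -[X in _ <= X]mulnA; apply: leq_trans h1 h2.
Qed.

Lemma gap_ge m : 0 < m -> 3 * points m <= 2 * gap m.
Proof.
move=> m0; have F2 := fsize_ge2 m0.
have lt_m : 2 * m <= fsize m.
  rewrite /fsize; elim: (m) => // n IH; rewrite expnS.
  by case: n IH => [|n] //; have := expn_gt0 2 n.+1; rewrite !expnS; lia.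
have := @bernoulli (fsize m) m; rewrite /gap /points.
set F := fsize m in F2 lt_m *; set X := F ^ m; set W := F.-1 ^ m => h.
have {}h : X * (F - m) <= W * F by apply: h; lia.
suff : X <= 2 * W by lia.
have F0 : 0 < F by lia.
rewrite -(leq_pmul2r F0); apply: (@leq_trans (2 * (X * (F - m)))); last by lia.
rewrite mulnCA leq_mul2l; apply/orP; right; lia.
Qed.

(** Two levels multiply the gap by 9/4, which exceeds 2; hence heights of the form [2 * tau.+1]. *)
Lemma gap_pow m tau : 0 < m ->
  2 ^ (m * m * (2 * tau.+1) + tau.+1) <= gap m ^ (2 * tau.+1).
Proof.
move=> m0; have := gap_ge m0; rewrite points_pow => h.
have -> : m * m * (2 * tau.+1) + tau.+1 = (2 * (m * m) + 1) * tau.+1 by lia.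
rewrite expnM [X in _ <= X]expnM leq_exp2r // expnD.
have -> : 2 ^ (2 * (m * m)) = 2 ^ (m * m) * 2 ^ (m * m) by rewrite -expnD addnn mul2n.
move: h; rewrite -mulnn; set D := 2 ^ _; set K := gap m => h; nia.
Qed.

(* Among the odd positions of the code, the first [false] ends the numerator. *)
Definition numerator_length (l : seq bool) : nat :=
  \sum_(0 <= z < size l)
    (\sum_(0 <= i < z.+1) (((2 * i).+1 < size l) && ~~ nth false l (2 * i).+1) == 0).

(** The approximate value can be exponential in the length of its code, too large for unary
    registers, so only bit lengths are compared: the numerator has fewer than [b] bits more than the
    denominator, whose length follows from the total length. *)
Definition short (l : seq bool) (b : nat) : bool :=
  4 * numerator_length l + 4 < size l + 2 * b.

Lemma size_code_nat n : size (code_nat n) = 2 * (trunc_log 2 n).+1 + 1.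
Proof. by rewrite /code_nat size_block size_map size_iota -mul2n addn1. Qed.

Lemma size_code_int z : size (code_int z) = 2 * (trunc_log 2 `|z|%N).+1 + 2.
Proof. by rewrite -[size _]/(size (code_nat _)).+1 size_code_nat; lia. Qed.

Lemma size_code_rat q :
  size (code_rat q) = 2 * (trunc_log 2 `|numq q|%N).+1 + 2 * (trunc_log 2 `|denq q|%N).+1 + 4.
Proof. by rewrite /code_rat size_cat !size_code_int; lia. Qed.

Lemma numerator_lengthE q :
  numerator_length (code_rat q) = (trunc_log 2 `|numq q|%N).+1.
Proof.
set n := `|numq q|%N; set a := (trunc_log 2 n).+1.
have sz : 2 * a + 1 < size (code_rat q).
  by rewrite size_code_rat -/n /a; lia.
have tag i : i <= a ->
    ((2 * i).+1 < size (code_rat q)) && ~~ nth false (code_rat q) (2 * i).+1 = (i == a).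
  move=> le_i; have -> : (2 * i).+1 < size (code_rat q) by lia.
  rewrite /code_rat nth_cat size_code_int -/n -/a ifT; last by lia.
  rewrite /code_int [nth _ _ _]/=.
  by rewrite /code_nat nth_block size_map size_iota -/a oddM /= andbT; lia.
rewrite /numerator_length.
rewrite (eq_big_nat _ _ (F2 := fun z => (z < a : nat))); last first.
  move=> z _; congr nat_of_bool; apply/eqP/idP => [s0|lt_z].
    rewrite ltnNge; apply/negP => le_z; move: s0.
    move/eqP; rewrite sum_nat_seq_eq0 => /allP /(_ a).
    by rewrite mem_index_iota ltnS le_z tag // eqxx => /(_ isT).
  by rewrite big_nat big1 // => i /andP[_ lt_i]; rewrite tag; lia.
by rewrite sum_ltn; lia.
Qed.

Lemma shortE q b :
  short (code_rat q) b = (trunc_log 2 `|numq q|%N < trunc_log 2 `|denq q|%N + b).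
Proof. by rewrite /short numerator_lengthE size_code_rat; lia. Qed.

Lemma nat_numq q : (0 <= q)%R -> (`|numq q|%:R = q * `|denq q|%:R)%R.
Proof.
move=> q0; rewrite !natr_absz ger0_norm ?numq_ge0 // gtr0_norm ?denq_gt0 //.
by rewrite numqE.
Qed.

(** Rounding the two logarithms down costs up to one bit, hence the shift by one here and in the
    opposite bound. *)
Lemma short_le q b : (0 <= q)%R -> (q <= (2 ^ b)%:R)%R -> short (code_rat q) b.+1.
Proof.
move=> q0 le_q; rewrite shortE; set n := `|numq q|%N; set d := `|denq q|%N.
have d0 : 0 < d by rewrite absz_gt0 denq_eq0.
have : n <= 2 ^ b * d.
  rewrite -(ler_nat rat) natrM.
  by rewrite nat_numq // ler_wpM2r ?ler0n.
move=> le_n; case: (posnP n) => [->|n0]; first by rewrite trunc_log0; lia.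
rewrite -(@ltn_exp2l 2) //; apply: leq_ltn_trans (trunc_logP (isT : 1 < 2) n0) _.
apply: leq_ltn_trans le_n _; rewrite addnS expnSr addnC expnD -mulnA ltn_pmul2l ?expn_gt0 //.
by have /= := trunc_log_ltn d (isT : 1 < 2); rewrite expnSr.
Qed.

Lemma short_ge q b : ((2 ^ b.+1)%:R <= q)%R -> ~~ short (code_rat q) b.
Proof.
move=> le_q; rewrite shortE -leqNgt; set n := `|numq q|%N; set d := `|denq q|%N.
have d0 : 0 < d by rewrite absz_gt0 denq_eq0.
have q0 : (0 <= q)%R by apply: le_trans le_q; rewrite ler0n.
have le_n : 2 ^ b.+1 * d <= n.
  rewrite -(ler_nat rat) natrM.
  by rewrite nat_numq // ler_wpM2r ?ler0n.
apply: trunc_log_max => //; apply: leq_trans le_n.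
rewrite expnD mulnC; apply: leq_mul; first by rewrite leq_exp2l.
exact: trunc_logP.
Qed.

(** * The reduction with its parameters *)

Section Reduction.
Variables (k theta : nat).
Hypotheses (theta3 : 3 <= theta) (theta_k : theta <= k).
Variables (L : seq bool -> Prop) (P : seq bool -> Prop) (V : machine) (dV dY c M0 : nat).
Hypothesis V_decides : decides V (fun s => s ^ dV + dV) P.
Hypothesis L_witness : forall x,
  L x <-> exists2 y, size y <= size x ^ dY + dY & P (block x ++ y).

Definition witness_size s := s ^ dY + dY.
Definition word_size s := 2 * s + 1 + witness_size s.
(** The power covers the running time of the verifier on all words in question; the last summand
    makes room for the word itself. *)
Definition horizon s := word_size s ^ dV + dV + word_size s.
Definition tape_size s := 3 * horizon s + 2.
(** The length 2^m of a line has to exceed the numbers of tape cells, states and symbols, so that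
    the witness and all arguments of nodes fit. [M0] leaves room for the asymptotic estimates. *)
Definition cube_dim s :=
  (trunc_log 2 (tape_size s + (#|state V| + #|{: option (bool + aux V)}| + 3))).+1 + M0.
(* The gap 2 ^ gap_exp has to beat the ratio of the approximation on instances
   with up to 2 ^ (cube_dim ^ (c + 3)) nodes. *)
Definition gap_exp s := cube_dim s ^ c.
Definition height s := 2 * (gap_exp s).+1.
Definition base_exp s := (2 * (cube_dim s * cube_dim s) * height s).+1.
(** Positive instances cost at most 2 to the first summand; the second leaves room for the error of
    the approximation. *)
Definition cutoff s := cube_dim s * cube_dim s * height s + gap_exp s.

Definition reduction x : instance :=
  let s := size x in let m := cube_dim s in let t := height s in
  gadget_instance k theta (base m t ^ 7) (1 + base m t)
    (rule V m t (horizon s) (witness_size s) (tape_size s) x)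
    (free V m t (horizon s) x) (is_leaf m t).

Lemma cube_dim_gt0 s : 0 < cube_dim s. Proof. by []. Qed.
Lemma height_gt0 s : 0 < height s. Proof. by []. Qed.

Lemma root_lt m t : 0 < m -> 1 + base m t < base m t ^ 7.
Proof.
move=> m0; have Z2 := base_ge2 t m0; set Z := base m t in Z2 *.
apply: (@leq_trans (Z ^ 2 * 2)).
  by rewrite -mulnn; nia.
apply: (@leq_trans (Z ^ 2 * Z ^ 1)); first by rewrite leq_mul2l expn1 Z2 orbT.
by rewrite -expnD leq_pexp2l //; lia.
Qed.

Lemma reduction_uniform x : unit_uniform k theta (reduction x).
Proof. by apply: gadget_unit_uniform => //; apply: root_lt. Qed.

Lemma run_accepts x y : size y <= witness_size (size x) ->
  P (block x ++ y) <-> output (run V (bx x ++ y) (horizon (size x))) = [:: true].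
Proof.
move=> le_y; have [hh ->] := V_decides (block x ++ y).
rewrite (run_stable hh) // size_cat size_block /horizon -mul2n.
apply: leq_trans (leq_addr _ _); rewrite leq_add2r.
have le_w : (2 * size x).+1 + size y <= word_size (size x) by rewrite /word_size; lia.
by case: (dV) => // d; rewrite leq_exp2r.
Qed.

Lemma horizon_ge x : size (bx x) + witness_size (size x) <= horizon (size x).
Proof. by rewrite /bx size_block /horizon /word_size -mul2n; lia. Qed.

Lemma tape_size_gt s : 3 * horizon s + 1 < tape_size s.
Proof. by rewrite /tape_size addn2 addn1. Qed.

Lemma tape_size_le s : tape_size s + #|state V| + #|{: option (bool + aux V)}| + 3 <= fsize (cube_dim s).
Proof.
set a := tape_size s + (#|state V| + #|{: option (bool + aux V)}| + 3).
apply: (@leq_trans a); first by rewrite /a; lia.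
apply: ltnW; apply: leq_trans (trunc_log_ltn a (isT : 1 < 2)) _.
by rewrite /fsize leq_exp2l //; apply: leq_addr.
Qed.

Lemma reduction_OPT_yes x : L x -> (OPT (reduction x) <= (2 ^ (cutoff (size x) - gap_exp (size x)))%:R)%R.
Proof.
move=> /L_witness[y le_y Py].
have acc := (run_accepts le_y).1 Py.
have hd := @completeness V (cube_dim (size x)) (height (size x)) _ _ _ x y isT isT
  (horizon_ge x) (tape_size_gt _) (tape_size_le _) le_y acc.
apply: le_trans (gadget_OPT_le _ _ _ _ hd _ _) _ => //; first exact: root_lt.
  by move=> i /and3P[-> ->].
rewrite ler_nat; apply: (leq_trans (leaf_count (cube_dim_gt0 _) (height_gt0 _)
  (horizon_ge x) (tape_size_gt _) (tape_size_le _) le_y)).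
rewrite points_pow -expnM leq_exp2l // /cutoff; lia.
Qed.

Lemma reduction_OPT_no x : ~ L x -> ((2 ^ (cutoff (size x)).+1)%:R <= OPT (reduction x))%R.
Proof.
move=> nL; set s := size x.
have m0 := cube_dim_gt0 s; have Z2 := base_ge2 (height s) m0.
apply: (@le_trans _ _ (gap (cube_dim s) ^ height s)%:R%R).
  rewrite ler_nat; apply: leq_trans (gap_pow _ m0).
  by rewrite leq_exp2l // /cutoff /height; lia.
apply: gadget_OPT_ge => //.
- exact: root_lt.
- apply: (@leq_trans (base (cube_dim s) (height s) ^ 1)); last first.
    by rewrite /nnodes -addnA; apply: leq_trans (leq_addr _ _); rewrite leq_pexp2l //; lia.
  rewrite expn1 /base /leaves; apply: leq_trans (leq_pmull _ (isT : 0 < 2)).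
  rewrite leq_exp2r // /gap /inputs; have D2 := points_ge2 m0.
  apply: (@leq_trans (2 * points (cube_dim s))); last by rewrite leq_mul2r D2 orbT.
  rewrite mul2n -addnn leq_add2l /points leq_exp2r //; lia.
- move=> p hp hd; apply: soundness hd => //.
  + exact: horizon_ge.
  + exact: tape_size_gt.
  + by move=> y le_y /(run_accepts le_y) Py; apply: nL; apply/L_witness; exists y.
  + by move=> i /hp /and3P[-> ->].
Qed.

Section Expressions.
Variable C : context.

Lemma rud_witness_size : rud (C := C) (fun e => witness_size (size (cstr e))).
Proof. by rewrite /witness_size; have := @rud_len C => ?; rud. Qed.

Lemma rud_horizon : rud (C := C) (fun e => horizon (size (cstr e))).
Proof.
have hw := rud_witness_size; have hl := @rud_len C.
by rewrite /horizon /word_size; rud.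
Qed.

Lemma rud_tape_size : rud (C := C) (fun e => tape_size (size (cstr e))).
Proof. by have h := rud_horizon; rewrite /tape_size; rud. Qed.

Lemma rud_cube_dim : rud (C := C) (fun e => cube_dim (size (cstr e))).
Proof.
have h := rud_tape_size; rewrite /cube_dim; rud.
by apply: rud_log; rud.
Qed.

Lemma rud_gap_exp : rud (C := C) (fun e => gap_exp (size (cstr e))).
Proof. by have h := rud_cube_dim; rewrite /gap_exp; rud. Qed.

Lemma rud_height : rud (C := C) (fun e => height (size (cstr e))).
Proof. by have h := rud_gap_exp; rewrite /height; rud. Qed.

Lemma rud_base_exp : rud (C := C) (fun e => base_exp (size (cstr e))).
Proof. by have h := rud_cube_dim; have h' := rud_height; rewrite /base_exp; rud. Qed.

Lemma rud_cutoff : rud (C := C) (fun e => cutoff (size (cstr e))).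
Proof.
have h := rud_cube_dim; have h' := rud_height; have h2 := rud_gap_exp.
by rewrite /cutoff; rud.
Qed.

End Expressions.

(** The variable supplies 2^[base_exp], which no polynomially bounded expression could produce. It
    dominates the other powers in the construction and so makes them definable. *)
Definition with_base := @Context (seq bool) id
  (fun x => [:: base (cube_dim (size x)) (height (size x))]).

Lemma rud_fsize_pow (f : seq bool -> nat) : (forall x, f x <= base_exp (size x)) ->
  rud (C := with_base) f -> rud (C := with_base) (fun x => 2 ^ f x).
Proof.
move=> le_f hf; apply: (@rud_pow with_base f (fun x => base (cube_dim (size x)) (height (size x)))) hf _.
  by move=> x; rewrite base_pow leq_exp2l.
by exists (Var 0).
Qed.

Lemma reduction_sexp : exists w, forall x,
  evals x [:: 2 ^ base_exp (size x)] w = code_instance (reduction x).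
Proof.
have hm : rud (C := with_base) (fun x => cube_dim (size x)) := rud_cube_dim with_base.
have ht : rud (C := with_base) (fun x => height (size x)) := rud_height with_base.
have hF : rud (C := with_base) (fun x => fsize (cube_dim (size x))).
  apply: rud_fsize_pow hm => x; rewrite /base_exp /height; have := cube_dim_gt0 (size x); nia.
have hD : rud (C := with_base) (fun x => points (cube_dim (size x))).
  have mm := rud_mul hm hm; apply: (rud_ext (C := with_base)) (rud_fsize_pow _ mm) => x.
    by rewrite points_pow.
  rewrite /base_exp /height; set a := cube_dim _ * cube_dim _; nia.
have hN : rud (C := with_base) (fun x => inputs (cube_dim (size x))) := rud_mul hD hD.
have hL : rud (C := with_base) (fun x => leaves (cube_dim (size x)) (height (size x))).
  have mm := rud_mul (rud_mul (rud_cst 2) (rud_mul hm hm)) ht.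
  apply: (rud_ext (C := with_base)) (rud_fsize_pow _ mm) => x.
    by rewrite leaves_pow.
  exact: leqnSn.
have hZ : rud (C := with_base) (fun x => base (cube_dim (size x)) (height (size x))).
  by exists (Var 0).
have [w hw] := @srud_instance V with_base (fun x => cube_dim (size x)) (fun x => height (size x))
  (fun x => horizon (size x)) (fun x => witness_size (size x)) (fun x => tape_size (size x))
  k theta hF hD hN hL hZ (rud_horizon with_base) (rud_witness_size with_base)
  (rud_tape_size with_base).
exists w => x; rewrite -base_pow; apply: etrans (hw x) _.
by rewrite instance_codeE //; apply: root_lt.
Qed.

Definition answer := @Context (seq bool * nat) fst (fun p => [:: p.2]).

Lemma short_expr : rud (C := answer) (fun p => (short p.1 p.2 : nat)).
Proof.
have hl := @rud_len answer.
have hl1 := rud_wk hl; have hl2 := rud_wk hl1.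
have hb : rud (C := answer) snd by exists (Var 0).
have odd_pos : rud (C := ext (ext answer)) (fun p => (2 * p.2).+1) by rud.
have hn : rud (C := answer) (fun p => numerator_length p.1).
  rewrite /numerator_length; apply: rud_sum => //.
  apply: rud_eq; last exact: rud_cst.
  apply: rud_sum; first by rud.
  apply: rud_and; first exact: rud_ltn.
  apply: rud_not; apply: rud_ext (rud_at true odd_pos) => p /=.
  have [lt|ge] := ltnP (2 * p.2).+1 (size p.1.1.1).
    by rewrite (nth_map false) //; case: nth.
  by rewrite !nth_default ?size_map.
by rewrite /short; rud.
Qed.

Lemma reduction_decides fA (A : machine) dA : computes A (fun s => s ^ dA + dA) fA ->
  (forall x, L x <-> short (fA (code_instance (reduction x))) (cutoff (size x))) ->
  exists M d, decides M (fun s => (s + 2 + 2 ^ base_exp s) ^ d) L.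
Proof.
move=> hA hL; pose input := @Context (seq bool) id (fun _ => [::]).
have [eW hW] := rud_base_exp input; have [eT hT] := rud_cutoff input.
have [w hw] := reduction_sexp; have [eAcc hAcc] := short_expr.
have [M [d hM]] := pipeline_decides eT eAcc w hA hW.
exists M, d => x; have [hh hx] := hM x; split=> //; rewrite -hx hL /final_value.
rewrite (hW x) (hT x) hw (hAcc (_, _)) /=.
by case: short.
Qed.

(** The number of nodes is roughly the cube of [base ^ 7], whence 21. With X = m^c and Y = m^2 the
    left side is 84 X Y + 84 Y + 24 + k, and 192 = 84 + 84 + 24. *)
Lemma base_exp_le s : 192 + k <= M0 -> 21 * base_exp s + k + 3 <= cube_dim s ^ (c + 3).
Proof.
move=> le_M; have : 192 + k <= cube_dim s by apply: leq_trans le_M _; apply: leq_addl.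
rewrite /base_exp /height /gap_exp; set m := cube_dim s => le_m.
have m0 : 0 < m ^ c by rewrite expn_gt0; case: (m) le_m.
rewrite addnC expnD mulnC; set X := m ^ c in m0 *.
have -> : m ^ 3 = m * (m * m) by rewrite !expnS expn0; lia.
set Y := m * m; have Y0 : 0 < Y by rewrite /Y; nia.
have le1 : Y <= X * Y by nia.
have le2 : (192 + k) * (X * Y) <= m * (X * Y) by rewrite leq_mul2r le_m orbT.
have e1 : 2 * Y * (2 * X.+1) = 4 * (X * Y) + 4 * Y by lia.
rewrite mulnDl in le2; rewrite e1 mulnCA; set Q := X * Y in le1 le2 *.
have : k <= k * Q by rewrite leq_pmulr // (leq_trans Y0).
lia.
Qed.

Lemma reduction_nodes x : 192 + k <= M0 ->
  cube_dim (size x) <= nodes (reduction x) <= 2 ^ (cube_dim (size x) ^ (c + 3)).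
Proof.
move=> le_M; have le_e := base_exp_le (size x) le_M.
rewrite /= /nnodes base_pow -[(2 * _ * _).+1]/(base_exp (size x)).
set e := base_exp (size x) in le_e *; apply/andP; split.
  apply: (@leq_trans (2 ^ e)); last first.
    rewrite -addnA; apply: leq_trans (leq_addr _ _).
    by rewrite -expnM leq_exp2l //; lia.
  apply: ltnW; apply: leq_trans (ltn_expl _ (isT : 1 < 2)) _; rewrite leq_exp2l //.
  by rewrite /e /base_exp /height; have := cube_dim_gt0 (size x); nia.
apply: (@leq_trans (2 ^ (21 * e + (k + 3)))); last by rewrite leq_exp2l // addnA.
have -> : 21 * e = e * 7 * 3 by lia.
rewrite expnD expnM -expnM; set X := 2 ^ (e * 7).
have X0 : 0 < X by rewrite expn_gt0.
have le1 : X <= X ^ 3 by rewrite -[X in X <= _]expn1 leq_pexp2l.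
have X30 : 0 < X ^ 3 by rewrite expn_gt0 X0.
have lt_k : k + 3 <= 2 ^ (k + 3) by apply: ltnW; apply: ltn_expl.
(* The three summands of [nnodes] are at most 1, [theta] and [ninner] times [X ^ 3]. *)
apply: (@leq_trans (X ^ 3 * (k + 3))); last by rewrite leq_mul2l lt_k orbT.
have -> : k + 3 = (k - theta + 2) + theta + 1 by lia.
have : theta <= X ^ 3 * theta by rewrite leq_pmull.
by rewrite /nextra /ninner !mulnDr; lia.
Qed.

Lemma cube_dim_log : exists a, forall s, 1 < s -> cube_dim s <= a * trunc_log 2 s.
Proof.
have [a ha] : poly_bounded (fun s =>
    tape_size s + (#|state V| + #|{: option (bool + aux V)}| + 3)).
  by rewrite /tape_size /horizon /word_size /witness_size; pb.
exists (2 * a + 1 + M0) => s s1; set l := trunc_log 2 s.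
have l0 : 0 < l by rewrite /l; apply: trunc_log_max => //.
suff : trunc_log 2 (tape_size s + (#|state V| + #|{: option (bool + aux V)}| + 3)) <= a * l.+1.
  by rewrite /cube_dim; nia.
apply: leq_trans (leq_trunc_log 2 (ha s s1)) _.
rewrite -ltnS -(@ltn_exp2l 2) //; apply: leq_ltn_trans (trunc_logP (isT : 1 < 2) _) _.
  by rewrite expn_gt0; case: (s) s1.
apply: (@leq_ltn_trans (2 ^ (a * l.+1))); last by rewrite ltn_exp2l.
by rewrite mulnC expnM; apply: leq_pow; apply: ltnW; apply: trunc_log_ltn.
Qed.

(** Since [cube_dim] is at most [a] times the logarithm, one extra power of the logarithm absorbs
    the constants [d] and [a ^ (c + 3)]. *)
Lemma reduction_time d : 192 + k <= M0 -> exists l0, forall s, l0 <= trunc_log 2 s ->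
  (s + 2 + 2 ^ base_exp s) ^ d <= 2 ^ (trunc_log 2 s ^ (c + 4)).
Proof.
move=> le_M; have [a ha] := cube_dim_log.
exists (2 * d * a ^ (c + 3) + 2) => s; set l := trunc_log 2 s => le_l.
have s1 : 1 < s.
  by rewrite ltnNge; apply/negP => s1; move: le_l; rewrite /l; case: (s) s1 => [|[|//]] _;
    rewrite ?trunc_log0 ?trunc_log1; lia.
have le_e := base_exp_le s le_M.
have lt_s : s + 2 <= 2 ^ base_exp s.
  apply: (@leq_trans (2 ^ cube_dim s)).
    apply: leq_trans (tape_size_le s); rewrite /tape_size /horizon /word_size; lia.
  by rewrite leq_exp2l // /base_exp /height; have := cube_dim_gt0 s; nia.
apply: (@leq_trans ((2 ^ (base_exp s).+1) ^ d)).
  by apply: leq_pow; rewrite expnS; lia.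
rewrite -expnM leq_exp2l //.
apply: (@leq_trans ((cube_dim s) ^ (c + 3) * d)); first by rewrite leq_mul2r; lia.
apply: (@leq_trans ((a * l) ^ (c + 3) * d)).
  by rewrite leq_mul2r leq_pow ?orbT // ha.
have -> : l ^ (c + 4) = l ^ (c + 3) * l by rewrite -expnSr addnS.
by rewrite expnMn mulnAC mulnC leq_mul2l; apply/orP; right; lia.
Qed.

End Reduction.

(* Asymptotic estimates and the conclusion *)
From mathcomp Require Import classical_sets reals topology normedtype.
From mathcomp Require Import sequences landau exp.
Import numFieldNormedType.Exports.
Local Open Scope classical_set_scope.
Local Open Scope ring_scope.

Lemma eqO_eventually (R : realType) (f g : nat -> R) : f =O_\oo g <->
  exists2 C : R, 0 < C & exists n0, forall n, (n0 <= n)%N -> `|f n| <= C * `|g n|.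
Proof.
rewrite eqO_exP; split=> -[C C0].
  by move=> [n0 _ h]; exists C => //; exists n0 => n /h.
by move=> [n0 h]; exists C => //; exists n0 => // n /h.
Qed.

Lemma ln2_gt0 (R : realType) : 0 < ln (2 : R).
Proof. by rewrite ln_gt0 // ltr1n. Qed.

Lemma log2_pow (R : realType) e : log2 ((2 ^ e)%N%:R : R) = e%:R.
Proof.
by rewrite /log2 natrX lnXn ?ltr0n // -[_ *+ e]mulr_natl mulfK // gt_eqF // ln2_gt0.
Qed.

Lemma ler_log2 (R : realType) (a b : nat) : (0 < a)%N -> (a <= b)%N ->
  log2 (a%:R : R) <= log2 b%:R.
Proof.
move=> a0 le_ab; rewrite ler_pM2r ?invr_gt0 ?ln2_gt0 // ler_ln ?ler_nat // posrE ltr0n //.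
exact: leq_trans le_ab.
Qed.

Lemma quasipoly_eqO (R : realType) (T : nat -> nat) l0 c :
  (forall s, l0 <= trunc_log 2 s -> T s <= 2 ^ (trunc_log 2 s ^ c))%N ->
  (fun s => (T s)%:R : R) =O_\oo (fun s => s%:R `^ (log2 (s%:R : R) ^+ c)).
Proof.
move=> hT; apply/eqO_eventually; exists 1 => //; exists (2 ^ l0.+1)%N => s le_s.
have s0 : (0 < s)%N by apply: leq_trans le_s; rewrite expn_gt0.
have le_l : (l0.+1 <= trunc_log 2 s)%N by apply: trunc_log_max.
set l := trunc_log 2 s in le_l.
have s2 : (2 <= s)%N.
  by apply: leq_trans le_s; rewrite expnS leq_pmulr // expn_gt0.
rewrite mul1r normr_nat ger0_norm ?powR_ge0 //.
apply: (@le_trans _ _ (2 ^ (l ^ c))%N%:R).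
  by rewrite ler_nat; apply: hT; apply: ltnW.
have le_log : l%:R <= log2 (s%:R : R).
  rewrite -(log2_pow R l) ler_log2 ?expn_gt0 //; exact: trunc_logP.
rewrite natrX; apply: (@le_trans _ _ (s%:R `^ (l ^ c)%N%:R)).
  by rewrite powR_mulrn ?ler0n // lerXn2r ?nnegrE ?ler0n // ler_nat.
by apply: ler_powR; rewrite ?ler1n // natrX lerXn2r // nnegrE ?ler0n // (le_trans _ le_log).
Qed.

(** As log n is at most m^(c+3), its power is at most m^((c+3)(1-xi)), and hence at most m^(c-1)
    once c xi >= 4. The factor m that is left beats the constant hidden in the O. *)
Lemma ratio_bound (R : realType) (xi : R) (rho : nat -> R) : 0 < xi ->
  rho =O_\oo (fun n : nat => 2 `^ (log2 (n%:R : R) `^ (1 - xi))) ->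
  exists c M0, forall m n, (M0 <= m)%N -> (m <= n)%N -> (n <= 2 ^ (m ^ (c + 3)))%N ->
    rho n <= (2 ^ (m ^ c).-1)%N%:R.
Proof.
move=> xi0 /eqO_eventually[C C0 [n0 hrho]].
(* A smaller xi only enlarges the exponent, and [1 - xi'] is nonnegative, so that the power is
   monotone in its base. *)
pose xi' := Order.min xi (1 / 2).
have xi'0 : 0 < xi' by rewrite lt_min xi0 divr_gt0.
have [le_xi le_h] : xi' <= xi /\ xi' <= 1 / 2.
  by rewrite !ge_min !lexx orbT.
pose c := (Num.truncn (4 / xi')).+1.
have hc : 4 <= c%:R * xi'.
  by rewrite -ler_pdivrMr // ltW // truncnS_gt.
pose K := (Num.truncn C).+1.
have hK : C <= (2 ^ K)%N%:R.
  apply: le_trans (ltW (truncnS_gt C)) _; rewrite ler_nat; exact: ltnW (ltn_expl _ _).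
(* [m >= K + 2] yields K + m^(c-1) < m^c; [n0] is where the O-estimate starts. *)
exists c, (maxn n0 (K + 2)) => m n; rewrite geq_max => /andP[le_n0 le_K] le_mn le_n.
have n0n := leq_trans le_n0 le_mn.
apply: le_trans (ler_norm _) (le_trans (hrho n n0n) _).
have m2 : (2 <= m)%N by lia.
have n2 : (2 <= n)%N by lia.
have log1 : 1 <= log2 (n%:R : R).
  by have := @ler_log2 R (2 ^ 1) n isT n2; rewrite log2_pow.
have log_le : log2 (n%:R : R) <= (m ^ (c + 3))%N%:R.
  by rewrite -(log2_pow R (m ^ _)) ler_log2 //; lia.
have exp_le : log2 (n%:R : R) `^ (1 - xi) <= (m ^ c.-1)%N%:R.
  apply: le_trans (_ : _ <= log2 n%:R `^ (1 - xi')) _.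
    by apply: ler_powR => //; rewrite lerB.
  apply: le_trans (_ : _ <= (m ^ (c + 3))%N%:R `^ (1 - xi')) _.
    apply: ge0_ler_powR; rewrite ?nnegrE ?ler0n ?(le_trans _ log1) //.
    by rewrite subr_ge0 (le_trans le_h) // ler_pdivrMr // mul1r ler1n.
  rewrite !natrX -!powR_mulrn ?ler0n // -powRrM; apply: ler_powR; first by rewrite ler1n; lia.
  have -> : (c + 3)%N%:R = c%:R + 3 :> R by rewrite natrD.
  have -> : c.-1%:R = c%:R - 1 :> R by rewrite -[in RHS](@prednK c) // -natr1 addrK.
  by lra.
rewrite ger0_norm ?powR_ge0 //.
apply: (@le_trans _ _ ((2 ^ K)%N%:R * (2 ^ (m ^ c.-1))%N%:R)).
  apply: ler_pM; rewrite ?powR_ge0 ?(ltW C0) //.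
  by rewrite natrX -powR_mulrn // ler_powR // ler1n.
rewrite -natrM -expnD ler_nat leq_exp2l //.
have -> : (m ^ c = m * m ^ c.-1)%N by rewrite -expnS.
have X0 : (0 < m ^ c.-1)%N by rewrite expn_gt0 (leq_trans _ m2).
set X := (m ^ c.-1)%N in X0 *; have : ((K + 2) * X <= m * X)%N by rewrite leq_mul2r le_K orbT.
have : (K <= K * X)%N by rewrite leq_pmulr.
rewrite mulnDl; move: X0 (m * X)%N (K * X)%N; clear; lia.
Qed.

Theorem proposition2 (R : realType) (k theta : nat)
    (h_theta : (3 <= theta)%N) (h_k : (theta <= k)%N) :
  exists alpha : R, 1 < alpha /\
    (~ NP_sub_quasipoly R ->
     forall xi : R, 0 < xi ->
     forall rho : nat -> R,
       rho =O_\oo (fun n : nat => alpha `^ (log2 (n%:R : R) `^ (1 - xi))) ->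
       ~ OPT_approximable (unit_uniform k theta) rho).
Proof.
exists 2; split; first by rewrite ltr1n.
(* By contraposition: an approximation within [rho] decides every language in NP in quasi-polynomial
   time. *)
move=> hard xi xi0 rho hrho [fA [A [dA hA]] happrox]; apply: hard => L.
move=> [P [V [dV hV]] [dY hL]].
have [c [M1 hrat]] := ratio_bound xi0 hrho.
pose M0 := maxn M1 (192 + k).
have le_M : (192 + k <= M0)%N by rewrite leq_max leqnn orbT.
have accept x : L x <-> short (fA (code_instance (reduction k theta V dV dY c M0 x)))
    (cutoff V dV dY c M0 (size x)).
  set I := reduction _ _ _ _ _ _ _ _; set b := cutoff _ _ _ _ _ _.
  have uI : unit_uniform k theta I := reduction_uniform h_theta h_k V dV dY c M0 x.
  have [q [-> le_q q_le]] := happrox I uI.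
  have OPT0 : 0 <= OPT I.
    have [S _ ->] := OPT_attained I; apply: sumr_ge0 => i _.
    by have [[_ _ _ h _] _ _ _ _] := uI; apply: h.
  split=> [Lx|sh].
    have le_O := reduction_OPT_yes h_theta h_k c M0 hV hL Lx.
    have m0 : (0 < gap_exp V dV dY c M0 (size x))%N.
      by rewrite expn_gt0 cube_dim_gt0.
    have le_g : (gap_exp V dV dY c M0 (size x) <= b)%N by rewrite /b /cutoff leq_addl.
    (* The bit-length test separates values up to 2^(b-1) from values of at least 2^(b+1). For [x]
       in [L], the ratio is at most 2 to [gap_exp - 1] and the optimum at most 2 to [b - gap_exp],
       and these exponents add up to b - 1. *)
    have -> : b = b.-1.+1 by lia.
    apply: short_le; first exact: le_trans le_q.
    rewrite -(ler_rat R) ratr_nat; apply: (le_trans q_le).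
    have /andP[le1 le2] := reduction_nodes h_theta h_k V dV dY c x le_M.
    have M1m : (M1 <= cube_dim V dV dY M0 (size x))%N.
      apply: leq_trans (leq_maxl M1 (192 + k)) _; exact: leq_addl.
    have hr := hrat _ _ M1m le1 le2.
    apply: (@le_trans _ _ ((2 ^ (gap_exp V dV dY c M0 (size x)).-1)%N%:R *
        (2 ^ (b - gap_exp V dV dY c M0 (size x)))%N%:R)).
      apply: (le_trans (ler_wpM2r _ hr)); first by rewrite ler0q.
      by rewrite ler_wpM2l // -(ratr_nat R) ler_rat.
    by rewrite -natrM -expnD ler_nat leq_exp2l //; lia.
  have [//|nL] := pselect (L x).
  have le_O := reduction_OPT_no h_theta h_k c M0 hV hL nL.
  by have := short_ge (le_trans le_O le_q); rewrite sh.
have [M [d hM]] := reduction_decides h_theta h_k hA accept.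
have [l0 hl] := reduction_time h_theta h_k V dV dY c d le_M.
exists (c + 4)%N, M, (fun s => (s + 2 + 2 ^ base_exp V dV dY c M0 s) ^ d)%N; split=> //.
exact: quasipoly_eqO hl.
Qed.
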